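(* Let $M$ be a manifold and $S$ a compact manifold with a fixed volume form $\mu$. The diffeomorphism group $\operatorname{Diff}(S)$ acts transitively from the right on the level sets of the left momentum map $$\mathbf J_L:T^*\operatorname{Emb}(S,M)^\times\to\mathfrak X(M)^*,\qquad\langle\mathbf J_L(P\mu),X\rangle=\int_SP\cdot(X\circ Q)\,\mu,\quad Q=\pi\circ P.$$
   Context: $S$ has no boundary. $\operatorname{Emb}(S,M)$ is the Fréchet manifold of smooth embeddings of $S$ into $M$. The regular part of $T^*\operatorname{Emb}(S,M)$ consists of the $1$-form densities $P\mu$ where $P:S\to T^*M$ is a smooth map over an embedding $Q=\pi\circ P$, with $\pi:T^*M\to M$ the projection; $T^*\operatorname{Emb}(S,M)^\times$ is the open subset of those $P\mu$ with $P(s)\ne0$ for all $s\in S$. The right action of $\operatorname{Diff}(S)$ is the cotangent lift of $Q\mapsto Q\circ\psi$, namely $\psi\cdot(P\mu)=(P\circ\psi)\,\psi^*\mu$, where $\mu$ is regarded as a density. *)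

(* Defs.v *)
From HB Require Import structures.
From mathcomp Require Import all_boot all_order all_algebra.
From mathcomp Require Import all_classical all_reals all_analysis.
Set Implicit Arguments.
Unset Strict Implicit.
Unset Printing Implicit Defensive.
Import Order.TTheory GRing.Theory Num.Theory.
Import numFieldNormedType.Exports.
Local Open Scope classical_set_scope.
Local Open Scope ring_scope.

(* For U open: all iterated directional derivatives of f exist and are
   continuous on U, i.e. f is C^oo on U. *)
Definition smooth_on (R : realType) (n : nat) (V : normedModType R)
    (U : set 'rV[R]_n) (f : 'rV[R]_n -> V) : Prop :=
  forall (vs : seq 'rV[R]_n) (x : 'rV[R]_n), U x ->
    let g := foldr (fun v h => 'D_v h) f vs in
    {for x, continuous g} /\ (forall v, derivable g x v).

(* Lebesgue integral over R^n, written as an iterated integral; it is only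
   applied below to continuous compactly supported functions. *)
Fixpoint integral_rV (R : realType) (n : nat) : ('rV[R]_n -> R) -> R :=
  match n with
  | 0 => fun f => f 0
  | n'.+1 => fun f : 'rV[R]_(1 + n') -> R =>
      \int[@lebesgue_measure R]_t
        integral_rV (fun y : 'rV[R]_n' => f (row_mx (const_mx t) y))
  end.

(* Both maps are total; only the restrictions [chart_dom -> chart_im] and
   [chart_im -> chart_dom] are meaningful. *)
Record chart (R : realType) (T : topologicalType) (n : nat) := Chart {
  chart_dom : set T;
  chart_map :> T -> 'rV[R]_n;
  chart_inv : 'rV[R]_n -> T;
  chart_dom_open : open chart_dom;
  chart_im_open : open (chart_map @` chart_dom);
  chart_mapK : forall x, chart_dom x -> chart_inv (chart_map x) = x;
  chart_map_continuous :
    forall x, chart_dom x -> {for x, continuous chart_map};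
  chart_inv_continuous :
    forall x, chart_dom x -> {for chart_map x, continuous chart_inv} }.

Definition chart_im (R : realType) (T : topologicalType) (n : nat)
  (c : chart R T n) : set 'rV[R]_n := c @` chart_dom c.

(* f, read in the chart c, is C^oo on the part of the open set A covered
   by c. *)
Definition smooth_in_chart (R : realType) (T : topologicalType) (n : nat)
    (V : normedModType R) (c : chart R T n) (A : set T) (f : T -> V) : Prop :=
  smooth_on (c @` (chart_dom c `&` A)) (f \o chart_inv c).

(* The atlas need not be maximal: every notion below depends only on the
   smooth structure it generates. *)
Record manifold (R : realType) (n : nat) := Manifold {
  manifold_sort :> topologicalType;
  manifold_hausdorff : hausdorff_space manifold_sort;
  manifold_second_countable : @second_countable manifold_sort;
  atlas : set (chart R manifold_sort n);
  atlas_cover : forall x, exists2 c, atlas c & chart_dom c x;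
  atlas_smooth : forall c d, atlas c -> atlas d ->
    smooth_in_chart c (chart_dom d) d }.

Definition smooth_map (R : realType) (m n : nat)
    (N : manifold R m) (M : manifold R n) (f : N -> M) : Prop :=
  continuous f /\
  forall c d, atlas c -> atlas d ->
    smooth_in_chart c (f @^-1` chart_dom d) (d \o f).

Definition diffeomorphism (R : realType) (m : nat) (S : manifold R m) :
    set (S -> S) :=
  [set f | smooth_map f /\
    exists g : S -> S, [/\ smooth_map g, cancel f g & cancel g f]].

Definition chart_at (R : realType) (n : nat) (M : manifold R n) (x : M) :
  chart R M n := sval (cid2 (atlas_cover x)).

(* T_x M is R^n through the coordinates of the chart [chart_at x] selected at
   x; [tangent_coord] and [coord_vector] below convert from and to the
   coordinates of an arbitrary chart, by the Jacobian of the transition map.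
   T*_x M is the dual, in the dual coordinates, with the duality [pairing]. *)
Definition tangent (R : realType) (n : nat) (M : manifold R n) (x : M) : Type :=
  'rV[R]_n.

Definition cotangent (R : realType) (n : nat) (M : manifold R n) (x : M) :
  Type := 'cV[R]_n.

Definition pairing (R : realType) (n : nat) (M : manifold R n) (x : M)
  (p : cotangent x) (v : tangent x) : R :=
  ((v : 'rV[R]_n) *m (p : 'cV[R]_n)) 0 0.

Definition tangent_coord (R : realType) (n : nat) (M : manifold R n)
    (c : chart R M n) (x : M) (v : tangent x) : 'rV[R]_n :=
  'D_v (c \o chart_inv (chart_at x)) (chart_at x x).

(* The coordinate vector d/dc^i at x. *)
Definition coord_vector (R : realType) (n : nat) (M : manifold R n)
    (c : chart R M n) (x : M) (i : 'I_n) : tangent x :=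
  'D_(delta_mx 0 i) (chart_at x \o chart_inv c) (c x).

(* The components p(d/dc^i) of a covector p. *)
Definition cotangent_coord (R : realType) (n : nat) (M : manifold R n)
    (c : chart R M n) (x : M) (p : cotangent x) : 'rV[R]_n :=
  \row_i pairing p (coord_vector c x i).

Definition tangent_map (R : realType) (m n : nat)
    (N : manifold R m) (M : manifold R n) (f : N -> M) (x : N)
    (v : tangent x) : tangent (f x) :=
  'D_v (chart_at (f x) \o f \o chart_inv (chart_at x)) (chart_at x x).

Record vector_field (R : realType) (n : nat) (M : manifold R n) := VectorField {
  vector_field_val :> forall x : M, tangent x;
  vector_field_smooth : forall c, atlas c ->
    smooth_in_chart c setT (fun x => tangent_coord c (vector_field_val x)) }.

Definition embedding (R : realType) (m n : nat)
    (S : manifold R m) (M : manifold R n) (Q : S -> M) : Prop :=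
  [/\ smooth_map Q,
      forall s, injective (@tangent_map R m n S M Q s),
      injective Q &
      forall U : set S, open U ->
        exists2 V : set M, open V & Q @` U = V `&` range Q].

Definition cotangent_bundle (R : realType) (n : nat) (M : manifold R n) : Type :=
  {x : M & cotangent x}.

Definition cotangent_proj (R : realType) (n : nat) (M : manifold R n)
  (p : cotangent_bundle M) : M := projT1 p.

(* Smoothness of P : S -> T*M in the charts (c \o pi, cotangent_coord c) of
   T*M induced by the charts c of M; by the first clause the relevant domains
   are open. *)
Definition smooth_cotangent_map (R : realType) (m n : nat)
    (S : manifold R m) (M : manifold R n) (P : S -> cotangent_bundle M) :
    Prop :=
  smooth_map (@cotangent_proj R n M \o P) /\
  forall c d, atlas c -> atlas d ->
    smooth_in_chart c ((@cotangent_proj R n M \o P) @^-1` chart_dom d)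
      (fun s => cotangent_coord d (projT2 (P s))).

Definition is_volume_form (R : realType) (m : nat) (S : manifold R m)
    (mu : forall s : S, ('I_m -> tangent s) -> R) : Prop :=
  [/\ forall (s : S) (v : 'I_m -> tangent s) (i : 'I_m) (a : R)
             (u w : tangent s),
        let v_ (x : tangent s) := fun j => if j == i then x else v j in
        mu s (v_ (a *: u + w)) = a * mu s (v_ u) + mu s (v_ w),
      forall (s : S) (v : 'I_m -> tangent s) (i j : 'I_m),
        i != j -> v i = v j -> mu s v = 0,
      forall s : S, exists v, mu s v != 0 &
      forall c, atlas c ->
        smooth_in_chart c setT (fun s => mu s (coord_vector c s) : R^o)].

Record volume_form (R : realType) (m : nat) (S : manifold R m) := VolumeForm {
  volume_form_val :> forall s : S, ('I_m -> tangent s) -> R;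
  volume_formP : is_volume_form volume_form_val }.

(* A density is a function of m tangent vectors scaling by |det| under linear
   substitutions; this property is not recorded in the type, but all the
   densities used below derive from |mu|. *)
Definition density (R : realType) (m : nat) (S : manifold R m) : Type :=
  forall s : S, ('I_m -> tangent s) -> R.

Definition density_of (R : realType) (m : nat) (S : manifold R m)
  (mu : volume_form S) : density S := fun s v => `|mu s v|.

Definition density_pullback (R : realType) (m : nat) (S : manifold R m)
    (psi : S -> S) (rho : density S) : density S :=
  fun s v => rho (psi s) (fun i => tangent_map psi (v i)).

(* Finite partitions of unity subordinate to the atlas; they exist because
   only compact S are considered. *)
Record partition_of_unity (R : realType) (m : nat) (S : manifold R m) :=
  PartitionOfUnity {
  pou_size : nat;
  pou_chart : 'I_pou_size -> chart R S m;
  pou_fun : 'I_pou_size -> S -> R;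
  pou_atlas : forall i, atlas (pou_chart i);
  pou_smooth : forall i c, atlas c ->
    smooth_in_chart c setT (pou_fun i : S -> R^o);
  pou_ge0 : forall i s, 0 <= pou_fun i s;
  pou_support : forall i,
    closure [set s | pou_fun i s != 0] `<=` chart_dom (pou_chart i);
  pou_sum : forall s, \sum_i pou_fun i s = 1 }.

Definition pou_integral (R : realType) (m : nat) (S : manifold R m)
    (p : partition_of_unity S) (rho : density S) : R :=
  \sum_(i < pou_size p) integral_rV
    (patch (fun=> 0) (chart_im (pou_chart i))
      (fun y => let s := chart_inv (pou_chart i) y in
                pou_fun i s * rho s (coord_vector (pou_chart i) s))).

(* The common value of [pou_integral p rho] for all p. *)
Definition density_integral (R : realType) (m : nat) (S : manifold R m)
    (rho : density S) : R :=
  get [set I | exists p : partition_of_unity S, I = pou_integral p rho].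

(* A 1-form density over Q : S -> M: a section of
   Q^* T*M (x) Dens(S), i.e. a covector-valued density on S. *)
Record form_density (R : realType) (m n : nat)
    (S : manifold R m) (M : manifold R n) := FormDensity {
  fd_base : S -> M;
  fd_val : forall s : S, ('I_m -> tangent s) -> cotangent (fd_base s) }.

Definition mul_density (R : realType) (m n : nat)
    (S : manifold R m) (M : manifold R n)
    (P : S -> cotangent_bundle M) (rho : density S) : form_density S M :=
  @FormDensity R m n S M (@cotangent_proj R n M \o P)
    (fun s v => rho s v *: projT2 (P s)).

(* T* Emb(S, M)^x *)
Definition cotangent_Emb_nz (R : realType) (m n : nat)
    (S : manifold R m) (M : manifold R n) (mu : volume_form S) :
    set (form_density S M) :=
  [set Phi | exists P : S -> cotangent_bundle M,
    [/\ smooth_cotangent_map P, embedding (@cotangent_proj R n M \o P),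
        forall s, projT2 (P s) != 0 & Phi = mul_density P (density_of mu)]].

Definition Diff_act (R : realType) (m n : nat)
    (S : manifold R m) (M : manifold R n)
    (psi : S -> S) (Phi : form_density S M) : form_density S M :=
  @FormDensity R m n S M (fd_base Phi \o psi)
    (fun s v => fd_val Phi (fun i => tangent_map psi (v i))).

Lemma Diff_act_mul_density (R : realType) (m n : nat)
    (S : manifold R m) (M : manifold R n)
    (psi : S -> S) (P : S -> cotangent_bundle M) (rho : density S) :
  Diff_act psi (mul_density P rho) =
  mul_density (P \o psi) (density_pullback psi rho).
Proof. by []. Qed.

Definition J_L (R : realType) (m n : nat)
    (S : manifold R m) (M : manifold R n)
    (Phi : form_density S M) : vector_field M -> R :=
  fun X => density_integral
    (fun s v => pairing (fd_val Phi v) (X (fd_base Phi s))).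

Lemma J_L_mul_density (R : realType) (m n : nat)
    (S : manifold R m) (M : manifold R n)
    (P : S -> cotangent_bundle M) (rho : density S) (X : vector_field M) :
  J_L (mul_density P rho) X =
  density_integral (fun s v =>
    pairing (projT2 (P s)) (X (cotangent_proj (P s))) * rho s v).
Proof.
congr density_integral; apply: functional_extensionality_dep => s; apply/funext => v.
by rewrite /pairing /= -scalemxAr mxE mulrC.
Qed.

(* The level set of J_L in T* Emb(S, M)^x at lambda; it is empty unless lambda
   belongs to the dual of the space of vector fields. *)
Definition J_L_level (R : realType) (m n : nat)
    (S : manifold R m) (M : manifold R n) (mu : volume_form S)
    (lambda : vector_field M -> R) : set (form_density S M) :=
  [set Phi | cotangent_Emb_nz mu Phi /\ J_L Phi = lambda].

(* The group G of transformations of T acts on A from the right, transitively,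
   through act : G x A -> A. *)
Definition transitive_right_action (T X : Type) (G : set (T -> T))
    (act : (T -> T) -> X -> X) (A : set X) : Prop :=
  [/\ forall g x, G g -> A x -> A (act g x),
      forall x, A x -> act id x = x,
      forall g h x, G g -> G h -> A x -> act (g \o h) x = act h (act g x) &
      forall x y, A x -> A y -> exists2 g, G g & act g x = y].

(* Main.v *)
(* The integral of a density over S is well defined, and invariant under
   diffeomorphisms, by the change of variables formula in R^m together with
   partitions of unity; this gives the invariance of J_L.

   Conversely let P1 mu and P2 mu, over Q1 and Q2, have the same momentum. If
   Q1 s0 were not in the compact set Q2(S), a vector field X supported away from
   Q2(S) with P1 . (X o Q1) >= 0, and > 0 at s0, would separate the two momenta
   (here P1 does not vanish). Hence Q1 and Q2 have the same range, and
   psi := Q1^-1 o Q2 is a homeomorphism, which is smooth because Q1 is an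
   immersion. Acting by psi reduces to the case Q1 = Q2, where testing P1 - P2
   against vector fields supported near a point of the range yields P1 = P2.

   The change of variables formula for phi follows from Fubini's theorem for the
   smoothing kernel hat((phi x - y) / e): near the diagonal phi is close to a
   linear map, for which the formula is a matrix computation. *)
From HB Require Import structures.
From mathcomp Require Import all_boot all_order all_algebra.
From mathcomp Require Import all_classical all_reals all_analysis.
From mathcomp Require Import ring lra perm.
Require Import Defs.
Set Implicit Arguments.
Unset Strict Implicit.
Unset Printing Implicit Defensive.
Import Order.TTheory GRing.Theory Num.Theory.
Import numFieldNormedType.Exports.
Local Open Scope classical_set_scope.
Local Open Scope ring_scope.

(** * Calculus of smooth functions of several variables *)

(** Smoothness is given only through iterated directional derivatives, with no Fréchet derivative to
    start from. The tool that replaces it is strict differentiability: on a small ball the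
    increments of a C^1 map are linear up to a small multiple of their length, uniformly in both
    endpoints. It yields the chain rule, the uniform kernel estimate in the change of variables, and
    the differentiability of psi. [density_integral] selects a value from a set, so it says nothing
    until all partitions of unity are shown to give the same sum. One statement with two partitions,
    one on each side of a diffeomorphism, covers both this (for the identity) and the invariance. As
    [mu] acts as a density, only absolute values of Jacobian determinants occur. The comparison of
    ranges produces psi as a mere map. A right inverse of the Jacobian matrix of Q1 turns Q1 o psi =
    Q2 into an equation between spaces of equal dimension with invertible Jacobian; since a
    continuous solution is at hand, no inverse function has to be constructed, and its regularity is
    raised order by order. *)

Section Ck.
Variable R : realType.
Implicit Types (k n p : nat).

(** The finite order k carries the inductions: the product, quotient and chain rules express a
    derivative through functions known one order lower, and [smooth_on] offers nothing that
    decreases. *)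
Fixpoint Ck n k (U : set 'rV[R]_n) (f : 'rV[R]_n -> R^o) : Prop :=
  (forall x, U x -> {for x, continuous f}) /\
  if k is k'.+1 then
    forall v, (forall x, U x -> derivable f x v) /\ Ck k' U ('D_v f)
  else True.

Lemma Ck_continuous n k U (f : 'rV[R]_n -> R^o) x :
  Ck k U f -> U x -> {for x, continuous f}.
Proof. by case: k => [|k] [+ _]; apply. Qed.

Lemma Ck_derivable n k U (f : 'rV[R]_n -> R^o) x v :
  Ck k.+1 U f -> U x -> derivable f x v.
Proof. by case=> _ /(_ v)[+ _]; apply. Qed.

Lemma Ck_derive n k U (f : 'rV[R]_n -> R^o) v :
  Ck k.+1 U f -> Ck k U ('D_v f).
Proof. by case=> _ /(_ v)[]. Qed.

Lemma CkW n k U (f : 'rV[R]_n -> R^o) : Ck k.+1 U f -> Ck k U f.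
Proof.
elim: k f => [|k IH] f; first by case.
move=> [fc fd]; split=> // v; have [fv fvk] := fd v.
by split=> //; exact: IH.
Qed.

Lemma Ck_sub n k U V (f : 'rV[R]_n -> R^o) :
  V `<=` U -> Ck k U f -> Ck k V f.
Proof.
move=> VU; elim: k f => [|k IH] f [fc fd]; split=> //.
- by move=> x /VU; exact: fc.
- by move=> x /VU; exact: fc.
- move=> v; have [fv fvk] := fd v; split; last exact: IH.
  by move=> x /VU; exact: fv.
Qed.

Lemma near_ext n (T : Type) (U : set 'rV[R]_n) (f g : 'rV[R]_n -> T) x :
  open U -> {in U, f =1 g} -> U x -> \near x, f x = g x.
Proof.
move=> oU fg Ux; near=> y; apply: fg; rewrite inE; near: y.
exact: open_nbhs_nbhs.
Unshelve. all: by end_near. Qed.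

Lemma near_eq_continuous (T T' : topologicalType) (f g : T -> T') x :
  (\near x, f x = g x) -> {for x, continuous f} -> {for x, continuous g}.
Proof.
move=> fg fc; rewrite /prop_for /continuous_at.
have <- : f x = g x := nbhs_singleton fg.
exact: cvg_trans (near_eq_cvg fg) fc.
Qed.

Lemma Ck_ext n k U (f g : 'rV[R]_n -> R^o) :
  open U -> {in U, f =1 g} -> Ck k U f -> Ck k U g.
Proof.
move=> oU; elim: k f g => [|k IH] f g fg [fc fd].
  by split=> // x Ux; exact: near_eq_continuous (near_ext oU fg Ux) (fc x Ux).
split.
  by move=> x Ux; exact: near_eq_continuous (near_ext oU fg Ux) (fc x Ux).
move=> v; have [fv fvk] := fd v; split.
  move=> x Ux; apply: near_eq_derivable (fv x Ux).
  exact: near_ext fg Ux.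
apply: IH fvk => x; rewrite inE => Ux; apply: near_eq_derive.
exact: near_ext fg Ux.
Qed.

Lemma Ck_cst n k U (a : R) : Ck k U (fun _ : 'rV[R]_n => a : R^o).
Proof.
have c x : {for x, continuous (fun _ : 'rV[R]_n => a : R^o)}.
  exact: (@cst_continuous _ R^o).
elim: k a c => [|k IH] a c; split=> // v; split.
  by move=> x _; exact: (@derivable_cst _ _ R^o).
have -> : 'D_v (fun _ : 'rV[R]_n => a : R^o) = fun=> 0.
  by apply/funext => x; rewrite (derive_cst (a : R^o)).
by apply: IH => x; exact: (@cst_continuous _ R^o).
Qed.

Lemma derivable_coord n (j : 'I_n) (x v : 'rV[R]_n) :
  derivable (fun y : 'rV[R]_n => y 0 j : R^o) x v.
Proof.
have := @derivable_id R 'rV[R]_n x v.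
by move=> /derivable_mxP /(_ 0 j).
Qed.

Lemma derive_coord n (j : 'I_n) (x v : 'rV[R]_n) :
  'D_v (fun y : 'rV[R]_n => y 0 j : R^o) x = v 0 j.
Proof.
have /derive_mx := @derivable_id R 'rV[R]_n x v.
by rewrite derive_id => /matrixP/(_ 0 j); rewrite mxE.
Qed.

Lemma Ck_coord n k U (j : 'I_n) : Ck k U (fun x => x 0 j).
Proof.
have c x : {for x, continuous (fun y : 'rV[R]_n => y 0 j : R^o)}.
  exact: coord_continuous.
case: k => [|k]; split=> // v; split; first by move=> x _; exact: derivable_coord.
have -> : 'D_v (fun x : 'rV[R]_n => x 0 j : R^o) = fun=> v 0 j.
  by apply/funext => x; rewrite derive_coord.
exact: Ck_cst.
Qed.

Lemma CkD n k U (f g : 'rV[R]_n -> R^o) :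
  open U -> Ck k U f -> Ck k U g -> Ck k U (fun x => f x + g x).
Proof.
move=> oU; elim: k f g => [|k IH] f g [fc fd] [gc gd]; split=> //;
  try by move=> x Ux; exact: (@continuousD _ R^o _ _ _ _ (fc x Ux) (gc x Ux)).
move=> v; have [fv fvk] := fd v; have [gv gvk] := gd v; split.
  by move=> x Ux; apply: derivableD; [exact: fv|exact: gv].
apply: Ck_ext oU _ (IH _ _ fvk gvk) => x; rewrite inE => Ux.
by rewrite deriveD//; [exact: fv|exact: gv].
Qed.

Lemma CkM n k U (f g : 'rV[R]_n -> R^o) :
  open U -> Ck k U f -> Ck k U g -> Ck k U (fun x => f x * g x : R^o).
Proof.
move=> oU; elim: k f g => [|k IH] f g Cf Cg; split=> //;
  try by move=> x Ux; exact: (@continuousM _ _ _ _ _ (Ck_continuous Cf Ux) (Ck_continuous Cg Ux)).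
move=> v; have fv x (Ux : U x) := @Ck_derivable _ _ _ _ x v Cf Ux.
have gv x (Ux : U x) := @Ck_derivable _ _ _ _ x v Cg Ux; split.
  by move=> x Ux; apply: derivableM; [exact: fv|exact: gv].
have C1 := IH _ _ (CkW Cf) (Ck_derive v Cg).
have C2 := IH _ _ (Ck_derive v Cf) (CkW Cg).
apply: Ck_ext oU _ (CkD oU C1 C2) => x; rewrite inE => Ux.
have -> : (fun x => f x * g x : R^o) = f * g by [].
rewrite deriveM; [|exact: fv|exact: gv].
by rewrite /GRing.scale/= [g x * _]mulrC.
Qed.

Lemma Ck_sum n k U (I : Type) (r : seq I) (P : pred I) (F : I -> 'rV[R]_n -> R^o) :
  open U -> (forall i, P i -> Ck k U (F i)) ->
  Ck k U (fun x => \sum_(i <- r | P i) F i x).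
Proof.
move=> oU CF; elim: r => [|i r IH].
  have -> : (fun x => \sum_(i <- [::] | P i) F i x) = fun=> 0.
    by apply/funext => x; rewrite big_nil.
  exact: Ck_cst.
case Pi: (P i).
- have -> : (fun x => \sum_(i <- i :: r | P i) F i x) =
      fun x => F i x + \sum_(i <- r | P i) F i x.
    by apply/funext => x; rewrite big_cons Pi.
  by apply: CkD => //; exact: CF.
- have -> // : (fun x => \sum_(i <- i :: r | P i) F i x) =
      fun x => \sum_(i <- r | P i) F i x.
    by apply/funext => x; rewrite big_cons Pi.
Qed.

Lemma Ck_prod n k U (I : Type) (r : seq I) (P : pred I) (F : I -> 'rV[R]_n -> R^o) :
  open U -> (forall i, P i -> Ck k U (F i)) ->
  Ck k U (fun x => \prod_(i <- r | P i) F i x : R^o).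
Proof.
move=> oU CF; elim: r => [|i r IH].
  have -> : (fun x => \prod_(i <- [::] | P i) F i x : R^o) = fun=> 1.
    by apply/funext => x; rewrite big_nil.
  exact: Ck_cst.
case Pi: (P i).
- have -> : (fun x => \prod_(i <- i :: r | P i) F i x : R^o) =
      fun x => F i x * \prod_(i <- r | P i) F i x.
    by apply/funext => x; rewrite big_cons Pi.
  by apply: CkM => //; exact: CF.
- have -> // : (fun x => \prod_(i <- i :: r | P i) F i x : R^o) =
      fun x => \prod_(i <- r | P i) F i x.
    by apply/funext => x; rewrite big_cons Pi.
Qed.

Lemma CkN n k U (f : 'rV[R]_n -> R^o) :
  open U -> Ck k U f -> Ck k U (fun x => - f x).
Proof.
move=> oU Cf.
have -> : (fun x => - f x) = (fun x => - 1 * f x : R^o).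
  by apply/funext => x; rewrite mulN1r.
exact/CkM/Cf/Ck_cst.
Qed.

Lemma CkV n k U (f : 'rV[R]_n -> R^o) :
  open U -> (forall x, U x -> f x != 0) -> Ck k U f ->
  Ck k U (fun x => (f x)^-1 : R^o).
Proof.
move=> oU f0; elim: k f f0 => [|k IH] f f0 Cf; split=> //;
  try by move=> x Ux; exact: (@continuousV _ _ _ _ (f0 x Ux) (Ck_continuous Cf Ux)).
move=> v; have fv x (Ux : U x) := @Ck_derivable _ _ _ _ x v Cf Ux; split.
  by move=> x Ux; apply: derivableV; [exact: f0|exact: fv].
have C1 := IH _ f0 (CkW Cf).
have C2 := CkN oU (CkM oU (CkM oU C1 C1) (Ck_derive v Cf)).
apply: Ck_ext oU _ C2 => x; rewrite inE => Ux.
rewrite (@deriveV _ _ f); [|exact: f0|exact: fv].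
by rewrite /GRing.scale/= expr2 invfM mulNr.
Qed.

(** In [foldr] the last direction of the list is the one applied first to f, so the list is peeled
    from its end to match the recursion of [Ck]. *)
Lemma smooth_onP n U (f : 'rV[R]_n -> R^o) :
  smooth_on U f <-> forall k, Ck k U f.
Proof.
split=> [sf k|Cf].
  elim: k f sf => [|k IH] f sf; (split; first by move=> x /(sf [::])[]) => //.
  move=> v; split; first by move=> x /(sf [::])[_]; exact.
  apply: IH => vs x Ux; have := sf (rcons vs v) x Ux.
  by rewrite -cats1 foldr_cat.
move=> vs; elim/last_ind: vs f Cf => [|vs v IH] f Cf x Ux /=.
  by split=> [|v]; [exact: Ck_continuous (Cf 0%N) _|exact: Ck_derivable (Cf 1%N) _].
rewrite -cats1 foldr_cat; apply: IH => // k; exact: Ck_derive (Cf k.+1).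
Qed.

Lemma continuous_rowP (T : topologicalType) n (f : T -> 'rV[R]_n) x :
  {for x, continuous f} <-> forall j, {for x, continuous (fun y => f y 0 j : R^o)}.
Proof.
split=> [fc j|fc].
  exact: (cvg_comp _ _ fc (@coord_continuous _ _ _ 0 j (f x))).
apply/cvgrPdist_le => /= e e0; near=> y.
rewrite [leLHS]/Num.Def.normr/= mx_normrE (bigmax_le _ (ltW e0))//= => -[i j] _.
rewrite !mxE/= ord1; move: j; near: y; apply: filter_forall => /= j.
by have /cvgrPdist_le/(_ e e0) := fc j.
Unshelve. all: by end_near. Qed.

Lemma derive_row n p (f : 'rV[R]_n -> 'rV[R]_p) x v j :
  derivable f x v -> 'D_v f x 0 j = 'D_v (fun y => f y 0 j : R^o) x.
Proof. by move=> /derive_mx ->; rewrite mxE. Qed.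

Lemma smooth_on_rowP n p U (f : 'rV[R]_n -> 'rV[R]_p) : open U ->
  smooth_on U f <-> forall k j, Ck k U (fun x => f x 0 j).
Proof.
move=> oU; split=> [sf k j|Cf].
  elim: k f sf => [|k IH] f sf.
    by split=> // x /(sf [::])[/continuous_rowP /(_ j)].
  split; first by move=> x /(sf [::])[/continuous_rowP /(_ j)].
  move=> v; split; first by move=> x /(sf [::])[_] /(_ v)/derivable_mxP; exact.
  have sfv : smooth_on U ('D_v f).
    by move=> vs x Ux; have := sf (rcons vs v) x Ux; rewrite -cats1 foldr_cat.
  apply: Ck_ext oU _ (IH _ sfv) => x; rewrite inE => /(sf [::])[_ /(_ v)].
  exact: derive_row.
move=> vs; elim/last_ind: vs f Cf => [|vs v IH] f Cf x Ux /=.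
  split=> [|v]; first by apply/continuous_rowP => j; exact: Ck_continuous (Cf 0%N j) _.
  by apply/derivable_mxP => i j; rewrite ord1; exact: Ck_derivable (Cf 1%N j) _.
rewrite -cats1 foldr_cat; apply: IH => // k j.
apply: Ck_ext oU _ (Ck_derive v (Cf k.+1 j)) => y; rewrite inE => Uy.
rewrite derive_row//; apply/derivable_mxP => i' j'; rewrite ord1.
exact: Ck_derivable (Cf 1%N j') _.
Qed.

End Ck.

Section rV.
Variable R : realType.

Lemma row_norm_le n (x : 'rV[R]_n) e :
  0 <= e -> (forall j, `|x 0 j| <= e) -> `|x| <= e.
Proof.
move=> e0 xe; rewrite [leLHS]/Num.Def.normr/= mx_normrE (bigmax_le _ e0)//=.
by move=> -[i j] _; rewrite ord1.
Qed.

Lemma coord_norm_le n (x : 'rV[R]_n) j : `|x 0 j| <= `|x|.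
Proof.
by rewrite [leRHS]/Num.Def.normr/= mx_normrE; exact: (le_bigmax _ _ (0, j)).
Qed.

Lemma MVT_direction (V : normedModType R) (f : V -> R^o) (a v : V) s t :
  s <= t -> (forall u, s <= u <= t -> derivable f (a + u *: v) v) ->
  exists2 u, s <= u <= t & f (a + t *: v) - f (a + s *: v) =
    (t - s) * 'D_v f (a + u *: v).
Proof.
move=> st df; pose g u : R^o := f (a + u *: v).
have dg u : s <= u <= t -> is_derive u 1 g ('D_v f (a + u *: v)).
  move=> /df dfu.
  have eq1 : (fun h => h^-1 *: ((g \o shift u) (h *: 1) - g u)) =
      (fun h => h^-1 *: ((f \o shift (a + u *: v)) (h *: v) - f (a + u *: v))).
    apply/funext => h; congr (_ *: (_ - _)); rewrite /g /=; congr f.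
    have -> : h *: (1 : R^o) = h by exact: mulr1.
    by rewrite scalerDl addrCA.
  by split; rewrite /derivable /derive eq1.
have [||u uab e] := @MVT_segment R g (fun u => 'D_v f (a + u *: v)) s t st.
- by move=> u; rewrite in_itv/= => /andP[su ut]; apply: dg; rewrite !ltW.
- apply: derivable_within_continuous => u; rewrite in_itv/= => us.
  by have [] := dg u us.
exists u; first by move: uab; rewrite in_itv.
by rewrite -/(g t) -/(g s) e mulrC.
Qed.

End rV.

(** * Strict differentiability and the chain rule *)

Section strict.
Variable R : realType.

Lemma ball_rV n (x y : 'rV[R]_n) r :
  0 < r -> (forall j, `|x 0 j - y 0 j| < r) -> ball x r y.
Proof. by move=> r0 xy; split=> // i j; rewrite ord1; exact: xy. Qed.

Lemma ball_coord n (x y : 'rV[R]_n) r j : ball x r y -> `|x 0 j - y 0 j| < r.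
Proof. by move=> [_]; exact. Qed.

(** Passing from y to x one coordinate at a time reduces the estimate to the mean value theorem on
    segments parallel to the axes. The ball of the sup norm is a box, so these segments stay inside
    it, where the partial derivatives are close to their values at z0. *)
Lemma strict_derivative n U (f : 'rV[R]_n -> R^o) z0 e :
  open U -> Ck 1 U f -> U z0 -> 0 < e ->
  exists2 r, 0 < r & ball z0 r `<=` U /\
    forall x y, ball z0 r x -> ball z0 r y ->
      `|f x - f y - \sum_j (x 0 j - y 0 j) * 'D_(delta_mx 0 j) f z0|
        <= e * `|x - y|.
Proof.
(* The error is shared among the coordinates; [n.+1] keeps e' positive when n = 0. *)
move=> oU Cf Uz0 e0; pose e' := e / n.+1%:R.
have e'0 : 0 < e' by rewrite divr_gt0.
have nD : \forall z \near z0, forall j,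
    `|'D_(delta_mx 0 j) f z0 - 'D_(delta_mx 0 j) f z| <= e'.
  apply: (@filter_forall _ 'I_n (fun j => [set z | `|'D_(delta_mx 0 j) f z0 - 'D_(delta_mx 0 j) f z| <= e']) (nbhs z0)) => j.
  have := Ck_continuous (@Ck_derive _ _ _ _ _ (delta_mx 0 j) Cf) Uz0.
  by move=> /cvgrPdist_le/(_ e' e'0).
have /nbhs_ballP[r /= r0 rP] : nbhs z0 [set z | U z /\ forall j,
    `|'D_(delta_mx 0 j) f z0 - 'D_(delta_mx 0 j) f z| <= e'].
  by apply: filterI; [exact: open_nbhs_nbhs|exact: nD].
exists r => //; split; first by move=> z /rP[].
move=> x y xr yr.
(* [w k] takes its first k coordinates from x and the others from y, so the increments telescope. *)
pose w k : 'rV[R]_n := \row_j (if (j < k)%N then x 0 j else y 0 j).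
have w0 : w 0%N = y by apply/rowP => j; rewrite mxE.
have wn : w n = x by apply/rowP => j; rewrite mxE ltn_ord.
have -> : f x - f y = \sum_(k < n) (f (w k.+1) - f (w k)).
  by rewrite -(big_mkord xpredT (fun k => f (w k.+1) - f (w k)))
             telescope_sumr// w0 wn.
rewrite -sumrB; apply: le_trans (ler_norm_sum _ _ _) _.
have -> : e * `|x - y| = \sum_(j < n.+1) (e' * `|x - y|).
  by rewrite sumr_const card_ord -mulr_natl mulrA /e' mulrCA divff// mulr1.
rewrite big_ord_recr/= -[leLHS]addr0 lerD//; last by rewrite mulr_ge0// ltW.
apply: ler_sum => j _.
(* [w j] and [w j.+1] differ only in coordinate j; [a] is their common part, with 0 in that
   place. *)
pose a : 'rV[R]_n := \row_i (if (i < j)%N then x 0 i else if i == j then 0 else y 0 i).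
have wa : w j = a + y 0 j *: delta_mx 0 j.
  apply/rowP => i; rewrite !mxE eqxx/=.
  case: (ltnP i j) => ij.
    by rewrite -val_eqE/= ltn_eqF// mulr0 addr0.
  by case: eqVneq => [->|]; rewrite ?mulr0 ?addr0// mulr1 add0r.
have wSa : w j.+1 = a + x 0 j *: delta_mx 0 j.
  apply/rowP => i; rewrite !mxE eqxx/= ltnS leq_eqVlt val_eqE.
  case: eqVneq => [->|] /=; first by rewrite ltnn mulr1 add0r.
  by case: ltnP => _; rewrite mulr0 addr0.
have aball s t u : (s = x 0 j /\ t = y 0 j) \/ (s = y 0 j /\ t = x 0 j) ->
    s <= u <= t -> ball z0 r (a + u *: delta_mx 0 j).
  move=> st /andP[su ut]; apply: ball_rV => // i; rewrite !mxE eqxx/=.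
  have := ball_coord i xr; have := ball_coord i yr.
  case: ltnP => ij; first by rewrite -val_eqE/= ltn_eqF// mulr0 addr0.
  case: eqVneq => [->|]; last by rewrite mulr0 addr0.
  rewrite mulr1 add0r !ltr_norml => /andP[y1 y2] /andP[x1 x2].
  by case: st => -[ss tt]; subst s t; apply/andP; split; lra.
have [u ur e1] : exists2 u, ball z0 r (a + u *: delta_mx 0 j) &
    f (w j.+1) - f (w j) = (x 0 j - y 0 j) *
     'D_(delta_mx 0 j) f (a + u *: delta_mx 0 j).
  rewrite wa wSa; case: (leP (x 0 j) (y 0 j)) => xy.
  - have [|u ur e1] := MVT_direction (f := f) (a := a) (v := delta_mx 0 j) xy.
      move=> u ur; apply: Ck_derivable Cf _.
      by have [] := rP _ (aball _ _ _ (or_introl (conj erefl erefl)) ur).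
    exists u; first exact: (aball _ _ _ (or_introl (conj erefl erefl)) ur).
    by rewrite -opprB e1 -mulNr opprB.
  - have [|u ur e1] := MVT_direction (f := f) (a := a) (v := delta_mx 0 j) (ltW xy).
      move=> u ur; apply: Ck_derivable Cf _.
      by have [] := rP _ (aball _ _ _ (or_intror (conj erefl erefl)) ur).
    by exists u => //; exact: (aball _ _ _ (or_intror (conj erefl erefl)) ur).
rewrite e1 -mulrBr normrM mulrC; apply: ler_pM => //.
- by rewrite distrC; have [_] := rP _ ur; exact.
- by have := coord_norm_le (x - y) j; rewrite !mxE.
Qed.

(* The chain rule along a direction, without Frechet differentiability of [g]. *)
Lemma is_derive_comp_row n p V (f : 'rV[R]_p -> R^o) (g : 'rV[R]_n -> 'rV[R]_p) x v :
  open V -> Ck 1 V f -> V (g x) -> derivable g x v ->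
  is_derive x v (f \o g) (\sum_j 'D_v g x 0 j * 'D_(delta_mx 0 j) f (g x)).
Proof.
move=> oV Cf Vgx dg; pose G := 'D_v g x.
pose q h := h^-1 *: (g (h *: v + x) - g x).
have qG : q h @[h --> 0^'] --> G by exact: dg.
set L := \sum_j _.
suff cL : (fun h => h^-1 *: (((f \o g) \o shift x) (h *: v) - (f \o g) x)) @ 0^' --> (L : R^o).
  by split; [apply/cvg_ex; exists L|exact: cvg_lim cL].
apply/cvgrPdist_le => /= e e0.
(* M bounds the difference quotients of g near 0 and D the partial derivatives of f; the added 1
   makes both positive divisors. The error e is split between the linearization of f and the
   convergence of the quotients. *)
pose M := `|G| + 1; have M0 : 0 < M by rewrite ltr_pwDr.
pose D := \sum_j `|'D_(delta_mx 0 j) f (g x)| + 1.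
have D0 : 0 < D by rewrite ltr_pwDr// sumr_ge0.
have eM0 : 0 < e / 2 / M by rewrite !divr_gt0.
have [r r0 [rV rP]] := strict_derivative oV Cf Vgx eM0.
have eD0 : 0 < e / 2 / D by rewrite !divr_gt0.
have q1 : \forall h \near 0^', `|G - q h| <= e / 2 / D.
  by move/cvgrPdist_le : qG; exact.
have q2 : \forall h \near 0^', `|q h| <= M.
  have /cvgrPdist_le/(_ 1 ltr01) := qG.
  apply: filterS => h; rewrite distrC => h1.
  rewrite -[q h](subrK G) (le_trans (ler_normD _ _))// addrC lerD//.
have h0 : \forall h \near (0:R)^', h != 0 by exact: nbhs_dnbhs_neq.
have hr : \forall h \near (0:R)^', `|h| < r / M by apply: dnbhs0_lt; rewrite divr_gt0.
near=> h.
have hn0 : h != 0 by near: h.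
have qM : `|q h| <= M by near: h.
have qD : `|G - q h| <= e / 2 / D by near: h.
have gq : g (h *: v + x) - g x = h *: q h by rewrite scalerA mulfV// scale1r.
have gb : ball (g x) r (g (h *: v + x)).
  rewrite -ball_normE/= distrC gq normrZ.
  have hr' : `|h| < r / M by near: h.
  apply: le_lt_trans (_ : `|h| * M < _); first by rewrite ler_wpM2l.
  by rewrite -ltr_pdivlMr.
have := rP _ _ gb (ballxx _ r0).
rewrite gq normrZ => rPh.
rewrite distrC /= /shift /=.
set F := f (g (h *: v + x)) - f (g x) in rPh *.
have -> : h^-1 *: F - L = h^-1 * (F - \sum_j (g (h *: v + x) 0 j - g x 0 j) * 'D_(delta_mx 0 j) f (g x))
   + \sum_j (q h 0 j - G 0 j) * 'D_(delta_mx 0 j) f (g x).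
  rewrite mulrBr -addrA; congr (_ + _); rewrite [RHS]addrC mulr_sumr -sumrB /L -sumrN.
  apply: eq_bigr => j _.
  have -> : g (h *: v + x) 0 j - g x 0 j = h * q h 0 j.
    by have /rowP/(_ j) := gq; rewrite !mxE.
  by rewrite !mulrA mulVf// mul1r -/G mulrBl addrAC subrr add0r.
rewrite (splitr e) (le_trans (ler_normD _ _))// lerD//.
- rewrite normrM normfV ler_pdivrMl ?normr_gt0//; apply: le_trans rPh _.
  rewrite mulrCA; apply: ler_wpM2l => //.
  by apply: le_trans (ler_wpM2l (ltW eM0) qM) _; rewrite divfK ?gt_eqF.
- apply: le_trans (ler_norm_sum _ _ _) _.
  apply: le_trans (_ : e / 2 / D * D <= _); last by rewrite divfK ?gt_eqF.
  rewrite /D mulrDr mulr1 -[leLHS]addr0 lerD ?(ltW eD0)//.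
  rewrite mulr_sumr; apply: ler_sum => j _; rewrite normrM ler_wpM2r//.
  apply: le_trans qD; rewrite distrC.
  by have := coord_norm_le (G - q h) j; rewrite !mxE.
Unshelve. all: by end_near. Qed.

(** [Ck] speaks of each direction separately; linearity in the direction comes from the chain rule
    with the identity as inner map. *)
Lemma derive_sum_coord n U (f : 'rV[R]_n -> R^o) x v :
  open U -> Ck 1 U f -> U x ->
  'D_v f x = \sum_j v 0 j * 'D_(delta_mx 0 j) f x.
Proof.
move=> oU Cf Ux; have := is_derive_comp_row oU Cf (Ux : U (id x)) (@derivable_id _ _ x v).
by move=> [_]; rewrite derive_id.
Qed.

Lemma Ck_comp n p k U V (f : 'rV[R]_p -> R^o) (g : 'rV[R]_n -> 'rV[R]_p) :
  open U -> open V -> (forall j, Ck k U (fun x => g x 0 j)) -> Ck k V f ->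
  (forall x, U x -> V (g x)) -> Ck k U (f \o g).
Proof.
move=> oU oV; elim: k f g => [|k IH] f g Cg Cf gV.
  split=> // x Ux; apply: continuous_comp.
    by apply/continuous_rowP => j; exact: Ck_continuous (Cg j) Ux.
  exact: Ck_continuous Cf (gV _ Ux).
have Cf1 : Ck 1 V f by elim: {IH} k {Cg} Cf => // k IH /CkW.
have dg x v : U x -> derivable g x v.
  move=> Ux; apply/derivable_mxP => i j; rewrite ord1.
  exact: Ck_derivable (Cg j) Ux.
have dgf x v (Ux : U x) := is_derive_comp_row oV Cf1 (gV _ Ux) (dg x v Ux).
split.
  move=> x Ux; apply: continuous_comp.
    by apply/continuous_rowP => j; exact: Ck_continuous (Cg j) Ux.
  exact: Ck_continuous Cf (gV _ Ux).
move=> v; split; first by move=> x /(dgf _ v)[].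
apply: (@Ck_ext _ _ _ _ (fun x => \sum_j ('D_v (fun y => g y 0 j : R^o) x *
    ('D_(delta_mx 0 j) f \o g) x))) => //.
  move=> x; rewrite inE => Ux; have [_ ->] := dgf x v Ux.
  by apply: eq_bigr => j _; rewrite derive_row//; exact: dg.
apply: Ck_sum => // j _; apply: CkM => //; first exact: Ck_derive (Cg j).
apply: IH => //; last exact: Ck_derive Cf.
by move=> i; exact/CkW/Cg.
Qed.

End strict.

(** * The iterated integral of a compactly supported function *)

Section csupp.
Variable R : realType.

(** The radius is explicit because the estimates depend on it: in the sup norm the support lies in a
    cube of side 2b, which gives the factors [(2 * b) ^+ n]. *)
Definition csupp (V : normedModType R) (b : R) (f : V -> R) :=
  continuous f /\ forall x, b < `|x| -> f x = 0.

Lemma csupp_le (V : normedModType R) b c (f : V -> R) :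
  b <= c -> csupp b f -> csupp c f.
Proof. by move=> bc [fc f0]; split=> // x cx; apply: f0; exact: le_lt_trans cx. Qed.

Lemma csuppB (V : normedModType R) b (f g : V -> R) :
  csupp b f -> csupp b g -> csupp b (fun x => f x - g x).
Proof.
move=> [fc f0] [gc g0]; split=> [x|x bx]; last by rewrite f0// g0// subrr.
by apply: (@continuousB _ R^o); [exact: fc|exact: gc].
Qed.

Lemma csuppD (V : normedModType R) b (f g : V -> R) :
  csupp b f -> csupp b g -> csupp b (fun x => f x + g x).
Proof.
move=> [fc f0] [gc g0]; split=> [x|x bx]; last by rewrite f0// g0// addr0.
by apply: (@continuousD _ R^o); [exact: fc|exact: gc].
Qed.

Lemma csuppMr (V : normedModType R) b (f g : V -> R) :
  csupp b f -> continuous g -> csupp b (fun x => f x * g x).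
Proof.
move=> [fc f0] gc; split=> [x|x bx]; last by rewrite f0// mul0r.
by apply: continuousM; [exact: fc|exact: gc].
Qed.

Lemma csuppZ (V : normedModType R) b k (f : V -> R) :
  csupp b f -> csupp b (fun x => k * f x).
Proof.
move=> fb; have -> : (fun x => k * f x) = (fun x => f x * k).
  by apply/funext => x; rewrite mulrC.
by apply: csuppMr => // x; exact: cvg_cst.
Qed.

Lemma csupp0 (V : normedModType R) b : csupp b (fun _ : V => 0).
Proof. by split=> // x; exact: cvg_cst. Qed.

Lemma csupp_sum (V : normedModType R) b (I : Type) (r : seq I) (P : pred I)
    (F : I -> V -> R) :
  (forall i, P i -> csupp b (F i)) -> csupp b (fun x => \sum_(i <- r | P i) F i x).
Proof.
move=> FP; elim: r => [|i r IH].
  by under eq_fun do rewrite big_nil; exact: csupp0.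
under eq_fun do rewrite big_cons.
by case Pi: (P i) => //; apply: csuppD => //; exact: FP.
Qed.

End csupp.

(** * The integral over the line *)

Section int1.
Variable R : realType.
Notation mu := (@lebesgue_measure R).
Implicit Types (f : R -> R) (b c d k t : R).

Lemma int1_itv f c d : (forall t, ~~ (c <= t <= d) -> f t = 0) ->
  \int[mu]_t f t = \int[mu]_(t in `[c, d]) f t.
Proof.
move=> f0; rewrite [RHS]Rintegral_mkcond; congr (Rintegral _ _ _).
apply/funext => t; rewrite patchE; case: ifPn => //.
by rewrite notin_setE/= in_itv/= => /negP; exact: f0.
Qed.

Lemma csupp_itv b f t : csupp b f -> ~~ (- b <= t <= b) -> f t = 0.
Proof. by move=> [_ f0] bt; apply: f0; rewrite ltNge ler_norml. Qed.

Lemma continuous_integrable f (i : interval R) c d : continuous f ->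
  [set` i] `<=` `[c, d] -> mu.-integrable [set` i] (EFin \o f).
Proof.
move=> fc icd; apply: (@integrableS _ _ _ mu `[c, d]) => //.
apply: (@continuous_compact_integrable R f); first exact: segment_compact.
exact: continuous_subspaceT.
Qed.

Lemma csupp_integrable b f : csupp b f -> mu.-integrable setT (EFin \o f).
Proof.
move=> fb; have [fc _] := fb.
have fi : mu.-integrable `[- b, b] (EFin \o f).
  by apply: (@continuous_integrable f `[- b, b] (- b) b fc).
have -> : EFin \o f = (EFin \o f) \_ `[- b, b].
  apply/funext => t; rewrite patchE; case: ifPn => //.
  rewrite notin_setE/= in_itv/= => /negP bt.
  by rewrite /= (csupp_itv fb bt).
apply/(@integrable_restrict _ _ _ mu `[- b, b]%classic _ setT measurableT) => //.
by rewrite setTI.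
Qed.

Lemma int1B b f g : csupp b f -> csupp b g ->
  \int[mu]_t (f t - g t) = \int[mu]_t f t - \int[mu]_t g t.
Proof. by move=> /csupp_integrable ? /csupp_integrable ?; exact: RintegralB. Qed.

Lemma int1Z b f k : csupp b f -> \int[mu]_t (k * f t) = k * \int[mu]_t f t.
Proof. by move=> /csupp_integrable ?; exact: RintegralZl. Qed.

Lemma Rintegral_itv_bound f (i : interval R) c d M : continuous f ->
  [set` i] `<=` `[c, d] -> (forall t, t \in i -> `|f t| <= M) ->
  `|\int[mu]_(t in [set` i]) f t| <= M * fine (mu [set` i]).
Proof.
move=> fc icd fM.
have fi := continuous_integrable fc icd.
apply: le_trans (le_normr_Rintegral _ fi) _ => //.
rewrite -Rintegral_cst//; apply: le_Rintegral => //.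
- by apply: (@continuous_integrable (fun t => `|f t|) i _ _ _ icd) => t;
    apply: (@continuous_comp _ _ _ f); [exact: fc|exact: (@norm_continuous _ R^o)].
- by apply: (@continuous_integrable (fun=> M) i _ _ _ icd) => t; exact: cvg_cst.
Qed.

Lemma fine_itv_cc c d : c <= d -> fine (mu `[c, d]) = d - c.
Proof.
move=> cd; rewrite lebesgue_measure_itv/= lte_fin; case: ifPn => //.
by rewrite -leNgt => dc; rewrite (@le_anti _ _ c d) ?cd ?subrr.
Qed.

Lemma fine_itv_oc c d : c <= d -> fine (mu `]c, d]) = d - c.
Proof.
move=> cd; rewrite lebesgue_measure_itv/= lte_fin; case: ifPn => //.
by rewrite -leNgt => dc; rewrite (@le_anti _ _ c d) ?cd ?subrr.
Qed.

Lemma int1_bound b f M : 0 <= b -> csupp b f -> (forall t, `|f t| <= M) ->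
  `|\int[mu]_t f t| <= 2 * b * M.
Proof.
move=> b0 fb fM; rewrite (int1_itv (fun t => @csupp_itv b f t fb)).
have [fc _] := fb.
apply: le_trans (@Rintegral_itv_bound f `[-b, b] (-b) b M fc _ _) _ => //.
by rewrite fine_itv_cc ?ge0_cp// opprK le_eqVlt; apply/orP; left; apply/eqP; ring.
Qed.

Lemma int1_affine b f k c : k != 0 -> csupp b f ->
  `|k| * \int[mu]_t f (k * t + c) = \int[mu]_t f t.
Proof.
(* A negative factor is reduced to a positive one by reflecting f. *)
wlog k0 : f k c / 0 < k => [wl|_ fb].
  move=> kn0 fb; have [kl0|k0|k0] := ltrgtP k 0; last by rewrite k0 eqxx in kn0.
    2: exact: (wl f k c k0 kn0 fb).
  have fNb : csupp b (f \o -%R).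
    have [fc f0] := fb; split=> [t|t bt]; last by apply: f0; rewrite normrN.
    by apply: continuous_comp; [exact: opp_continuous|exact: fc].
  have Nk0 : 0 < - k by rewrite oppr_gt0.
  have := wl (f \o -%R) (- k) (- c) Nk0 (lt0r_neq0 Nk0) fNb.
  rewrite normrN /= => wl'.
  transitivity (`|k| * \int[mu]_t f (- (- k * t - c))).
    by congr (_ * _); congr (Rintegral _ _ _); apply/funext => t; congr f; ring.
  rewrite wl' (int1_itv (fun t => @csupp_itv b _ t fNb)).
  rewrite (int1_itv (fun t => @csupp_itv b f t fb)) /Rintegral; congr fine.
  have [b0|b0] := leP b 0.
    have [->|bn0] := eqVneq b 0; first by rewrite oppr0 !set_itv1 !integral_set1.
    by rewrite !set_itv_ge ?integral_set0// bnd_simp; lra.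
  rewrite -(@integration_by_substitution_oppr _ f (-b) b) ?opprK//; first lra.
  by apply: continuous_subspaceT; have [] := fb.
have [fc f0] := fb.
(* For a nonpositive radius f vanishes off the origin, hence also at the origin by continuity; the
   substitution below then takes place on a nondegenerate interval. *)
have [b0|b0] := leP b 0.
  have f00 t : f t = 0.
    have [tb|tb] := ltP b `|t|; first exact: f0.
    have tb0 : `|t| <= 0 by apply: le_trans b0.
    apply/eqP; move: tb0; rewrite normr_le0 => /eqP -> {t tb}.
    apply/negP => fn0.
    have /cvgrPdist_lt/(_ `|f 0|) := fc 0.
    rewrite normr_gt0 => /(_ (introN idP fn0)) /nbhs_ballP[e /= e0 He].
    have := He (e / 2); rewrite -ball_normE/= sub0r normrN gtr0_norm ?divr_gt0//.
    rewrite ltr_pdivrMr// ltr_pMr// ltr1n => /(_ isT).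
    rewrite (f0 (e / 2)) ?subr0 ?ltxx//.
    by rewrite gtr0_norm ?divr_gt0// (le_lt_trans b0)// divr_gt0.
  rewrite (_ : (fun t => _) = cst 0); last by apply/funext => t; rewrite f00.
  rewrite (_ : f = cst 0); last by apply/funext => t; rewrite f00.
  by rewrite Rintegral_cst// mul0r mulr0.
pose F t := k * t + c.
have dF : derive1 F = cst k.
  apply/funext => t; rewrite derive1E /F deriveD//.
  by rewrite derive_cst addr0 deriveMl// derive_id /GRing.scale/= mulr1.
have Fc : continuous F.
  move=> t; apply: (@continuousD _ R^o); last exact: cvg_cst.
  by apply: continuousM; [exact: cvg_cst|exact: cvg_id].
pose x0 := (- b - c) / k; pose x1 := (b - c) / k.
have Fx0 : F x0 = - b by rewrite /F /x0 mulrC divfK ?gt_eqF// subrK.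
have Fx1 : F x1 = b by rewrite /F /x1 mulrC divfK ?gt_eqF// subrK.
have x01 : x0 <= x1 by rewrite /x0 /x1 ler_pM2r ?invr_gt0//; lra.
rewrite gtr0_norm// (int1_itv (fun t => @csupp_itv b f t fb)).
have f1 t : ~~ (x0 <= t <= x1) -> f (F t) = 0.
  move=> tx; apply: (csupp_itv fb); apply: contra tx.
  rewrite /x0 /x1 ler_pdivrMr// ler_pdivlMr// /F => /andP[? ?].
  by apply/andP; split; lra.
rewrite (int1_itv f1).
have cfF : continuous (f \o F).
  by move=> t; apply: continuous_comp; [exact: Fc|exact: fc].
rewrite -RintegralZl//; last by apply: (@continuous_integrable _ `[x0, x1] x0 x1 cfF).
rewrite /Rintegral; congr fine; rewrite -Fx0 -Fx1.
rewrite (@integration_by_substitution_increasing _ F f x0 x1)//.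
- apply: eq_integral => t _; congr EFin; rewrite dF.
  by rewrite /GRing.mul/= mulrC.
- by move=> s t _ _ st; rewrite /F ltrD2r ltr_pM2l.
- by rewrite dF => t _; exact: cvg_cst.
- by rewrite dF; exact: is_cvg_cst.
- by rewrite dF; exact: is_cvg_cst.
- split.
  + move=> s _; apply: (@derivableD R R R (fun t => k * t) (cst c) s 1); last exact: derivable_cst.
    by apply: (@derivableM R R (cst k) id s 1).
  + exact/cvg_at_right_filter/Fc.
  + exact/cvg_at_left_filter/Fc.
- exact: continuous_subspaceT.
Qed.

(** Riemann sums are finite linear combinations of values, so they commute with any linear integral;
    this is how Fubini's theorem is reached. The hypothesis is a modulus of continuity at the scale
    of the mesh. *)
Lemma int1_riemann b f N w : 0 <= b -> csupp b f -> (0 < N)%N ->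
  (forall s t, `|s - t| <= 2 * b / N%:R -> `|f s - f t| <= w) ->
  `|\int[mu]_t f t - \sum_(k < N) 2 * b / N%:R * f (- b + k%:R * (2 * b / N%:R))|
    <= 2 * b * w.
Proof.
move=> b0 fb N0 fw; set dl := 2 * b / N%:R.
have dl0 : 0 <= dl by rewrite !mulr_ge0// invr_ge0.
have [fc f0] := fb; pose x (k : nat) : R := - b + k%:R * dl.
have xS (k : nat) : x k.+1 = x k + dl by rewrite /x -natr1; ring.
have xle (k : nat) : x k <= x k.+1 by rewrite xS lerDl.
have x0k (k : nat) : - b <= x k by rewrite /x lerDl mulr_ge0.
have xN : x N = b.
  by rewrite /x /dl mulrC divfK ?pnatr_eq0 -?lt0n//; ring.
have E (k : nat) : \int[mu]_(t in `[- b, x k]) f t =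
    \sum_(i < k) \int[mu]_(t in `]x i, x i.+1]) f t.
  elim: k => [|k IH].
    by rewrite big_ord0 /x mul0r addr0 set_itv1 Rintegral_set1.
  rewrite big_ord_recr/= -IH -(@Rintegral_itvB R f (BLeft (- b)) (BRight (x k.+1)) (x k)).
  - by rewrite addrC subrK.
  - by apply: (@continuous_integrable f `[- b, x k.+1] (- b) (x k.+1) fc).
  - by rewrite bnd_simp.
  - by rewrite bnd_simp.
rewrite (int1_itv (fun t => @csupp_itv b f t fb)) -[X in `[_, X]]xN E -sumrB.
apply: le_trans (ler_norm_sum _ _ _) _.
have -> : 2 * b * w = \sum_(k < N) dl * w.
  rewrite sumr_const card_ord -[RHS]mulr_natl [RHS]mulrA [N%:R * _]mulrC divfK//.
  by rewrite pnatr_eq0 -lt0n.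
apply: ler_sum => k _; rewrite -/(x k).
have oc : `]x k, x k.+1] `<=` `[x k, x k.+1].
  by move=> t /=; rewrite !in_itv/= => /andP[/ltW -> ->].
have <- : \int[mu]_(t in `]x k, x k.+1]) f (x k) = dl * f (x k).
  by rewrite Rintegral_cst// fine_itv_oc// xS addrAC subrr add0r mulrC.
rewrite -RintegralB//.
- have -> : dl * w = w * fine (mu `]x k, x k.+1]).
    by rewrite fine_itv_oc// xS addrAC subrr add0r mulrC.
  apply: (@Rintegral_itv_bound (fun t => f t - f (x k)) _ _ _ _ _ oc).
    move=> t; apply: (@continuousB _ R^o); [exact: fc|exact: cvg_cst].
  move=> t; rewrite in_itv/= => /andP[xt tx]; apply: fw.
  by rewrite gtr0_norm ?subr_gt0// -/dl lerBlDl -xS.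
- exact: continuous_integrable fc oc.
- by apply: (@continuous_integrable (cst (f (x k))) _ _ _ _ oc) => t; exact: cvg_cst.
Qed.

End int1.

Section compact_unif.
Variable R : realType.

(** Compactness of K makes the neighbourhood of t0 independent of x. The space T is arbitrary since
    the parameter is a translation in one use and a parameter of an integral in another. *)
Lemma compact_unif (T X : topologicalType) (K : set X) (F : T -> X -> R) t0 e :
  compact K -> (forall x, K x -> {for (t0, x), continuous (fun z : T * X => F z.1 z.2)}) ->
  0 < e -> \forall t \near t0, forall x, K x -> `|F t x - F t0 x| <= e.
Proof.
move=> /compact_near_coveringP cK Fc e0.
apply: (cK T (nbhs t0) (fun t x => `|F t x - F t0 x| <= e)) => x Kx.
have e20 : 0 < e / 2 by rewrite divr_gt0.
have /cvgrPdist_le/(_ _ e20)[[A B] /= [At0 Bx] AB] := Fc x Kx.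
exists (B, A) => //= -[x' t] /= [Bx' At].
have h1 := AB (t, x') (conj At Bx'); have h2 := AB (t0, x') (conj (nbhs_singleton At0) Bx').
rewrite /= in h1 h2.
rewrite -(subrKA (F t0 x)) (splitr e) (le_trans (ler_normD _ _))// lerD//.
by rewrite distrC.
Qed.

Lemma pair1_continuous (T X : topologicalType) (t : T) : continuous (fun x : X => (t, x)).
Proof. by move=> x; apply: cvg_pair; [exact: cvg_cst|exact: cvg_id]. Qed.

Lemma continuous_pair (T X Y : topologicalType) (f : T -> X) (g : T -> Y) t :
  {for t, continuous f} -> {for t, continuous g} ->
  {for t, continuous (fun x => (f x, g x))}.
Proof. by move=> fc gc; apply: (@cvg_pair _ _ _ (nbhs t) (nbhs (f t)) (nbhs (g t))). Qed.

Lemma ball_rV_compact n b : compact [set x : 'rV[R]_n | `|x| <= b].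
Proof.
apply: bounded_closed_compact.
- exists b; split=> [|c bc x /= xb]; first exact: num_real.
  by rewrite (le_trans xb)// ltW.
- apply: (@closed_comp _ _ (fun x : 'rV[R]_n => `|x|) [set t | t <= b]).
    by move=> x _; exact: norm_continuous.
  exact: closed_le.
Qed.

Lemma csupp_unif n b (f : 'rV[R]_n -> R) e : csupp b f -> 0 < e ->
  exists2 d, 0 < d & forall x y, `|x - y| <= d -> `|f x - f y| <= e.
Proof.
move=> [fc f0] e0.
have Fc x : {for (0 : 'rV[R]_n, x), continuous (fun z : 'rV[R]_n * 'rV[R]_n => f (z.2 + z.1))}.
  apply: (@continuous_comp _ _ _ (fun z : 'rV[R]_n * 'rV[R]_n => z.2 + z.1) f).
    by apply: (@continuousD _ 'rV[R]_n); [exact: cvg_snd|exact: cvg_fst].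
  exact: fc.
have := compact_unif (F := fun h x : 'rV[R]_n => f (x + h)) (@ball_rV_compact n (b + 1)) (fun x _ => Fc x) e0.
move=> /nbhs_ballP[r /= r0 H].
(* With steps at most 1, a point y outside the ball of radius b + 1 forces x outside the ball of
   radius b, so both values vanish. *)
pose d := Num.min (r / 2) 1.
have d0 : 0 < d by rewrite lt_min divr_gt0//=.
exists d => // x y xyd.
have [xb|xb] := leP `|y| (b + 1).
  have /H/(_ y xb) : ball (0 : 'rV[R]_n) r (x - y).
    rewrite -ball_normE/= sub0r normrN (le_lt_trans xyd)// gt_min ltr_pdivrMr//.
    by rewrite ltr_pMr// ltr1n.
  by rewrite addr0 (addrC y) subrK.
have xy1 : `|x - y| <= 1 by rewrite (le_trans xyd)// ge_min lexx orbT.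
rewrite !f0 ?subrr ?normr0 ?ltW//.
- by rewrite (lt_trans _ xb)// ltrDl.
- rewrite -(ltrD2r 1) (lt_le_trans xb)//.
  have := ler_normD (y - x) x; rewrite subrK (distrC y x).
  by move/le_trans; apply; rewrite addrC lerD2l.
Qed.

End compact_unif.

Section integral_rV.
Variable R : realType.
Notation mu := (@lebesgue_measure R).
Local Notation I := (@integral_rV R _).

(** This is the term under which [integral_rV] hands its first variable to the integrand, so that
    [integral_rVS] holds by conversion. *)
Definition rcons1 n (t : R) (y : 'rV[R]_n) : 'rV[R]_n.+1 :=
  row_mx (const_mx t : 'rV_1) y.

Lemma integral_rVS n (f : 'rV[R]_n.+1 -> R) :
  I f = \int[mu]_t I (fun y => f (rcons1 t y)).
Proof. by []. Qed.

Lemma rcons1_0 n (t : R) (y : 'rV[R]_n) : rcons1 t y 0 0 = t.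
Proof.
rewrite /rcons1; have -> : 0 = lshift n (0 : 'I_1) by exact/val_inj.
by rewrite (row_mxEl (const_mx t : 'rV_1) y) mxE.
Qed.

Lemma rcons1_lift n (t : R) (y : 'rV[R]_n) j : rcons1 t y 0 (lift 0 j) = y 0 j.
Proof.
rewrite /rcons1; have -> : lift 0 j = rshift 1 j by exact/val_inj.
by rewrite (row_mxEr (const_mx t : 'rV_1) y).
Qed.

Lemma rcons1P n (x : 'rV[R]_n.+1) : exists t y, x = rcons1 t y.
Proof.
exists (x 0 0), (\row_j x 0 (lift 0 j)); apply/rowP => j.
case: (unliftP 0 j) => [j'|] ->; first by rewrite rcons1_lift mxE.
by rewrite rcons1_0.
Qed.

Lemma norm_rcons1 n (t : R) (y : 'rV[R]_n) : `|rcons1 t y| = Num.max `|t| `|y|.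
Proof.
apply/le_anti/andP; split.
  apply: row_norm_le; first by rewrite le_max normr_ge0.
  move=> j; case: (unliftP 0 j) => [j'|] ->; rewrite ?rcons1_lift ?rcons1_0 le_max.
    by rewrite coord_norm_le orbT.
  by rewrite lexx.
rewrite ge_max; apply/andP; split.
  by have := coord_norm_le (rcons1 t y) 0; rewrite rcons1_0.
apply: row_norm_le => // j.
by have := coord_norm_le (rcons1 t y) (lift 0 j); rewrite rcons1_lift.
Qed.

Lemma rcons1_continuous n : continuous (fun z : R * 'rV[R]_n => rcons1 z.1 z.2).
Proof.
move=> z; apply/continuous_rowP => j; case: (unliftP 0 j) => [j'|] ->.
- have -> : (fun z : R * 'rV[R]_n => rcons1 z.1 z.2 0 (lift 0 j') : R^o) =
      fun z => z.2 0 j' by apply/funext => y; rewrite rcons1_lift.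
  apply: (@continuous_comp _ _ _ (fun z : R * 'rV[R]_n => z.2) (fun y : 'rV[R]_n => y 0 j')).
    exact: cvg_snd.
  exact: coord_continuous.
- have -> : (fun z : R * 'rV[R]_n => rcons1 z.1 z.2 0 0 : R^o) =
      fun z => z.1 by apply/funext => y; rewrite rcons1_0.
  exact: cvg_fst.
Qed.

Lemma rcons1D n t t' (y y' : 'rV[R]_n) :
  rcons1 (t + t') (y + y') = rcons1 t y + rcons1 t' y'.
Proof.
apply/rowP => j; rewrite [RHS]mxE.
by case: (unliftP 0 j) => [j'|] ->; rewrite ?rcons1_0// !rcons1_lift mxE.
Qed.

(** The two properties are proved together by induction on n: in dimension n they make the inner
    integral continuous in its parameter, and this continuity gives both of them for the outer
    integral, one dimension higher. *)
Let bound n := forall b (f : 'rV[R]_n -> R) M, 0 <= b -> csupp b f ->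
  (forall x, `|f x| <= M) -> `|I f| <= (2 * b) ^+ n * M.
Let subtr n := forall b (f g : 'rV[R]_n -> R), csupp b f -> csupp b g ->
  I (fun x => f x - g x) = I f - I g.

Let continuous_integral0 n : bound n -> subtr n ->
  forall (T : topologicalType) (F : T -> 'rV[R]_n -> R) b,
  continuous (fun z : T * 'rV[R]_n => F z.1 z.2) ->
  (forall t x, b < `|x| -> F t x = 0) -> continuous (fun t => I (F t)).
Proof.
move=> Hb Hs T F b0 Fc F0 t0.
pose b := Num.max b0 0; have b_ge0 : 0 <= b by rewrite le_max lexx orbT.
have Fb t : csupp b (F t).
  split=> [x|x]; last by rewrite gt_max => /andP[/F0 ->].
  apply: (@continuous_comp _ _ _ (fun x => (t, x)) (fun z : T * 'rV[R]_n => F z.1 z.2)).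
    exact: pair1_continuous.
  exact: Fc.
apply/cvgrPdist_le => /= e e0.
pose c := (2 * b) ^+ n + 1; have c0 : 0 < c by rewrite ltr_wpDl ?exprn_ge0 ?mulr_ge0.
have ec0 : 0 < e / c by rewrite divr_gt0.
have := compact_unif (F := F) (t0 := t0) (@ball_rV_compact R n b) (fun x _ => Fc (t0, x)) ec0.
apply: filterS => t Ft.
rewrite distrC -(Hs b)//.
apply: le_trans (Hb b _ (e / c) b_ge0 (csuppB (Fb t) (Fb t0)) _) _.
  move=> x; have [xb|xb] := leP `|x| b; first exact: Ft.
  by have [_ ->//] := Fb t; have [_ ->//] := Fb t0; rewrite subrr normr0 ltW.
by rewrite mulrCA ler_piMr ?(ltW e0)// ler_pdivrMr// mul1r lerDl.
Qed.

Let csupp_integral0 n : bound n -> subtr n ->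
  forall (V : normedModType R) (F : V -> 'rV[R]_n -> R) b,
  csupp b (fun z : V * 'rV[R]_n => F z.1 z.2) ->
  csupp b (fun t => I (F t)).
Proof.
move=> Hb Hs V F b [Fc F0]; split.
  apply: (continuous_integral0 Hb Hs (b := b) Fc) => t x bx.
  by apply: (F0 (t, x)); rewrite prod_normE/= lt_max bx orbT.
move=> t bt; have -> : F t = fun=> 0.
  by apply/funext => x; apply: (F0 (t, x)); rewrite prod_normE/= lt_max bt.
apply/eqP; rewrite -normr_le0 -[leRHS](mulr0 ((2 * 0) ^+ n)).
by apply: Hb (csupp0 _ _) _ => // x; rewrite normr0.
Qed.

Lemma csupp_rcons1 n b (f : 'rV[R]_n.+1 -> R) : csupp b f ->
  csupp b (fun z : R * 'rV[R]_n => f (rcons1 z.1 z.2)).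
Proof.
move=> [fc f0]; split=> [z|z bz]; last by apply: f0; rewrite norm_rcons1 -prod_normE.
apply: (@continuous_comp _ _ _ (fun z : R * 'rV[R]_n => rcons1 z.1 z.2) f).
  exact: rcons1_continuous.
exact: fc.
Qed.

Lemma csupp_slice (V W : normedModType R) b (F : V -> W -> R) t :
  csupp b (fun z : V * W => F z.1 z.2) -> csupp b (F t).
Proof.
move=> [Fc F0]; split=> [x|x bx]; last first.
  by apply: (F0 (t, x)); rewrite prod_normE/= lt_max bx orbT.
apply: (@continuous_comp _ _ _ (fun x => (t, x)) (fun z : V * W => F z.1 z.2)).
  exact: pair1_continuous.
exact: Fc.
Qed.

Lemma csupp_swap (V W : normedModType R) b (F : V -> W -> R) :
  csupp b (fun z : V * W => F z.1 z.2) -> csupp b (fun z : W * V => F z.2 z.1).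
Proof.
move=> [Fc F0]; split=> [z|z bz]; last first.
  by apply: (F0 (z.2, z.1)); move: bz; rewrite !prod_normE/= maxC.
apply: (@continuous_comp _ _ _ (fun z : W * V => (z.2, z.1)) (fun z : V * W => F z.1 z.2)).
  by apply: cvg_pair; [exact: cvg_snd|exact: cvg_fst].
exact: Fc.
Qed.

Let bound_subtr n : bound n /\ subtr n.
Proof.
elim: n => [|n [Hb Hs]].
  by split=> [b f M _ _|//]; rewrite expr0 mul1r; exact.
have slice b (f : 'rV[R]_n.+1 -> R) t : csupp b f -> csupp b (fun y => f (rcons1 t y)).
  by move=> /csupp_rcons1; exact: (csupp_slice (F := fun t y => f (rcons1 t y))).
have int b (f : 'rV[R]_n.+1 -> R) : csupp b f -> csupp b (fun t : R^o => I (fun y => f (rcons1 t y))).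
  by move=> /csupp_rcons1 /(csupp_integral0 Hb Hs (V := R^o) (F := fun t y => f (rcons1 t y))).
split=> [b f M b0 fb fM|b f g fb gb].
  rewrite integral_rVS exprS -mulrA.
  by apply: int1_bound (int _ _ fb) _ => // t; exact: Hb (slice _ _ _ fb) _.
rewrite !integral_rVS -(int1B (int _ _ fb) (int _ _ gb)).
by congr (Rintegral _ _ _); apply/funext => t; exact: Hs (slice _ _ _ fb) (slice _ _ _ gb).
Qed.

Lemma integral_rV_bound n b (f : 'rV[R]_n -> R) M : 0 <= b -> csupp b f ->
  (forall x, `|f x| <= M) -> `|I f| <= (2 * b) ^+ n * M.
Proof. by have [+ _] := bound_subtr n; exact. Qed.

Lemma integral_rVB n b (f g : 'rV[R]_n -> R) : csupp b f -> csupp b g ->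
  I (fun x => f x - g x) = I f - I g.
Proof. by have [_] := bound_subtr n; exact. Qed.

Lemma csupp_integral (V : normedModType R) n (F : V -> 'rV[R]_n -> R) b :
  csupp b (fun z : V * 'rV[R]_n => F z.1 z.2) -> csupp b (fun t => I (F t)).
Proof. by have [? ?] := bound_subtr n; exact: csupp_integral0. Qed.

Lemma csupp_integral1 n b (f : 'rV[R]_n.+1 -> R) : csupp b f ->
  csupp b (fun t : R => I (fun y => f (rcons1 t y))).
Proof. by move=> /csupp_rcons1 /(csupp_integral (V := R^o) (F := fun t y => f (rcons1 t y))). Qed.

Lemma csupp_rcons1_slice n b (f : 'rV[R]_n.+1 -> R) t : csupp b f ->
  csupp b (fun y => f (rcons1 t y)).
Proof.
by move=> /csupp_rcons1; exact: (csupp_slice (F := fun t y => f (rcons1 t y))).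
Qed.

Lemma integral_rV0 n : I (fun _ : 'rV[R]_n => 0) = 0.
Proof.
have := integral_rVB (@csupp0 _ 'rV[R]_n 0) (@csupp0 _ 'rV[R]_n 0).
by rewrite !subrr.
Qed.

Lemma integral_rVD n b (f g : 'rV[R]_n -> R) : csupp b f -> csupp b g ->
  I (fun x => f x + g x) = I f + I g.
Proof.
move=> fb gb; apply/eqP; rewrite -subr_eq; apply/eqP.
rewrite -(integral_rVB (csuppD fb gb) gb); congr integral_rV.
by apply/funext => x; rewrite addrK.
Qed.

Lemma integral_rVZ n b k (f : 'rV[R]_n -> R) : csupp b f ->
  I (fun x => k * f x) = k * I f.
Proof.
elim: n f => [//|n IH] f fb; rewrite !integral_rVS -(int1Z _ (csupp_integral1 fb)).
by congr (Rintegral _ _ _); apply/funext => t; exact: IH (csupp_rcons1_slice _ fb).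
Qed.

Lemma integral_rV_sum n b (J : Type) (r : seq J) (F : J -> 'rV[R]_n -> R) :
  (forall i, csupp b (F i)) ->
  I (fun x => \sum_(i <- r) F i x) = \sum_(i <- r) I (F i).
Proof.
move=> Fb; elim: r => [|i r IH].
  by rewrite big_nil; under eq_fun do rewrite big_nil; exact: integral_rV0.
rewrite big_cons -IH; under eq_fun do rewrite big_cons.
by apply: (@integral_rVD _ b) => //; exact: csupp_sum.
Qed.

Lemma integral_rV_ge0 n (f : 'rV[R]_n -> R) : (forall x, 0 <= f x) -> 0 <= I f.
Proof.
elim: n f => [f|n IH f f0]; first exact.
by rewrite integral_rVS; apply: Rintegral_ge0 => t _; exact: IH.
Qed.

End integral_rV.

(** * Fubini's theorem and the linear change of variables *)

Section fubini.
Variable R : realType.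
Notation mu := (@lebesgue_measure R).
Local Notation I := (@integral_rV R _).

Lemma eq_norm_le (x y : R) : (forall e, 0 < e -> `|x - y| <= e) -> x = y.
Proof.
move=> xy; apply/eqP; rewrite -subr_eq0 -normr_le0; apply/ler_addgt0Pr => e e0.
by rewrite add0r; exact: xy.
Qed.

Lemma int1E (g : R -> R) : \int[mu]_t g t = integral_rV (fun x : 'rV[R]_1 => g (x 0 0)).
Proof.
by rewrite integral_rVS; congr (Rintegral _ _ _); apply/funext => t /=; rewrite rcons1_0.
Qed.

Lemma csupp_int1 (V : normedModType R) (F : V -> R -> R) b :
  csupp b (fun z : V * R => F z.1 z.2) -> csupp b (fun x => \int[mu]_t F x t).
Proof.
move=> [Fc F0]; under eq_fun do rewrite int1E.
apply: (csupp_integral (F := fun x (z : 'rV[R]_1) => F x (z 0 0))); split=> [z|z bz].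
  apply: (@continuous_comp _ _ _ (fun z : V * 'rV[R]_1 => (z.1, z.2 0 0)) (fun z : V * R => F z.1 z.2)).
    apply: continuous_pair; first exact: cvg_fst.
    apply: (@continuous_comp _ _ _ (fun z : V * 'rV[R]_1 => z.2) (fun y : 'rV[R]_1 => y 0 0)).
      exact: cvg_snd.
    exact: coord_continuous.
  exact: Fc.
apply: (F0 (z.1, z.2 0 0)); move: bz; rewrite !prod_normE/= !lt_max => /orP[->//|bz].
apply/orP; right; rewrite (lt_le_trans bz)//.
by apply: row_norm_le => // j; rewrite ord1.
Qed.

Lemma csupp_uncurry n (F : R -> 'rV[R]_n -> R) b :
  csupp b (fun z : R * 'rV[R]_n => F z.1 z.2) ->
  csupp b (fun x : 'rV[R]_n.+1 => F (x 0 0) (\row_j x 0 (lift 0 j))).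
Proof.
move=> [Fc F0]; split=> [x|x bx].
  apply: (@continuous_comp _ _ _ (fun x : 'rV[R]_n.+1 => (x 0 0, \row_j x 0 (lift 0 j)))
    (fun z : R * 'rV[R]_n => F z.1 z.2)).
    apply: continuous_pair; first exact: coord_continuous.
    apply/continuous_rowP => j.
    rewrite (_ : (fun _ => _) = fun y : 'rV[R]_n.+1 => y 0 (lift 0 j)).
      exact: coord_continuous.
    by apply/funext => y; rewrite mxE.
  exact: Fc.
apply: (F0 (x 0 0, \row_j x 0 (lift 0 j))); move: bx; rewrite prod_normE/=.
have [t [y ->]] := rcons1P x; rewrite norm_rcons1 rcons1_0.
by have -> // : \row_j rcons1 t y 0 (lift 0 j) = y by apply/rowP => j; rewrite mxE rcons1_lift.
Qed.

(** Both sides are compared with the Riemann sum in t of the integrals over y: the sum passes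
    through the integral over y by linearity, and uniform continuity controls the two errors. *)
Lemma fubini_int1 n (F : R -> 'rV[R]_n -> R) b :
  csupp b (fun z : R * 'rV[R]_n => F z.1 z.2) ->
  \int[mu]_t I (F t) = I (fun y => \int[mu]_t F t y).
Proof.
wlog b0 : b / 0 < b => [wl Fb|Fb].
  by apply: (wl (Num.max b 1)); rewrite ?lt_max ?ltr01 ?orbT//; apply: csupp_le Fb; rewrite le_max lexx.
have b_ge0 := ltW b0.
apply: eq_norm_le => e e0.
(* The two summands of c are the volume factors of the two errors. *)
pose c := (2 * b) ^+ n * (2 * b) + (2 * b) * (2 * b) ^+ n.
have c0 : 0 < c by rewrite addr_gt0 ?mulr_gt0 ?exprn_gt0 ?mulr_gt0.
have ec0 : 0 < e / c by rewrite divr_gt0.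
have [d d0 dP] := csupp_unif (csupp_uncurry Fb) ec0.
have Fts s t y : `|s - t| <= d -> `|F s y - F t y| <= e / c.
  move=> st; have rE u : \row_j rcons1 u y 0 (lift 0 j) = y.
    by apply/rowP => j; rewrite mxE rcons1_lift.
  have := dP (rcons1 s y) (rcons1 t y); rewrite !rcons1_0 !rE; apply.
  have -> : rcons1 s y - rcons1 t y = rcons1 (s - t) 0.
    by apply/eqP; rewrite subr_eq -rcons1D add0r subrK.
  by rewrite norm_rcons1 normr0 ge_max st ltW.
pose N := (Num.bound (2 * b / d)).+1.
have N0 : (0 < N)%N by [].
have Nd : 2 * b / N%:R <= d.
  rewrite ler_pdivrMr ?ltr0n// [d * _]mulrC -ler_pdivrMr//.
  rewrite ltW// (lt_le_trans (archi_boundP _))// ?ler_nat//.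
  by rewrite !mulr_ge0// invr_ge0 ltW.
pose S (g : R -> R) := \sum_(k < N) 2 * b / N%:R * g (- b + k%:R * (2 * b / N%:R)).
have Fbt t : csupp b (F t) := csupp_slice t Fb.
have Fsw : csupp b (fun z : 'rV[R]_n * R => F z.2 z.1) := csupp_swap Fb.
have Fby y : csupp b (F^~ y : R^o -> R) := csupp_slice (F := fun y t => F t y) y Fsw.
have IF : csupp b (fun t : R^o => I (F t)) := csupp_integral (V := R^o) (F := F) Fb.
have SF : I (fun y => S (F^~ y)) = S (fun t => I (F t)).
  rewrite /S (@integral_rV_sum _ _ b) => [|k]; last exact: csuppZ.
  by apply: eq_bigr => k _; rewrite (integral_rVZ _ (Fbt _)).
apply: le_trans (ler_distD (S (fun t => I (F t))) _ _) _.
have -> : e = 2 * b * ((2 * b) ^+ n * (e / c)) + (2 * b) ^+ n * (2 * b * (e / c)).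
  transitivity (c * (e / c)); last by rewrite /c; ring.
  by rewrite mulrC divfK// gt_eqF.
apply: lerD.
  apply: (int1_riemann b_ge0 IF N0) => s t st.
  rewrite -(integral_rVB (Fbt s) (Fbt t)).
  apply: (integral_rV_bound b_ge0 (csuppB (Fbt s) (Fbt t))) => y.
  exact/Fts/(le_trans st).
rewrite -SF -(@integral_rVB _ _ b).
- apply: (integral_rV_bound (b := b)) => //.
    apply: csuppB; first by apply: csupp_sum => k _; exact: csuppZ.
    exact: (csupp_int1 (F := fun y t => F t y)).
  move=> y; rewrite distrC; apply: (int1_riemann b_ge0 (Fby y) N0) => s t st.
  exact/Fts/(le_trans st).
- by apply: csupp_sum => k _; exact: csuppZ.
- exact: (csupp_int1 (F := fun y t => F t y)).
Qed.

Lemma fubini_rV m n (F : 'rV[R]_m -> 'rV[R]_n -> R) b :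
  csupp b (fun z : 'rV[R]_m * 'rV[R]_n => F z.1 z.2) ->
  I (fun x => I (F x)) = I (fun y => I (F^~ y)).
Proof.
elim: m F => [//|m IH] F Fb; rewrite integral_rVS.
have G : csupp b (fun z : (R * 'rV[R]_n) * 'rV[R]_m => F (rcons1 z.1.1 z.2) z.1.2).
  have [Fc F0] := Fb; split=> [z|z bz].
    apply: (@continuous_comp _ _ _ (fun z : (R * 'rV[R]_n) * 'rV[R]_m =>
      (rcons1 z.1.1 z.2, z.1.2)) (fun z : 'rV[R]_m.+1 * 'rV[R]_n => F z.1 z.2)).
      apply: continuous_pair.
        apply: (@continuous_comp _ _ _ (fun z : (R * 'rV[R]_n) * 'rV[R]_m => (z.1.1, z.2))
          (fun z => rcons1 z.1 z.2)); last exact: rcons1_continuous.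
        apply: continuous_pair; last exact: cvg_snd.
        apply: (@continuous_comp _ _ _ (fun z : (R * 'rV[R]_n) * 'rV[R]_m => z.1) fst).
          exact: cvg_fst.
        exact: cvg_fst.
      apply: (@continuous_comp _ _ _ (fun z : (R * 'rV[R]_n) * 'rV[R]_m => z.1) snd).
        exact: cvg_fst.
      exact: cvg_snd.
    exact: Fc.
  apply: (F0 (rcons1 z.1.1 z.2, z.1.2)); move: bz.
  by rewrite !prod_normE/= norm_rcons1 -!maxA [Num.max _ `|z.2|]maxC.
have E t : I (fun x => I (F (rcons1 t x))) = I (fun y => I (fun x => F (rcons1 t x) y)).
  apply: (IH (fun x => F (rcons1 t x))).
  have [Fc F0] := Fb; split=> [z|z bz].
    apply: (@continuous_comp _ _ _ (fun z : 'rV[R]_m * 'rV[R]_n => (rcons1 t z.1, z.2))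
      (fun z : 'rV[R]_m.+1 * 'rV[R]_n => F z.1 z.2)); last exact: Fc.
    apply: continuous_pair; last exact: cvg_snd.
    apply: (@continuous_comp _ _ _ (fun z : 'rV[R]_m * 'rV[R]_n => (t, z.1))
      (fun z => rcons1 z.1 z.2)); last exact: rcons1_continuous.
    by apply: continuous_pair; [exact: cvg_cst|exact: cvg_fst].
  apply: (F0 (rcons1 t z.1, z.2)); rewrite prod_normE/= norm_rcons1 -maxA -prod_normE.
  by rewrite lt_max bz orbT.
transitivity (\int[mu]_t I (fun y => I (fun x => F (rcons1 t x) y))).
  by congr (Rintegral _ _ _); apply/funext => t; exact: E.
rewrite (@fubini_int1 n (fun t y => I (fun x => F (rcons1 t x) y)) b); last first.
  exact: (csupp_integral (F := fun (z : R * 'rV[R]_n) x => F (rcons1 z.1 x) z.2) G).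
by congr integral_rV; apply/funext => y; rewrite integral_rVS.
Qed.

Lemma csupp_shift n b (f : 'rV[R]_n -> R) a :
  csupp b f -> csupp (b + `|a|) (fun x => f (x + a)).
Proof.
move=> [fc f0]; split=> [x|x bx].
  apply: (@continuous_comp _ _ _ (fun x : 'rV[R]_n => x + a) f); last exact: fc.
  by apply: (@continuousD _ 'rV[R]_n 'rV[R]_n id (cst a)); [exact: cvg_id|exact: cst_continuous].
apply: f0; rewrite -(ltrD2r `|a|) (lt_le_trans bx)//.
by rewrite -[in leLHS](addrK a x) ler_normB.
Qed.

Lemma integral_rV_shift n b (f : 'rV[R]_n -> R) a : csupp b f ->
  I (fun x => f (x + a)) = I f.
Proof.
elim: n f a => [f a _|n IH f a fb].
  by rewrite /= [a]thinmx0 addr0.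
have [s [z ->]] := rcons1P a; rewrite !integral_rVS.
rewrite -[RHS](int1_affine s (@oner_neq0 R) (csupp_integral1 fb)) normr1 mul1r.
congr (Rintegral _ _ _); apply/funext => t; rewrite mul1r.
under eq_fun do rewrite -rcons1D.
exact: (IH (fun y => f (rcons1 (t + s) y)) z (csupp_rcons1_slice _ fb)).
Qed.

Lemma mulmx_bound m n (A : 'M[R]_(m, n)) :
  exists2 C, 0 < C & forall x : 'rV[R]_m, `|x *m A| <= C * `|x|.
Proof.
pose C := \sum_i \sum_j `|A i j| + 1.
have C1 : 0 <= \sum_i \sum_j `|A i j| by apply: sumr_ge0 => i _; exact: sumr_ge0.
have C0 : 0 < C by rewrite ltr_wpDl.
exists C => // x; apply: row_norm_le => [|j]; first by rewrite mulr_ge0// ltW.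
rewrite mxE (le_trans (ler_norm_sum _ _ _))//.
rewrite /C mulrDl mul1r -[leLHS]addr0 lerD// mulr_suml; apply: ler_sum => i _.
rewrite normrM mulrC ler_pM ?coord_norm_le//.
by rewrite (bigD1 j)//= lerDl; exact: sumr_ge0.
Qed.

Lemma mulmxr_continuous m n (A : 'M[R]_(m, n)) : continuous (fun x : 'rV[R]_m => x *m A).
Proof.
move=> x; apply/continuous_rowP => j.
rewrite (_ : (fun _ => _) = fun y : 'rV[R]_m => \sum_i y 0 i * A i j : R^o); last first.
  by apply/funext => y; rewrite mxE.
apply: (@Ck_continuous _ _ 0 setT) => //; apply: Ck_sum => [|i _]; first exact: openT.
by apply: CkM; [exact: openT|exact: Ck_coord|exact: Ck_cst].
Qed.

Lemma csupp_mulmx n b (f : 'rV[R]_n -> R) (A : 'M[R]_n) : A \in unitmx ->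
  csupp b f -> exists c, csupp c (fun x => f (x *m A)).
Proof.
move=> uA [fc f0]; have [C C0 CP] := mulmx_bound (invmx A).
exists (C * b); split=> [x|x bx].
  apply: (@continuous_comp _ _ _ (fun x : 'rV[R]_n => x *m A) f); last exact: fc.
  exact: mulmxr_continuous.
apply: f0; rewrite -(ltr_pM2l C0) (lt_le_trans bx)//.
by rewrite -[in leLHS](mulmxK uA x).
Qed.

Definition change_of_variables n (A : 'M[R]_n) := forall b (f : 'rV[R]_n -> R),
  csupp b f -> `|\det A| * I (fun x => f (x *m A)) = I f.

Lemma change_of_variables_mul n (A B : 'M[R]_n) : A \in unitmx -> B \in unitmx ->
  change_of_variables A -> change_of_variables B -> change_of_variables (A *m B).
Proof.
move=> uA uB cA cB b f fb; have [c gc] := csupp_mulmx uB fb.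
rewrite -(cB b f fb) -(cA c _ gc) det_mulmx normrM [RHS]mulrA [`|\det B| * _]mulrC.
by congr (_ * integral_rV _); apply/funext => x; rewrite mulmxA.
Qed.

Lemma rcons1_mul n t (y : 'rV[R]_n) a (b : 'rV[R]_n) c D :
  rcons1 t y *m (block_mx a%:M b c D : 'M[R]_(1 + n)) =
  rcons1 (t * a + (y *m c) 0 0) (t *: b + y *m D).
Proof.
rewrite /rcons1 (@mul_row_block _ 1 1 n 1 n).
have -> : const_mx t = t%:M :> 'M[R]_1 by apply/matrixP => i j; rewrite !ord1 !mxE eqxx.
rewrite mul_scalar_mx; congr row_mx.
  by apply/matrixP => i j; rewrite !ord1 !mxE eqxx mulr1n.
by rewrite mul_scalar_mx.
Qed.

Lemma change_of_variables_upper n (b : 'rV[R]_n) :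
  change_of_variables (block_mx 1%:M b 0 1%:M : 'M[R]_(1 + n)).
Proof.
move=> c f fc; rewrite det_ublock !det1 mulr1 normr1 mul1r !integral_rVS.
congr (Rintegral _ _ _); apply/funext => t.
under eq_fun do rewrite rcons1_mul mulmx0 mxE addr0 mulr1 mulmx1 addrC.
exact: (@integral_rV_shift _ c (fun y => f (rcons1 t y)) (t *: b) (csupp_rcons1_slice _ fc)).
Qed.

(** For fixed y the first coordinate undergoes a translation, so it has to be integrated innermost;
    hence the two uses of [fubini_int1]. *)
Lemma change_of_variables_lower n (a : 'cV[R]_n) :
  change_of_variables (block_mx 1%:M 0 a 1%:M : 'M[R]_(1 + n)).
Proof.
move=> b f fb.
have uA : (block_mx 1%:M 0 a 1%:M : 'M[R]_(1 + n)) \in unitmx.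
  by rewrite unitmxE det_lblock !det1 mulr1 unitr1.
have [c gc] := csupp_mulmx uA fb.
rewrite det_lblock !det1 mulr1 normr1 mul1r !integral_rVS.
rewrite (fubini_int1 (F := fun t y => f (rcons1 t y *m _)) (csupp_rcons1 gc)).
rewrite (fubini_int1 (F := fun t y => f (rcons1 t y)) (csupp_rcons1 fb)).
congr integral_rV; apply/funext => y.
have fy : csupp b (fun t : R^o => f (rcons1 t y)).
  exact: (csupp_slice (F := fun y t => f (rcons1 t y)) y
    (csupp_swap (F := fun t y => f (rcons1 t y)) (csupp_rcons1 fb))).
rewrite -(int1_affine ((y *m a) 0 0) (@oner_neq0 R) fy) normr1 mul1r.
congr (Rintegral _ _ _); apply/funext => t.
by rewrite rcons1_mul scaler0 add0r mulmx1 mulr1 mul1r.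
Qed.

Lemma change_of_variables_diag n a (D : 'M[R]_n) : a != 0 ->
  change_of_variables D -> change_of_variables (block_mx a%:M 0 0 D : 'M[R]_(1 + n)).
Proof.
move=> a0 cD b f fb; rewrite det_ublock det_scalar1 normrM !integral_rVS.
rewrite -(int1_affine 0 a0 (csupp_integral1 fb)) -mulrA; congr (_ * _).
have fD t : I (fun y => f (rcons1 (a * t + 0) y)) =
    `|\det D| * I (fun y => f (rcons1 t y *m (block_mx a%:M 0 0 D : 'M[R]_(1 + n)))).
  rewrite -(cD b _ (csupp_rcons1_slice _ fb)); congr (_ * integral_rV _).
  by apply/funext => y; rewrite rcons1_mul mulmx0 mxE scaler0 add0r mulrC.
under [in RHS]eq_Rintegral do rewrite fD.
(* A singular D is treated apart, because the composite with the block matrix need not have compact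
   support then. *)
have [D0|D0] := eqVneq (\det D) 0.
  rewrite D0 normr0 mul0r; under [in RHS]eq_Rintegral do rewrite mul0r.
  by rewrite Rintegral_cst// mul0r.
have uA : (block_mx a%:M 0 0 D : 'M[R]_(1 + n)) \in unitmx.
  by rewrite unitmxE det_ublock det_scalar1 unitfE mulf_neq0.
have [c gc] := csupp_mulmx uA fb.
by rewrite (int1Z _ (csupp_integral1 gc)).
Qed.

(* Block LU decomposition with the top left entry as pivot; if it vanishes,
   multiplying by [1 0; b^T 1] replaces it by b b^T. *)
Lemma integral_rV_mulmx n (A : 'M[R]_n) : A \in unitmx -> change_of_variables A.
Proof.
elim: n A => [A _ b f _|n IH].
  by rewrite det_mx00 normr1 mul1r; congr integral_rV; apply/funext => x; rewrite [x]thinmx0 mul0mx.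
have nz (a : R) (b : 'rV[R]_n) (c : 'cV[R]_n) (D : 'M[R]_n) : a != 0 ->
    (block_mx a%:M b c D : 'M[R]_(1 + n)) \in unitmx ->
    change_of_variables (block_mx a%:M b c D : 'M[R]_(1 + n)).
  move=> a0; pose S := D - (a^-1 *: c) *m b.
  have E : block_mx a%:M b c D = (block_mx 1%:M 0 (a^-1 *: c) 1%:M : 'M[R]_(1 + n)) *m
      (block_mx a%:M 0 0 S *m block_mx 1%:M (a^-1 *: b) 0 1%:M).
    rewrite !mulmx_block !mulmx0 !mul0mx !mulmx1 !mul1mx !addr0 !add0r.
    rewrite mul_scalar_mx scalerA mulfV// scale1r mul_mx_scalar scalerA mulfV// scale1r.
    by rewrite /S addrC subrK.
  have uL : (block_mx 1%:M 0 (a^-1 *: c) 1%:M : 'M[R]_(1 + n)) \in unitmx.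
    by rewrite unitmxE det_lblock !det1 mulr1 unitr1.
  have uU : (block_mx 1%:M (a^-1 *: b) 0 1%:M : 'M[R]_(1 + n)) \in unitmx.
    by rewrite unitmxE det_ublock !det1 mulr1 unitr1.
  rewrite E !unitmx_mul => /and3P[_ uD _].
  have uS : S \in unitmx.
    by move: uD; rewrite !unitmxE det_ublock unitrM => /andP[].
  apply: change_of_variables_mul => //; first by rewrite unitmx_mul uD.
    exact: change_of_variables_lower.
  apply: change_of_variables_mul => //; last exact: change_of_variables_upper.
  by apply: change_of_variables_diag => //; exact: IH.
move=> A; rewrite -[A](@submxK _ 1 n 1 n).
set a := ulsubmx _; set b := ursubmx _; set c := dlsubmx _; set D := drsubmx _.
rewrite [a]mx11_scalar => uA.
have [a0|] := eqVneq (a 0 0) 0; last by move=> a0; exact: nz.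
pose T : 'M[R]_(1 + n) := block_mx 1%:M 0 b^T 1%:M.
pose T' : 'M[R]_(1 + n) := block_mx 1%:M 0 (- b^T) 1%:M.
have TT : T *m T' = 1%:M.
  rewrite /T /T' mulmx_block !mulmx0 !mul0mx !mulmx1 !mul1mx !addr0 !add0r.
  by rewrite subrr scalar_mx_block.
have uT : T \in unitmx by rewrite unitmxE det_lblock !det1 mulr1 unitr1.
have uT' : T' \in unitmx by rewrite unitmxE det_lblock !det1 mulr1 unitr1.
rewrite -[block_mx _ _ _ _]mulmx1 -TT mulmxA.
apply: change_of_variables_mul => //; [by rewrite unitmx_mul uA|
  |exact: change_of_variables_lower].
(* The new pivot is the squared length of b, and b cannot vanish: with a = 0 the first row of the
   matrix would be zero. *)
have bb0 : (b *m b^T) 0 0 != 0.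
  apply/negP => /eqP b0; have {}b0 : b = 0.
    apply/rowP => j; rewrite [RHS]mxE; apply/eqP.
    move: b0; rewrite mxE => /eqP; rewrite psumr_eq0 => [/allP/(_ j)|i _].
      by rewrite mem_index_enum => /(_ isT); rewrite [b^T _ _]mxE mulf_eq0 orbb.
    by rewrite [b^T _ _]mxE -expr2 sqr_ge0.
  move: uA; rewrite b0 a0 unitmxE (_ : 0%:M = 0); last by apply/matrixP => i j; rewrite !mxE mul0rn.
  by rewrite (@det_lblock R 1 n (0 : 'M[R]_1) c D) det0 mul0r unitr0.
have uAT : block_mx (a 0 0)%:M b c D *m T \in unitmx by rewrite unitmx_mul uA.
move: uAT; rewrite /T mulmx_block !mulmx0 !mulmx1 !add0r a0.
have -> : (0 : R)%:M + b *m b^T = ((b *m b^T) 0 0)%:M.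
  rewrite -mx11_scalar (_ : 0%:M = 0) ?add0r//.
  by apply/matrixP => i j; rewrite !mxE mul0rn.
exact: nz.
Qed.

End fubini.

(** * Change of variables *)

Section cov.
Variable R : realType.
Notation mu := (@lebesgue_measure R).
Local Notation I := (@integral_rV R _).

(** L is closed as a compact subset of a Hausdorff space, so a point outside U has a neighbourhood
    missing L, on which the extension vanishes. *)
Lemma patch_continuous (X : topologicalType) (U L : set X) (g : X -> R) :
  hausdorff_space X -> open U -> (forall x, U x -> {for x, continuous g}) ->
  compact L -> (forall x, U x -> ~ L x -> g x = 0) -> L `<=` U ->
  continuous (patch (fun=> 0) U g).
Proof.
move=> hX oU gc cL gL LU x.
have [Ux|nUx] := pselect (U x).
  apply: near_eq_continuous (gc x Ux); near=> y.
  by rewrite patchE ifT// inE; near: y; exact: open_nbhs_nbhs.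
have : {for x, continuous (fun _ : X => 0 : R)} by exact: cst_continuous.
apply: near_eq_continuous; near=> y.
have nLy : (~` L) y.
  near: y; apply: open_nbhs_nbhs; split; last by move=> /LU.
  by apply: closed_openC; exact: compact_closed.
by rewrite patchE; case: ifPn => //; rewrite inE => Uy; rewrite gL.
Unshelve. all: by end_near. Qed.

Lemma patch_csupp (V : normedModType R) (U L : set V) (g : V -> R) :
  open U -> (forall x, U x -> {for x, continuous g}) ->
  compact L -> (forall x, U x -> ~ L x -> g x = 0) -> L `<=` U ->
  exists2 b, 0 < b & csupp b (patch (fun=> 0) U g) /\ L `<=` [set x | `|x| <= b].
Proof.
move=> oU gc cL gL LU.
have [M [_ LM]] := compact_bounded cL.
pose b := Num.max (M + 1) 1; exists b; first by rewrite lt_max ltr01 orbT.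
have Lb : L `<=` [set x | `|x| <= b].
  by move=> x /LM; apply; rewrite lt_max ltrDl ltr01.
split=> //; split; first exact: (patch_continuous (@norm_hausdorff _ V) oU gc cL gL LU).
move=> x bx; rewrite patchE; case: ifPn => //; rewrite inE => Ux; apply: gL => //.
by move=> /Lb /=; rewrite leNgt bx.
Qed.

Lemma integral_rV_gt0 n b (f : 'rV[R]_n -> R) x0 : csupp b f ->
  (forall x, 0 <= f x) -> 0 < f x0 -> 0 < I f.
Proof.
elim: n f x0 => [f x0 _ _|n IH f x0 fb f0 fx0].
  by rewrite [x0]thinmx0.
have [t0 [y0 ex0]] := rcons1P x0; subst x0; rewrite integral_rVS.
have gb := csupp_integral1 fb; set g := fun t => _ in gb *.
have g0 t : 0 <= g t by apply: integral_rV_ge0.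
have gt0 : 0 < g t0 by apply: IH (csupp_rcons1_slice _ fb) _ fx0.
have [gc _] := gb.
have /cvgrPdist_le/(_ (g t0 / 2)) := gc t0; rewrite divr_gt0// => /(_ isT).
move=> /nbhs_ballP[d /= d0 dP]; pose J := `[t0 - d / 2, t0 + d / 2]%classic.
have Jg t : J t -> g t0 / 2 <= g t.
  rewrite /J/= in_itv/= => /andP[t1 t2].
  have /dP : ball t0 d t by rewrite -ball_normE/= ltr_norml; apply/andP; split; lra.
  by rewrite /= ler_norml => /andP[_]; lra.
have gi := csupp_integrable gb.
apply: lt_le_trans (_ : \int[mu]_(t in J) g t <= _); last first.
  rewrite Rintegral_mkcond; apply: le_Rintegral => //.
  - rewrite -restrict_EFin; apply/integrable_restrict => //; first exact: measurable_itv.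
    by apply: integrableS gi => //; apply: measurableI => //; exact: measurable_itv.
  - by move=> t _; rewrite patchE; case: ifPn => _ //; exact: g0.
apply: lt_le_trans (_ : \int[mu]_(t in J) (g t0 / 2) <= _).
  rewrite /J Rintegral_cst// fine_itv_cc; last lra.
  by rewrite mulr_gt0// ?divr_gt0//; lra.
have mJ : measurable J by exact: measurable_itv.
apply: le_Rintegral => //; last by apply: integrableS gi.
apply: (@continuous_integrable _ (cst (g t0 / 2)) `[t0 - d / 2, t0 + d / 2] (t0 - d / 2) (t0 + d / 2)) => //.
by move=> t; exact: cvg_cst.
Qed.

Lemma Ck_det n p k U (A : 'rV[R]_n -> 'M[R]_p) : open U ->
  (forall i j, Ck k U (fun x => A x i j)) -> Ck k U (fun x => \det (A x)).
Proof.
move=> oU CA; rewrite /determinant; apply: Ck_sum => // s _.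
by apply: CkM => //; [exact: Ck_cst|apply: Ck_prod].
Qed.

(** Rows are indexed by the directions, so the derivative is [v *m Jac f x] and the chain rule
    multiplies Jacobians in the order in which the maps are applied. *)
Definition Jac n p (f : 'rV[R]_n -> 'rV[R]_p) (x : 'rV[R]_n) : 'M[R]_(n, p) :=
  \matrix_(i, j) 'D_(delta_mx 0 i) (fun y => f y 0 j : R^o) x.

Lemma strict_Jac n p U (f : 'rV[R]_n -> 'rV[R]_p) z0 e :
  open U -> (forall j, Ck 1 U (fun x => f x 0 j)) -> U z0 -> 0 < e ->
  exists2 r, 0 < r & ball z0 r `<=` U /\
    forall x y, ball z0 r x -> ball z0 r y ->
      `|f x - f y - (x - y) *m Jac f z0| <= e * `|x - y|.
Proof.
move=> oU Cf Uz0 e0.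
have rU : \forall r \near (0:R)^'+, ball z0 r `<=` U.
  have [r /= r0 rU] := (@nbhs_ballP _ _ z0 U).1 (open_nbhs_nbhs (conj oU Uz0)).
  near=> r' => x xr; apply: rU; apply: le_ball xr; near: r'; exact: nbhs_right_le.
have rj : \forall r \near (0:R)^'+, forall j x y, ball z0 r x -> ball z0 r y ->
    `|f x 0 j - f y 0 j - \sum_i (x 0 i - y 0 i) * Jac f z0 i j| <= e * `|x - y|.
  apply: filter_forall => j.
  have [r r0 [_ rP]] := strict_derivative oU (Cf j) Uz0 e0.
  near=> r' => x y xr yr.
  have le_r : r' <= r by near: r'; exact: nbhs_right_le.
  under eq_bigr do rewrite [Jac _ _ _ _]mxE.
  exact: rP x y (le_ball le_r xr) (le_ball le_r yr).
have [r [r0 [rU' rj']]] := filter_ex (filterI (nbhs_right_gt 0) (filterI rU rj)).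
exists r => //; split=> // x y xr yr; apply: row_norm_le; first by rewrite mulr_ge0// ltW.
move=> j; rewrite !mxE (eq_bigr (fun i => (x 0 i - y 0 i) * Jac f z0 i j)); last first.
  by move=> i _; rewrite !mxE.
exact: rj'.
Unshelve. all: by end_near. Qed.

End cov.

Lemma continuous_at_dist (R : realType) (T : topologicalType) (f : T -> R) x :
  (forall e, 0 < e -> \forall y \near x, `|f x - f y| <= e) -> {for x, continuous f}.
Proof. by move=> fx; apply/cvgrPdist_le. Qed.

Section hat.
Variables (R : realType) (n : nat).
Local Notation I := (@integral_rV R _).

(** A tent in the sup norm. The kernel is only ever integrated and compared in size, so Lipschitz
    continuity is enough regularity, and its integral, a positive constant, cancels at the end. *)
Definition hat (v : 'rV[R]_n) : R := Num.max 0 (1 - `|v|).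

Lemma hat_ge0 v : 0 <= hat v. Proof. by rewrite le_max lexx. Qed.

Lemma hat_le1 v : hat v <= 1. Proof. by rewrite ge_max ler01 gerBl normr_ge0. Qed.

Lemma hat_eq0 v : 1 <= `|v| -> hat v = 0.
Proof. by move=> v1; rewrite /hat max_l// subr_le0. Qed.

Lemma hat_lipschitz v w : `|hat v - hat w| <= `|v - w|.
Proof.
have h (a b : 'rV[R]_n) : hat a <= hat b + `|a - b|.
  rewrite /hat ge_max addr_ge0 ?hat_ge0//= -lerBlDr le_max.
  apply/orP; right; have := ler_distD b 0 a; rewrite !sub0r !normrN.
  by rewrite -lerBlDl; have := ler_distD a b 0; rewrite !subr0 distrC; lra.
rewrite ler_norml; apply/andP; split.
  by have := h w v; rewrite distrC; lra.
by have := h v w; lra.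
Qed.

Lemma hat_continuous : continuous hat.
Proof.
move=> v; apply: continuous_at_dist => e e0; apply/nbhs_ballP; exists e => // w.
by rewrite -ball_normE/= => /ltW vw; rewrite (le_trans (hat_lipschitz _ _)).
Qed.

Lemma hat_csupp : csupp 1 hat.
Proof. by split=> [|v v1]; [exact: hat_continuous|rewrite hat_eq0// ltW]. Qed.

Lemma integral_hat_gt0 : 0 < I hat.
Proof.
apply: (@integral_rV_gt0 _ _ _ _ 0 hat_csupp hat_ge0).
by rewrite /hat normr0 subr0 lt_max ltr01 orbT.
Qed.

End hat.

Section kernel_tools.
Variables (R : realType) (n : nat).
Local Notation I := (@integral_rV R _).

Lemma csupp_affine b (g : 'rV[R]_n -> R) z e : e != 0 -> csupp b g ->
  csupp ((b + `|z|) / `|e|) (fun u => g (e *: u + z)).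
Proof.
move=> e0 [gc g0]; split=> [u|u bu].
  apply: (@continuous_comp _ _ _ (fun u : 'rV[R]_n => e *: u + z) g); last exact: gc.
  apply: (@continuousD _ 'rV[R]_n 'rV[R]_n ( *:%R e) (cst z)); last exact: cst_continuous.
  exact: scaler_continuous.
apply: g0; move: bu; rewrite ltr_pdivrMr ?normr_gt0// mulrC -normrZ => bu.
rewrite -(ltrD2r `|z|) (lt_le_trans bu)//.
by rewrite -[in leLHS](addrK z (e *: u)) ler_normB.
Qed.

Lemma integral_rV_affine b (g : 'rV[R]_n -> R) z e : e != 0 -> csupp b g ->
  `|e| ^+ n * I (fun u => g (e *: u + z)) = I g.
Proof.
move=> e0 gb; rewrite -(integral_rV_shift z gb).
have uE : (e%:M : 'M[R]_n) \in unitmx.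
  by rewrite unitmxE det_scalar unitrX// unitfE.
rewrite -(integral_rV_mulmx uE (csupp_shift z gb)) det_scalar normrX; congr (_ * integral_rV _).
by apply/funext => u; rewrite mul_mx_scalar.
Qed.

Lemma compact_thicken (K : set 'rV[R]_n) e : compact K ->
  compact [set p | exists2 k, K k & `|p - k| <= e].
Proof.
move=> cK.
have -> : [set p | exists2 k, K k & `|p - k| <= e] =
    (fun z : 'rV[R]_n * 'rV[R]_n => z.1 + z.2) @` (K `*` [set v | `|v| <= e]).
  apply/seteqP; split=> [p [k Kk pk]|_ [[k v] [/= Kk ve] <-]].
    by exists (k, p - k) => //=; rewrite addrC subrK.
  by exists k => //; rewrite addrC addKr.
apply: continuous_compact; last by apply: compact_setX => //; exact: ball_rV_compact.
apply: continuous_subspaceT => z.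
by apply: (@continuousD _ 'rV[R]_n _ fst snd); [exact: cvg_fst|exact: cvg_snd].
Qed.

Lemma closed_ball_compact (y : 'rV[R]_n) r : compact [set z : 'rV[R]_n | `|z - y| <= r].
Proof.
have -> : [set z : 'rV[R]_n | `|z - y| <= r] = [set p | exists2 k, [set y] k & `|p - k| <= r].
  by apply/seteqP; split=> [p pK|p [k /= ->]//]; exists y.
exact/compact_thicken/compact_set1.
Qed.

Lemma compact_image (X Y : topologicalType) (K : set X) (f : X -> Y) :
  (forall x, K x -> {for x, continuous f}) -> compact K -> compact (f @` K).
Proof.
move=> fc cK; apply: continuous_compact => //.
by apply: continuous_in_subspaceT => x; rewrite inE; exact: fc.
Qed.

End kernel_tools.

(** * The nonlinear change of variables *)

Section kernel.
Variables (R : realType) (n : nat) (U V : set 'rV[R]_n) (phi psi : 'rV[R]_n -> 'rV[R]_n).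
Hypothesis oU : open U.
Hypothesis oV : open V.
Hypothesis psiU : forall y, V y -> U (psi y).
Hypothesis phiK : forall x, U x -> psi (phi x) = x.
Hypothesis psiK : forall y, V y -> phi (psi y) = y.
Hypothesis Cphi : forall j, Ck 1 U (fun x => phi x 0 j).
Hypothesis psic : forall y, V y -> {for y, continuous psi}.
Hypothesis detJ : forall x, U x -> \det (Jac phi x) != 0.
Local Notation I := (@integral_rV R _).
Local Notation J x := `|\det (Jac phi x)|.

Let phic x : U x -> {for x, continuous phi}.
Proof. by move=> Ux; apply/continuous_rowP => j; exact: Ck_continuous (Cphi j) Ux. Qed.

Let Jc x : U x -> {for x, continuous (fun x => J x)}.
Proof.
move=> Ux; apply: (@continuous_comp _ _ _ (fun x => \det (Jac phi x)) Num.norm).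
  have : Ck 0 U (fun x => \det (Jac phi x)).
    apply: Ck_det => // i j.
    rewrite (_ : (fun _ => _) = 'D_(delta_mx 0 i) (fun y => phi y 0 j : R^o)).
      exact: Ck_derive (Cphi j).
    by apply/funext => y; rewrite mxE.
  by move=> /Ck_continuous/(_ Ux).
exact: (@norm_continuous _ R^o).
Qed.

Let ker e y := patch (fun=> 0) U (fun x => hat (e^-1 *: (phi x - y)) * J x).

Let hatc e y x : U x -> {for x, continuous (fun x => hat (e^-1 *: (phi x - y)))}.
Proof.
move=> Ux; apply: (@continuous_comp _ _ _ (fun x => e^-1 *: (phi x - y)) (@hat R n)).
  apply: (@continuous_comp _ _ _ (fun x => phi x - y) ( *:%R e^-1)).
    apply: (@continuousD _ 'rV[R]_n _ phi (cst (- y))); first exact: phic.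
    exact: cst_continuous.
  exact: scaler_continuous.
exact: hat_continuous.
Qed.

Let hat_ball e (y p : 'rV[R]_n) : 0 < e -> hat (e^-1 *: (p - y)) != 0 -> `|p - y| <= e.
Proof.
move=> e0; apply: contra_neqT; rewrite -ltNge => ep; apply: hat_eq0.
by rewrite normrZ gtr0_norm ?invr_gt0// ler_pdivlMl// mulr1 ltW.
Qed.

Let ker_csupp e y : 0 < e -> [set p | `|p - y| <= e] `<=` V ->
  exists2 b, 0 < b & csupp b (ker e y).
Proof.
move=> e0 yV; pose K := [set p : 'rV[R]_n | `|p - y| <= e].
have cK : compact K by exact: closed_ball_compact.
have [||||b b0 [bk _]] := @patch_csupp _ _ U (psi @` K)
    (fun x => hat (e^-1 *: (phi x - y)) * J x) oU.
- by move=> x Ux; apply: continuousM; [exact: hatc|exact: Jc].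
- by apply: compact_image => // p /yV; exact: psic.
- move=> x Ux nx; apply/eqP; rewrite mulf_eq0; apply/orP; left; apply/negP => /negP h0.
  by apply: nx; exists (phi x); [exact: hat_ball h0|exact: phiK].
- by move=> _ [p /yV Vp <-]; exact: psiU.
by exists b.
Qed.

(** Putting x = e u + psi y turns (phi x - y) / e into nearly u J0, with J0 the Jacobian at z0, so
    the rescaled kernel is close to [hat (u *m J0)] times |det J0|, whose integral is that of [hat]
    by the linear case. Strict differentiability at z0 makes the estimate uniform in y near y0. *)
Let ker_local y0 eta : V y0 -> 0 < eta ->
  \forall y \near y0 & e \near (0:R)^'+,
    `|I (fun u => ker e y (e *: u + psi y)) - I (@hat R n)| <= eta.
Proof.
move=> Vy0 eta0; pose z0 := psi y0; have Uz0 : U z0 by exact: psiU.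
pose J0 := Jac phi z0.
have uJ0 : J0 \in unitmx by rewrite unitmxE unitfE detJ.
have [C C0 CP] := mulmx_bound (invmx J0).
have C1 (x : 'rV[R]_n) : `|x| <= C * `|x *m J0| by have := CP (x *m J0); rewrite mulmxK.
(* C bounds the inverse of J0. Outside the radius 2C both kernels vanish: the limit because |u| <= C
   |u J0|, the other because an error e1 <= 1 / (2C) takes up only half of that bound. *)
pose rho := 2 * C; have rho0 : 0 < rho by rewrite mulr_gt0.
pose th := eta / (2 * rho) ^+ n.
have th0 : 0 < th by rewrite divr_gt0// exprn_gt0// mulr_gt0.
pose D := J z0 + 1; have D0 : 0 < D by rewrite ltr_wpDl.
pose e2 := Num.min 1 (th / 2); have e20 : 0 < e2 by rewrite lt_min ltr01 divr_gt0.
(* The first entry of the minimum serves the support bound, the second the Lipschitz error of [hat]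
   multiplied by the bound D of the Jacobian; D is such a bound because e2 <= 1. *)
pose e1 := Num.min rho^-1 (th / 2 / (rho * D)).
have e10 : 0 < e1.
  by rewrite lt_min invr_gt0 rho0/=; apply: divr_gt0; [exact: divr_gt0|exact: mulr_gt0].
have e1r : e1 <= rho^-1 by rewrite ge_min lexx.
have e1t : e1 * (rho * D) <= th / 2.
  by rewrite -ler_pdivlMr ?mulr_gt0// ge_min lexx orbT.
have [r1 r10 [r1U r1P]] := strict_Jac oU Cphi Uz0 e10.
have /nbhs_ballP[r2 /= r20 r2P] : \forall x \near z0, `|J z0 - J x| <= e2.
  by have /cvgrPdist_le/(_ _ e20) := Jc Uz0.
pose r := Num.min r1 r2; have r0 : 0 < r by rewrite lt_min r10.
have rr1 : r <= r1 by rewrite ge_min lexx.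
have rr2 : r <= r2 by rewrite ge_min lexx orbT.
have /nbhs_ballP[s /= s0 sP] : \forall y \near y0, V y /\ ball z0 (r / 2) (psi y).
  apply: filterI; first exact: open_nbhs_nbhs.
  by apply: (psic Vy0); apply: nbhsx_ballx; rewrite divr_gt0.
exists (ball y0 (s / 2), [set e | 0 < e /\ e < Num.min (s / 2) (r / 2 / rho)]).
  split=> /=; first by apply: nbhsx_ballx; rewrite divr_gt0.
  apply: filterI; first exact: nbhs_right_gt.
  by apply: nbhs_right_lt; rewrite lt_min !divr_gt0.
move=> [y e] /= [ys [e0]]; rewrite lt_min => /andP[es er].
set z := psi y.
have halfs p : ball y0 (s / 2) p -> ball y0 s p.
  by apply: le_ball; lra.
have [Vy zr2] := sP _ (halfs _ ys).
have zr : ball z0 r z by apply: le_ball zr2; lra.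
have ball_ye p : `|p - y| <= e -> ball y0 s p.
  move=> pe; rewrite (splitr s); apply: (ball_triangle ys).
  by rewrite -ball_normE/= distrC (le_lt_trans pe).
have yeV : [set p | `|p - y| <= e] `<=` V by move=> p /ball_ye /sP[].
have [b b0 kb] := ker_csupp e0 yeV.
have en0 : e != 0 by rewrite gt_eqF.
have kb' := csupp_affine z en0 kb.
have [c hc] := csupp_mulmx uJ0 (@hat_csupp R n).
pose H u := hat (u *m J0) * J z0.
have Hc : csupp c H by apply: csuppMr => // x; exact: cst_continuous.
have HI : I H = I (@hat R n).
  rewrite -(integral_rV_mulmx uJ0 (@hat_csupp R n)) -(integral_rVZ _ hc).
  by congr integral_rV; apply/funext => u; rewrite mulrC.
rewrite -HI.
have zE u : e *: u + z - z = e *: u by rewrite addrK.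
have inball u : `|u| <= rho -> ball z0 r (e *: u + z).
  move=> ur; rewrite (splitr r); apply: (ball_triangle zr2).
  rewrite -ball_normE/= opprD addrCA subrr addr0 normrN normrZ gtr0_norm//.
  by apply: le_lt_trans (ler_wpM2l (ltW e0) ur) _; rewrite -ltr_pdivlMr.
have strict x : ball z0 r x -> `|phi x - y - (x - z) *m J0| <= e1 * `|x - z|.
  by move=> xr; rewrite -[in X in phi x - X](psiK Vy); apply: r1P; exact: le_ball rr1 _ _.
have out u : ~~ (`|u| <= rho) -> ker e y (e *: u + z) = 0 /\ H u = 0.
  rewrite -ltNge => ur; split; last first.
    rewrite /H hat_eq0 ?mul0r//.
    rewrite -(ler_pM2l C0) mulr1 (le_trans _ (C1 u))// (le_trans _ (ltW ur))//.
    by rewrite /rho ler_peMl ?ler1n ?ltW.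
  rewrite /ker patchE; case: ifPn => //; rewrite inE => Ux; apply/eqP.
  rewrite mulf_eq0; apply/orP; left; apply/negP => /negP h0.
  (* The point e u + z is known only to lie in U. It is the image under psi of a point within e of
     y, and the continuity of psi at y0 brings it into the ball where phi is nearly linear. *)
  have xe := hat_ball e0 h0.
  have [_ ] := sP _ (ball_ye _ xe); rewrite phiK// => xr2.
  have xr : ball z0 r (e *: u + z).
    by apply: le_ball xr2; lra.
  have := strict _ xr; rewrite zE => st.
  have k1 : C * `|(e *: u) *m J0| <= C * (e1 * `|e *: u| + e).
    rewrite ler_pM2l//; apply: le_trans (lerD st xe).
    have := ler_normB (phi (e *: u + z) - y) (phi (e *: u + z) - y - (e *: u) *m J0).
    by rewrite subKr addrC.
  have := le_trans (C1 _) k1; rewrite mulrDr mulrA.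
  have k2 : C * e1 * `|e *: u| <= `|e *: u| / 2.
    rewrite mulrC ler_wpM2l//; apply: le_trans (ler_wpM2l (ltW C0) e1r) _.
    by rewrite /rho invfM mulrCA mulfV ?gt_eqF// mulr1.
  have -> : `|e *: u| = e * `|u| by rewrite normrZ gtr0_norm.
  move: k2; rewrite normrZ gtr0_norm// => k2 k3.
  have : e * rho < e * `|u| by rewrite ltr_pM2l.
  by move: k2 k3; rewrite /rho; set t := e * `|u|; lra.
have est u : `|ker e y (e *: u + z) - H u| <= th.
  have [ur|ur] := boolP (`|u| <= rho); last first.
    by have [-> ->] := out u ur; rewrite subrr normr0 ltW.
  have xr := inball _ ur.
  have Ux : U (e *: u + z) by apply: r1U; exact: le_ball rr1 _ xr.
  rewrite /ker patchE ifT ?inE// /H.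
  set x := e *: u + z; set p := e^-1 *: _.
  have pu : `|p - u *m J0| <= e1 * rho.
    have -> : p - u *m J0 = e^-1 *: (phi x - y - (x - z) *m J0).
      by rewrite /x zE -scalemxAl scalerBr scalerA mulVf// scale1r.
    rewrite normrZ gtr0_norm ?invr_gt0// ler_pdivrMl//.
    rewrite (le_trans (strict _ xr))// /x zE normrZ gtr0_norm// mulrCA.
    by rewrite ler_wpM2l ?(ltW e0)// ler_wpM2l ?(ltW e10).
  have JJ : `|J z0 - J x| <= e2 by apply: r2P; exact: le_ball rr2 _ xr.
  have JD : J x <= D.
    have : e2 <= 1 by rewrite ge_min lexx.
    by move: JJ; rewrite ler_norml => /andP[]; rewrite /D; lra.
  have -> : hat p * J x - hat (u *m J0) * J z0 =
     (hat p - hat (u *m J0)) * J x + hat (u *m J0) * (J x - J z0) by ring.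
  rewrite (splitr th) (le_trans (ler_normD _ _))// lerD//.
    rewrite normrM normr_id (le_trans _ e1t)// mulrA ler_pM//.
    exact: le_trans (hat_lipschitz _ _) pu.
  rewrite normrM ger0_norm ?hat_ge0//.
  apply: le_trans (ler_piMl _ (hat_le1 _)) _ => //.
  by rewrite distrC (le_trans JJ)// ge_min lexx orbT.
have -> : eta = (2 * rho) ^+ n * th.
  by rewrite mulrC divfK// gt_eqF// exprn_gt0// mulr_gt0.
pose c' := Num.max ((b + `|z|) / `|e|) c.
have k1 : csupp c' (fun u => ker e y (e *: u + z)).
  by apply: csupp_le kb'; rewrite le_max lexx.
have k2 : csupp c' H by apply: csupp_le Hc; rewrite le_max lexx orbT.
rewrite -(integral_rVB k1 k2); apply: integral_rV_bound est; first exact: ltW.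
have [kc _] := csuppB k1 k2; split=> // u ur.
by have [|-> ->] := out u; rewrite ?subrr// -ltNge.
Qed.

Let hat_csuppM (f : 'rV[R]_n -> R) b e p : csupp b f ->
  csupp b (fun y => hat (e^-1 *: (p - y)) * f y).
Proof.
move=> [fc f0]; split=> [y|y yb]; last by rewrite f0// mulr0.
apply: (@continuousM _ _ (fun y => hat (e^-1 *: (p - y))) f); last exact: fc.
apply: (@continuous_comp _ _ _ (fun y => e^-1 *: (p - y)) (@hat R n)); last exact: hat_continuous.
apply: (@continuous_comp _ _ _ (fun y => p - y) ( *:%R e^-1)); last exact: scaler_continuous.
apply: (@continuousD _ 'rV[R]_n _ (cst p) -%R); first exact: cst_continuous.
exact: opp_continuous.
Qed.

(** The substitution y = p - e u turns the integral into e^n times that of [hat u] against f near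
    p. *)
Let hat_int (f : 'rV[R]_n -> R) b e p w : 0 < e -> csupp b f ->
  (forall v, `|v| <= 1 -> `|f (p - e *: v) - f p| <= w) ->
  `|I (fun y => hat (e^-1 *: (p - y)) * f y) - e ^+ n * (f p * I (@hat R n))|
    <= e ^+ n * (2 ^+ n * w).
Proof.
move=> e0 fb fw; have Ne0 : - e != 0 by rewrite oppr_eq0 gt_eqF.
have gb : csupp b (fun y => hat (e^-1 *: (p - y)) * f y) := hat_csuppM e p fb.
rewrite -(integral_rV_affine p Ne0 gb) normrN (gtr0_norm e0) -mulrBr normrM.
rewrite (gtr0_norm (exprn_gt0 n e0)) ler_pM2l ?exprn_gt0//.
have E : (fun u => hat (e^-1 *: (p - (- e *: u + p))) * f (- e *: u + p)) =
    fun u => hat u * f (p - e *: u).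
  apply/funext => u; congr (hat _ * f _).
    by rewrite opprD addrCA subrr addr0 scaleNr opprK scalerA mulVf ?gt_eqF// scale1r.
  by rewrite scaleNr addrC.
rewrite E -(integral_rVZ (f p) (@hat_csupp R n)).
have h1 : csupp 1 (fun u => hat u * f (p - e *: u)).
  apply: csuppMr; first exact: hat_csupp.
  move=> u; apply: (@continuous_comp _ _ _ (fun u => p - e *: u) f); last by have [fc _] := fb; exact: fc.
  apply: (@continuousD _ 'rV[R]_n _ (cst p) (fun u => - (e *: u))); first exact: cst_continuous.
  apply: (@continuousN _ 'rV[R]_n 'rV[R]_n ( *:%R e)); exact: scaler_continuous.
have h2 : csupp 1 (fun u : 'rV[R]_n => f p * hat u) by apply: csuppZ; exact: hat_csupp.
rewrite -(integral_rVB h1 h2).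
have -> : 2 ^+ n * w = (2 * 1) ^+ n * w by rewrite mulr1.
apply: (integral_rV_bound ler01 (csuppB h1 h2)) => u.
rewrite [f p * _]mulrC -mulrBr normrM ger0_norm ?hat_ge0//.
have [u1|u1] := leP `|u| 1; first by apply: le_trans (ler_piMl _ (hat_le1 _)) (fw _ u1).
rewrite hat_eq0; last exact: ltW.
rewrite mul0r.
have : `|f (p - e *: 0) - f p| <= w by apply: fw; rewrite normr0.
by apply: le_trans; exact: normr_ge0.
Qed.

(* Over (x, y), the integral of f(y) hat((phi x - y) / e) |det D phi(x)| is
   e^n (I f) (I hat) + o(e^n) when x is integrated out first, and
   e^n (I ((f o phi) |det D phi|)) (I hat) + o(e^n) when y is. *)
Theorem integral_rV_change (f : 'rV[R]_n -> R) (K : set 'rV[R]_n) :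
  continuous f -> compact K -> K `<=` V -> (forall y, ~ K y -> f y = 0) ->
  I (patch (fun=> 0) U (fun x => f (phi x) * J x)) = I f.
Proof.
move=> fc cK KV f0.
have [bf bf0 [fb _]] : exists2 b, 0 < b & csupp b f /\ K `<=` [set x | `|x| <= b].
  have [b b0 [fb Kb]] := @patch_csupp _ _ setT K f openT (fun x _ => fc x) cK (fun x _ => f0 x) (fun x _ => Logic.I).
  by exists b => //; rewrite patch_setT in fb.
have [Mf Mf0 fM] : exists2 M, 0 < M & forall y, `|f y| <= M.
  have [M [_ MP]] := compact_bounded (compact_image (fun x _ => fc x) cK).
  pose M' := Num.max (M + 1) 1; exists M'; first by rewrite lt_max ltr01 orbT.
  move=> y; have [Ky|nKy] := pselect (K y).
    by apply: (MP M'); [rewrite lt_max ltrDl ltr01|exists y].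
  by rewrite f0// normr0 le_max ler01 orbT.
pose F := patch (fun=> 0) U (fun x => f (phi x) * J x).
have KeV : \forall e \near (0:R)^'+, K `<=` [set k | [set p | `|p - k| <= e] `<=` V].
  apply: ((compact_near_coveringP K).1 cK R (0^'+) (fun e k => [set p | `|p - k| <= e] `<=` V)).
  move=> k0 /KV Vk0; have /nbhs_ballP[s /= s0 sV] := open_nbhs_nbhs (conj oV Vk0).
  exists (ball k0 (s / 2), [set e | e < s / 2]).
    by split=> /=; [apply: nbhsx_ballx; rewrite divr_gt0|apply: nbhs_right_lt; rewrite divr_gt0].
  move=> [k e] /= [ks es] p pe; apply: sV; rewrite (splitr s); apply: (ball_triangle ks).
  by rewrite -ball_normE/= distrC (le_lt_trans pe).
(* K can be thickened by d inside V. For e <= d, the set L = psi(Kd) then catches every x at which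
   the double integrand can be nonzero. *)
have [d [d0 dV]] := filter_ex (filterI (nbhs_right_gt 0) KeV).
pose Kd := [set p | exists2 k, K k & `|p - k| <= d].
have cKd : compact Kd := compact_thicken (e := d) cK.
have KdV : Kd `<=` V by move=> p [k Kk pk]; exact: (dV k Kk).
have KKd : K `<=` Kd by move=> k Kk; exists k => //; rewrite subrr normr0 ltW.
pose L := psi @` Kd.
have cL : compact L by apply: compact_image => // p /KdV; exact: psic.
have LU : L `<=` U by move=> _ [p /KdV Vp <-]; exact: psiU.
have LP x p : U x -> Kd p -> phi x = p -> L x.
  by move=> Ux Kp e; exists p => //; rewrite -e phiK.
have [bF bF0 [Fb Lb]] : exists2 b, 0 < b & csupp b F /\ L `<=` [set x | `|x| <= b].
  apply: patch_csupp => // x Ux.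
    apply: continuousM; last exact: Jc.
    by apply: (@continuous_comp _ _ _ phi f); [exact: phic|exact: fc].
  move=> nL; rewrite f0 ?mul0r// => Kp; apply: nL; exact: (LP _ _ Ux (KKd _ Kp)).
have [D D0 DP] : exists2 D, 0 < D & forall x, L x -> J x <= D.
  have [M [_ MP]] := compact_bounded (compact_image (fun x Lx => Jc (LU x Lx)) cL).
  pose M' := Num.max (M + 1) 1; exists M'; first by rewrite lt_max ltr01 orbT.
  move=> x Lx; have : `|J x| <= M' by apply: MP; [rewrite lt_max ltrDl ltr01|exists x].
  by rewrite normr_id.
pose G e x y := patch (fun=> 0) U (fun x => hat (e^-1 *: (phi x - y)) * J x * f y) x.
have Gc e : 0 < e -> e <= d -> exists b, csupp b (fun z : 'rV[R]_n * 'rV[R]_n => G e z.1 z.2).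
  move=> e0 ed; pose g (z : 'rV[R]_n * 'rV[R]_n) := hat (e^-1 *: (phi z.1 - z.2)) * J z.1 * f z.2.
  have -> : (fun z : 'rV[R]_n * 'rV[R]_n => G e z.1 z.2) = patch (fun=> 0) [set z | U z.1] g.
    apply/funext => z; rewrite /G !patchE.
    by have -> // : (z \in [set z : 'rV[R]_n * 'rV[R]_n | U z.1]) = (z.1 \in U) by apply/idP/idP; rewrite !inE.
  have [|||||b _ [gb _]] := @patch_csupp R ('rV[R]_n * 'rV[R]_n)%type [set z | U z.1] (L `*` K) g; last by exists b.
  - by apply: open_comp => // z _; exact: cvg_fst.
  - move=> z /= Uz; apply: continuousM; last first.
      by apply: (@continuous_comp _ _ _ snd f); [exact: cvg_snd|exact: fc].
    apply: continuousM; last first.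
      by apply: (@continuous_comp _ _ _ fst (fun x => J x)); [exact: cvg_fst|exact: Jc].
    apply: (@continuous_comp _ _ _ (fun z : 'rV[R]_n * 'rV[R]_n => e^-1 *: (phi z.1 - z.2)) (@hat R n));
      last exact: hat_continuous.
    apply: (@continuous_comp _ _ _ (fun z : 'rV[R]_n * 'rV[R]_n => (phi z.1 - z.2)) ( *:%R e^-1));
      last exact: scaler_continuous.
    apply: (@continuousB _ 'rV[R]_n _ (phi \o fst) snd); last exact: cvg_snd.
    by apply: (@continuous_comp _ _ _ fst phi); [exact: cvg_fst|exact: phic].
  - exact: compact_setX.
  - move=> z /= Uz nLK; have [Kz|nKz] := pselect (K z.2); last by rewrite /g f0// mulr0.
    apply/eqP; rewrite !mulf_eq0; apply/orP; left; apply/orP; left; apply/negP => /negP h0.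
    have pe := hat_ball e0 h0; apply: nLK; split=> //=.
    by apply: (LP _ _ Uz _ erefl); exists z.2 => //; exact: le_trans ed.
  - by move=> z [/LU].
set Ih := I (@hat R n).
have Ih0 : 0 < Ih := integral_hat_gt0 R n.
suff : I F * Ih = I f * Ih by move/(mulIf (lt0r_neq0 Ih0)).
apply: eq_norm_le => eta eta0.
(* C and C' gather the volumes of the supports and the sup bounds in the two estimates, so that each
   contributes e^n eta / 2. *)
pose C := (2 * bF) ^+ n * (D * 2 ^+ n); pose C' := (2 * bf) ^+ n * Mf.
have C0 : 0 < C by rewrite !mulr_gt0 ?exprn_gt0 ?mulr_gt0.
have C'0 : 0 < C' by rewrite !mulr_gt0 ?exprn_gt0 ?mulr_gt0.
have w0 : 0 < eta / 2 / C by rewrite !divr_gt0.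
have w'0 : 0 < eta / 2 / C' by rewrite !divr_gt0.
have [dl dl0 dlP] := csupp_unif fb w0.
(* Compactness of K gives one e for which the local kernel estimate holds at every y in K. *)
have kerK : \forall e \near (0:R)^'+, K `<=` [set y |
    `|I (fun u => ker e y (e *: u + psi y)) - Ih| <= eta / 2 / C'].
  apply: ((compact_near_coveringP K).1 cK R (0^'+)
    (fun e y => `|I (fun u => ker e y (e *: u + psi y)) - Ih| <= eta / 2 / C')).
  by move=> y /KV Vy; exact: ker_local.
have [e [e0 [ed [edl ek]]]] := filter_ex (filterI (nbhs_right_gt 0)
  (filterI (nbhs_right_le d0) (filterI (nbhs_right_le dl0) kerK))).
have [bG Gb] := Gc e e0 ed.
have en0 : 0 < e ^+ n by rewrite exprn_gt0.
have FubG := fubini_rV Gb.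
set A := I (fun x => I (G e x)) in FubG.
have eV y : K y -> [set p | `|p - y| <= e] `<=` V.
  by move=> Ky p pe; apply: (dV y Ky); exact: le_trans ed.
have A1 : `|A - e ^+ n * (I F * Ih)| <= e ^+ n * (eta / 2).
  have Ab := csupp_integral Gb.
  have E : A - e ^+ n * (I F * Ih) = I (fun x => I (G e x) - e ^+ n * Ih * F x).
    pose b' := Num.max bG bF.
    have k1 : csupp b' (fun x => I (G e x)) by apply: csupp_le Ab; rewrite le_max lexx.
    have k2 : csupp b' (fun x => e ^+ n * Ih * F x).
      by apply: csuppZ; apply: csupp_le Fb; rewrite le_max lexx orbT.
    by rewrite (integral_rVB k1 k2) (integral_rVZ _ Fb) mulrAC mulrA.
  rewrite E.
  have GE x : I (G e x) - e ^+ n * Ih * F x = patch (fun=> 0) U (fun x => J x *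
      (I (fun y => hat (e^-1 *: (phi x - y)) * f y) - e ^+ n * (f (phi x) * Ih))) x.
    rewrite /F /G !patchE; case: ifPn => [xU|xU]; last first.
      by rewrite mulr0 subr0 -[RHS](@integral_rV0 R n); congr integral_rV; apply/funext => y; rewrite patchE (negbTE xU).
    rewrite mulrBr; congr (_ - _); last by ring.
    rewrite -(integral_rVZ _ (hat_csuppM e (phi x) fb)).
    by congr integral_rV; apply/funext => y; rewrite patchE xU mulrAC mulrC.
  have nn : 0 <= e ^+ n * (D * (2 ^+ n * (eta / 2 / C))).
    by apply/ltW/(mulr_gt0 en0)/(mulr_gt0 D0)/(mulr_gt0 _ w0); rewrite exprn_gt0.
  have dom x : `|I (G e x) - e ^+ n * Ih * F x| <= e ^+ n * (D * (2 ^+ n * (eta / 2 / C))).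
    rewrite GE patchE; case: ifPn => [|_]; last first.
      by rewrite normr0.
    rewrite inE => Ux; rewrite normrM normr_id [leRHS]mulrCA.
    have [Lx|nLx] := pselect (L x).
      rewrite ler_pM ?DP//; apply: (hat_int e0 fb) => v v1; apply: dlP.
      rewrite addrAC subrr add0r normrN normrZ gtr0_norm//.
      by apply: le_trans edl; rewrite ler_piMr// ltW.
    have nK : ~ Kd (phi x) by move=> Kp; apply: nLx; exact: (LP _ _ Ux Kp).
    rewrite f0; last by move=> /KKd.
    rewrite mul0r mulr0 subr0 (_ : (fun _ => _) = fun=> 0) ?integral_rV0.
      by rewrite normr0 mulr0 mulrCA.
    apply/funext => y; have [Ky|nKy] := pselect (K y); last by rewrite f0// mulr0.
    apply/eqP; rewrite mulf_eq0; apply/orP; left; apply/negP => /negP h0.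
    by apply: nK; exists y => //; exact: le_trans (hat_ball e0 h0) ed.
  have sup : csupp bF (fun x => I (G e x) - e ^+ n * Ih * F x).
    split=> [x|x xb].
      have [kc _] := Ab; have [Fc _] := Fb.
      apply: (@continuousB _ R^o _ (fun x => I (G e x))); first exact: kc.
      by apply: continuousM; [exact: cst_continuous|exact: Fc].
    have nLx : ~ L x by move=> /Lb /=; rewrite leNgt xb.
    rewrite GE patchE; case: ifPn => //; rewrite inE => Ux.
    have nK : ~ Kd (phi x) by move=> Kp; apply: nLx; exact: (LP _ _ Ux Kp).
    rewrite f0; last by move=> /KKd.
    rewrite mul0r mulr0 subr0 (_ : (fun _ => _) = fun=> 0) ?integral_rV0 ?mulr0//.
    apply/funext => y; have [Ky|nKy] := pselect (K y); last by rewrite f0// mulr0.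
    apply/eqP; rewrite mulf_eq0; apply/orP; left; apply/negP => /negP h0.
    by apply: nK; exists y => //; exact: le_trans (hat_ball e0 h0) ed.
  apply: le_trans (integral_rV_bound (ltW bF0) sup dom) _.
  rewrite mulrCA ler_pM2l//.
  have -> : (2 * bF) ^+ n * (D * (2 ^+ n * (eta / 2 / C))) = eta / 2 / C * C.
    by rewrite /C; ring.
  by rewrite divfK ?gt_eqF.
have A2 : `|A - e ^+ n * (I f * Ih)| <= e ^+ n * (eta / 2).
  pose kk y := I (ker e y).
  have kE y : K y -> kk y = e ^+ n * I (fun u => ker e y (e *: u + psi y)).
    move=> Ky; have [b _ kb] := ker_csupp e0 (eV y Ky).
    have := integral_rV_affine (psi y) (lt0r_neq0 e0) kb.
    by rewrite gtr0_norm.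
  have GE y : I (fun x => G e x y) = f y * kk y.
    have [Ky|nKy] := pselect (K y); last first.
      rewrite f0// mul0r -[RHS](@integral_rV0 R n); congr integral_rV; apply/funext => x.
      by rewrite /G patchE f0// mulr0 if_same.
    have [b _ kb] := ker_csupp e0 (eV y Ky).
    rewrite -(integral_rVZ _ kb); congr integral_rV; apply/funext => x.
    by rewrite /G /ker !patchE; case: ifP => _; rewrite ?mulr0// mulrC.
  have Ab := csupp_integral (F := fun y x => G e x y) (csupp_swap Gb).
  have AE : (fun y => I (fun x => G e x y)) = fun y => f y * kk y by apply/funext.
  rewrite AE in Ab FubG.
  have E : A - e ^+ n * (I f * Ih) = I (fun y => f y * kk y - e ^+ n * Ih * f y).
    pose b' := Num.max bG bf.
    have k1 : csupp b' (fun y => f y * kk y) by apply: csupp_le Ab; rewrite le_max lexx.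
    have k2 : csupp b' (fun y => e ^+ n * Ih * f y).
      by apply: csuppZ; apply: csupp_le fb; rewrite le_max lexx orbT.
    by rewrite (integral_rVB k1 k2) (integral_rVZ _ fb) mulrAC mulrA FubG.
  rewrite E.
  have sup : csupp bf (fun y => f y * kk y - e ^+ n * Ih * f y).
    split=> [y|y yb]; last by have [_ f0'] := fb; rewrite f0'// mul0r mulr0 subr0.
    have [kc _] := Ab.
    apply: (@continuousB _ R^o _ (fun y => f y * kk y)); first exact: kc.
    by apply: continuousM; [exact: cst_continuous|exact: fc].
  have dom y : `|f y * kk y - e ^+ n * Ih * f y| <= e ^+ n * (Mf * (eta / 2 / C')).
    have [Ky|nKy] := pselect (K y); last first.
      rewrite f0// mul0r mulr0 subr0 normr0 mulr_ge0 ?(ltW en0)//.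
      by rewrite mulr_ge0 ?(ltW Mf0) ?(ltW w'0).
    rewrite [_ * Ih * _]mulrC -mulrBr kE// -mulrBr normrM normrM (gtr0_norm en0) mulrCA.
    by rewrite ler_pM2l// ler_pM//; exact: ek.
  apply: le_trans (integral_rV_bound (ltW bf0) sup dom) _.
  rewrite mulrCA ler_pM2l//.
  have -> : (2 * bf) ^+ n * (Mf * (eta / 2 / C')) = eta / 2 / C' * C'.
    by rewrite /C'; ring.
  by rewrite divfK ?gt_eqF.
rewrite -(ler_pM2l en0) -[X in X * `|_|](gtr0_norm en0) -normrM mulrBr.
apply: le_trans (ler_distD A _ _) _.
have -> : e ^+ n * eta = e ^+ n * (eta / 2) + e ^+ n * (eta / 2).
  by rewrite -mulrDr -splitr.
by rewrite lerD// distrC.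
Qed.

End kernel.

(** * Smooth maps in charts *)

Lemma nbhs_forall (T : topologicalType) (x : T) (I : finType) (P : I -> T -> Prop) :
  (forall i, \forall y \near x, P i y) -> \forall y \near x, forall i, P i y.
Proof. exact: filter_forall. Qed.

Section germs.
Variable R : realType.

(** Working at a point spares the bookkeeping of domains when functions read in different charts are
    composed. One neighbourhood serves all orders, so differentiation keeps the same U. *)
Definition smooth_germ n (x : 'rV[R]_n) (f : 'rV[R]_n -> R^o) : Prop :=
  exists2 U, open U /\ U x & forall k, Ck k U f.

(** Every clause of [Ck] concerns single points, where continuity and derivatives already refer to
    full neighbourhoods, so the local domains require no gluing. *)
Lemma Ck_local n k U (f : 'rV[R]_n -> R^o) :
  (forall x, U x -> exists2 W : set 'rV[R]_n, W x & Ck k W f) -> Ck k U f.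
Proof.
elim: k f => [|k IH] f H.
  by split=> // x /H[W Wx []]; move=> /(_ x Wx).
split; first by move=> x /H[W Wx []]; move=> /(_ x Wx).
move=> v; split; first by move=> x /H[W Wx Cf]; exact: Ck_derivable Cf Wx.
by apply: IH => x /H[W Wx Cf]; exists W => //; exact: Ck_derive.
Qed.

Lemma smooth_on_germP n U (f : 'rV[R]_n -> R^o) : open U ->
  smooth_on U f <-> forall x, U x -> smooth_germ x f.
Proof.
move=> oU; rewrite smooth_onP; split=> [Cf x Ux|sf k]; first by exists U.
by apply: Ck_local => x /sf[W [oW Wx] CW]; exists W.
Qed.

Lemma smooth_on_row_germP n p U (f : 'rV[R]_n -> 'rV[R]_p) : open U ->
  smooth_on U f <-> forall x, U x -> forall j, smooth_germ x (fun y => f y 0 j).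
Proof.
move=> oU; rewrite smooth_on_rowP//; split=> [Cf x Ux j|sf k j]; first by exists U.
by apply: Ck_local => x /sf/(_ j)[W [oW Wx] CW]; exists W.
Qed.

Lemma smooth_germ_near n (x : 'rV[R]_n) f : smooth_germ x f -> \forall y \near x, smooth_germ y f.
Proof. by move=> [U [oU Ux] Cf]; near=> y; exists U => //; split=> //; near: y; exact: open_nbhs_nbhs.
Unshelve. all: by end_near. Qed.

Lemma smooth_germ_continuous n (x : 'rV[R]_n) f : smooth_germ x f -> {for x, continuous f}.
Proof. by move=> [U [oU Ux] /(_ 0%N) Cf]; exact: Ck_continuous Cf Ux. Qed.

Lemma smooth_germ_derivable n (x : 'rV[R]_n) f v : smooth_germ x f -> derivable f x v.
Proof. by move=> [U [oU Ux] /(_ 1%N) Cf]; exact: Ck_derivable Cf Ux. Qed.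

Lemma smooth_germ_derive n (x : 'rV[R]_n) f v : smooth_germ x f -> smooth_germ x ('D_v f).
Proof. by move=> [U oU Cf]; exists U => // k; exact: Ck_derive (Cf k.+1). Qed.

Lemma smooth_germ_ext n (x : 'rV[R]_n) f g : (\near x, f x = g x) -> smooth_germ x f -> smooth_germ x g.
Proof.
move=> fg [U [oU Ux] Cf]; have /nbhs_ballP[r /= r0 rP] := fg.
pose W := U `&` (ball x r)°.
have oW : open W by apply: openI => //; exact: open_interior.
have Wx : W x by split=> //; exact: nbhsx_ballx.
exists W => // k; apply: (@Ck_ext _ _ _ _ f) => //; last by apply: Ck_sub (Cf k) => y [].
by move=> y; rewrite inE => -[_ /interior_subset/rP].
Qed.

Lemma smooth_germ_cst n (x : 'rV[R]_n) (a : R) : smooth_germ x (fun=> a).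
Proof. by exists setT => [|k]; [split=> //; exact: openT|exact: Ck_cst]. Qed.

Lemma smooth_germ_coord n (x : 'rV[R]_n) j : smooth_germ x (fun y => y 0 j).
Proof. by exists setT => [|k]; [split=> //; exact: openT|exact: Ck_coord]. Qed.

Let smooth_germ2 n (x : 'rV[R]_n) f g h : smooth_germ x f -> smooth_germ x g ->
  (forall k U, open U -> Ck k U f -> Ck k U g -> Ck k U h) -> smooth_germ x h.
Proof.
move=> [U [oU Ux] Cf] [W [oW Wx] Cg] H; exists (U `&` W); first by split=> //; exact: openI.
move=> k; apply: H; first exact: openI.
- by apply: Ck_sub (Cf k) => y [].
- by apply: Ck_sub (Cg k) => y [].
Qed.

Lemma smooth_germD n (x : 'rV[R]_n) f g : smooth_germ x f -> smooth_germ x g -> smooth_germ x (fun y => f y + g y).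
Proof. by move=> sf sg; apply: (smooth_germ2 sf sg) => k U oU; exact: CkD. Qed.

Lemma smooth_germM n (x : 'rV[R]_n) f g : smooth_germ x f -> smooth_germ x g -> smooth_germ x (fun y => f y * g y : R^o).
Proof. by move=> sf sg; apply: (smooth_germ2 sf sg) => k U oU; exact: CkM. Qed.

Lemma smooth_germN n (x : 'rV[R]_n) f : smooth_germ x f -> smooth_germ x (fun y => - f y).
Proof. by move=> sf; apply: (smooth_germ2 sf sf) => k U oU Cf _; exact: CkN. Qed.

Lemma smooth_germ_sum n (x : 'rV[R]_n) (I : Type) (r : seq I) (P : pred I) (F : I -> 'rV[R]_n -> R^o) :
  (forall i, P i -> smooth_germ x (F i)) -> smooth_germ x (fun y => \sum_(i <- r | P i) F i y).
Proof.
move=> sF; elim: r => [|i r IH].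
  by under eq_fun do rewrite big_nil; exact: smooth_germ_cst.
under eq_fun do rewrite big_cons.
by case Pi: (P i) => //; apply: smooth_germD => //; exact: sF.
Qed.

Lemma smooth_germ_prod n (x : 'rV[R]_n) (I : Type) (r : seq I) (P : pred I) (F : I -> 'rV[R]_n -> R^o) :
  (forall i, P i -> smooth_germ x (F i)) -> smooth_germ x (fun y => \prod_(i <- r | P i) F i y : R^o).
Proof.
move=> sF; elim: r => [|i r IH].
  by under eq_fun do rewrite big_nil; exact: smooth_germ_cst.
under eq_fun do rewrite big_cons.
by case Pi: (P i) => //; apply: smooth_germM => //; exact: sF.
Qed.

Lemma smooth_germ_det n p (x : 'rV[R]_n) (A : 'rV[R]_n -> 'M[R]_p) :
  (forall i j, smooth_germ x (fun y => A y i j)) -> smooth_germ x (fun y => \det (A y)).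
Proof.
move=> sA; rewrite /determinant; apply: smooth_germ_sum => s _.
by apply: smooth_germM; [exact: smooth_germ_cst|apply: smooth_germ_prod].
Qed.

Lemma smooth_germV n (x : 'rV[R]_n) f : f x != 0 -> smooth_germ x f -> smooth_germ x (fun y => (f y)^-1 : R^o).
Proof.
move=> fx [U [oU Ux] Cf].
pose W := U `&` f @^-1` [set t | t != 0].
have oW : open W.
  rewrite openE => y [Uy /= fy]; apply: filterI; first exact: open_nbhs_nbhs.
  exact: (cvgr_neq0 _ (Ck_continuous (Cf 0%N) Uy) fy).
exists W => // k; apply: CkV => //; first by move=> y [].
by apply: Ck_sub (Cf k) => y [].
Qed.

Lemma smooth_germ_row_continuous n p (x : 'rV[R]_n) (g : 'rV[R]_n -> 'rV[R]_p) :
  (forall j, smooth_germ x (fun y => g y 0 j)) -> {for x, continuous g}.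
Proof. by move=> sg; apply/continuous_rowP => j; exact: smooth_germ_continuous. Qed.

Lemma smooth_germ_comp n p (x : 'rV[R]_n) (f : 'rV[R]_p -> R^o) (g : 'rV[R]_n -> 'rV[R]_p) :
  (forall j, smooth_germ x (fun y => g y 0 j)) -> smooth_germ (g x) f -> smooth_germ x (f \o g).
Proof.
move=> sg [V [oV Vgx] Cf].
have sgn : \forall y \near x, V (g y) /\ forall j, smooth_germ y (fun y => g y 0 j).
  have h1 : \forall y \near x, V (g y).
    by apply: (smooth_germ_row_continuous sg); exact: open_nbhs_nbhs.
  have h2 : \forall y \near x, forall j, smooth_germ y (fun y => g y 0 j).
    by apply: (nbhs_forall (P := fun j y => smooth_germ y (fun y => g y 0 j))) => j; exact: smooth_germ_near.
  exact: filterI h1 h2.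
pose U := [set y | V (g y) /\ forall j, smooth_germ y (fun y => g y 0 j)]°.
have oU : open U by exact: open_interior.
exists U => // k; apply: (@Ck_comp _ _ _ k U V) => //.
- move=> j; apply: Ck_local => y /interior_subset [_ /(_ j)[W [oW Wy] CW]].
  by exists W.
- by move=> y /interior_subset [].
Qed.

Lemma Jac_near n p (f g : 'rV[R]_n -> 'rV[R]_p) x :
  (\near x, f x = g x) -> Jac f x = Jac g x.
Proof.
move=> fg; apply/matrixP => i j; rewrite !mxE; apply: near_eq_derive.
by apply: filterS fg => y ->.
Qed.

Lemma smooth_germ_Jac n p (f : 'rV[R]_n -> 'rV[R]_p) x i j :
  (forall j, smooth_germ x (fun y => f y 0 j)) -> smooth_germ x (fun y => Jac f y i j).
Proof.
move=> sf; rewrite (_ : (fun y => _) = 'D_(delta_mx 0 i) (fun y => f y 0 j : R^o)).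
  exact: smooth_germ_derive.
by apply/funext => y; rewrite mxE.
Qed.

Lemma derive_Jac n p (f : 'rV[R]_n -> 'rV[R]_p) x v :
  (forall j, smooth_germ x (fun y => f y 0 j)) -> 'D_v f x = v *m Jac f x.
Proof.
move=> sf; apply/rowP => j; rewrite derive_row; last first.
  by apply/derivable_mxP => i j'; rewrite ord1; exact: smooth_germ_derivable.
have [U [oU Ux] /(_ 1%N) Cf] := sf j.
by rewrite (derive_sum_coord _ oU Cf Ux) mxE; apply: eq_bigr => i _; rewrite mxE.
Qed.

Lemma Jac_id n (x : 'rV[R]_n) : Jac id x = 1%:M.
Proof. by apply/matrixP => i j; rewrite !mxE derive_coord mxE eqxx eq_sym. Qed.

Lemma Jac_comp n p q (f : 'rV[R]_n -> 'rV[R]_p) (g : 'rV[R]_p -> 'rV[R]_q) x :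
  (forall j, smooth_germ x (fun y => f y 0 j)) -> (forall j, smooth_germ (f x) (fun y => g y 0 j)) ->
  Jac (g \o f) x = Jac f x *m Jac g (f x).
Proof.
move=> sf sg; apply/matrixP => i j; rewrite !mxE.
have df : derivable f x (delta_mx 0 i).
  by apply/derivable_mxP => i' j'; rewrite ord1; exact: smooth_germ_derivable.
have [U [oU Ux] /(_ 1%N) Cg] := sg j.
have [_ ->] := is_derive_comp_row oU Cg Ux df.
by apply: eq_bigr => l _; rewrite derive_row// !mxE.
Qed.

End germs.

Section charts.
Variable R : realType.

Lemma chart_near (T : topologicalType) n (c : chart R T n) x : chart_dom c x ->
  \forall y \near c x, chart_dom c (chart_inv c y) /\ c (chart_inv c y) = y.
Proof.
move=> cx; near=> y.
have [z cz <-] : (c @` chart_dom c) y.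
  by near: y; apply: open_nbhs_nbhs; split; [exact: chart_im_open|exists x].
by rewrite chart_mapK.
Unshelve. all: by end_near. Qed.

Lemma chart_inv_near (T : topologicalType) n (c : chart R T n) x (A : set T) :
  chart_dom c x -> nbhs x A -> \forall y \near c x, A (chart_inv c y).
Proof.
by move=> cx xA; have := chart_inv_continuous cx; apply; rewrite /= chart_mapK.
Qed.

Lemma chart_dom_nbhs (T : topologicalType) n (c : chart R T n) x :
  chart_dom c x -> nbhs x (chart_dom c).
Proof. by move=> cx; apply: open_nbhs_nbhs; split=> //; exact: chart_dom_open. Qed.

Lemma chart_image_open (T : topologicalType) n (c : chart R T n) (A : set T) :
  open A -> open (c @` (chart_dom c `&` A)).
Proof.
move=> oA; rewrite openE => _ [x [cx Ax] <-].
have nA : nbhs x A by exact: open_nbhs_nbhs.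
have h1 := chart_near cx; have h2 := chart_inv_near cx nA.
apply: filterS (filterI h1 h2) => y [[cy e] Ay].
by exists (chart_inv c y).
Qed.

End charts.

(** * Smooth functions on a manifold *)

Section smooth_at.
Variables (R : realType) (m : nat) (S : manifold R m).
Implicit Types (f g : S -> R) (x : S).

(** A single chart suffices as witness: smoothness of the transition maps transfers the property to
    any other chart of the atlas, as [smooth_atE] shows. *)
Definition smooth_at x f : Prop :=
  exists2 c : chart R S m, atlas c /\ chart_dom c x & smooth_germ (c x) (f \o chart_inv c).

Lemma transition_smooth_germ (c d : chart R S m) x : atlas c -> atlas d ->
  chart_dom c x -> chart_dom d x -> forall j, smooth_germ (c x) (fun y => d (chart_inv c y) 0 j).
Proof.
move=> ac ad cx dx; have := atlas_smooth ac ad; rewrite /smooth_in_chart.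
move/smooth_on_row_germP; apply; first by apply: chart_image_open; exact: chart_dom_open.
by exists x.
Qed.

Lemma smooth_atE (d : chart R S m) x f : atlas d -> chart_dom d x -> smooth_at x f ->
  smooth_germ (d x) (f \o chart_inv d).
Proof.
move=> ad dx [c [ac cx] sf].
apply: (@smooth_germ_ext _ _ _ ((f \o chart_inv c) \o (c \o chart_inv d))).
  apply: filterS (chart_inv_near dx (chart_dom_nbhs cx)) => y cy /=.
  by rewrite chart_mapK.
apply: smooth_germ_comp; first exact: transition_smooth_germ.
by rewrite /= chart_mapK.
Qed.

Lemma smooth_at_continuous x f : smooth_at x f -> {for x, continuous f}.
Proof.
move=> [c [ac cx] /smooth_germ_continuous sf].
apply: (@near_eq_continuous _ _ ((f \o chart_inv c) \o c)).
  by apply: filterS (chart_dom_nbhs cx) => y cy /=; rewrite chart_mapK.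
by apply: continuous_comp; [exact: chart_map_continuous|exact: sf].
Qed.

Lemma smooth_at_ext x f g : (\near x, f x = g x) -> smooth_at x f -> smooth_at x g.
Proof.
move=> fg [c [ac cx] sf]; exists c => //; apply: smooth_germ_ext sf.
exact: chart_inv_near cx fg.
Qed.

Lemma atlas_ex x : exists2 c : chart R S m, atlas c & chart_dom c x.
Proof. exact: atlas_cover. Qed.

Lemma smooth_at_cst x a : smooth_at x (fun=> a).
Proof. by have [c ac cx] := atlas_ex x; exists c => //; exact: smooth_germ_cst. Qed.

Lemma smooth_atM x f g : smooth_at x f -> smooth_at x g -> smooth_at x (fun y => f y * g y).
Proof.
have [c ac cx] := atlas_ex x => /(smooth_atE ac cx) sf /(smooth_atE ac cx) sg.
by exists c => //; exact: smooth_germM sf sg.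
Qed.

Lemma smooth_atN x f : smooth_at x f -> smooth_at x (fun y => - f y).
Proof. by have [c ac cx] := atlas_ex x => /(smooth_atE ac cx) sf; exists c => //; exact: smooth_germN sf. Qed.

Lemma smooth_atV x f : f x != 0 -> smooth_at x f -> smooth_at x (fun y => (f y)^-1).
Proof.
move=> fx; have [c ac cx] := atlas_ex x => /(smooth_atE ac cx) sf; exists c => //.
by apply: (smooth_germV _ sf) => /=; rewrite chart_mapK.
Qed.

Lemma smooth_at_sum x (I : Type) (r : seq I) (P : pred I) (F : I -> S -> R) :
  (forall i, P i -> smooth_at x (F i)) -> smooth_at x (fun y => \sum_(i <- r | P i) F i y).
Proof.
have [c ac cx] := atlas_ex x => sF; exists c => //.
by apply: smooth_germ_sum => i Pi; exact: (smooth_atE ac cx (sF i Pi)).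
Qed.

Lemma smooth_at_det x p (A : S -> 'M[R]_p) :
  (forall i j, smooth_at x (fun y => A y i j)) -> smooth_at x (fun y => \det (A y)).
Proof.
have [c ac cx] := atlas_ex x => sA; exists c => //.
by apply: (smooth_germ_det (A := A \o chart_inv c)) => i j; exact: (smooth_atE ac cx (sA i j)).
Qed.

Lemma smooth_at_norm x f : f x != 0 -> smooth_at x f -> smooth_at x (fun y => `|f y|).
Proof.
move=> fx sf; have fc := smooth_at_continuous sf.
have [f0|f0] := ltP 0 (f x).
  apply: (smooth_at_ext _ sf); have : \forall y \near x, 0 < f y by exact: (cvgr_gt (f x) fc _ f0).
  by apply: filterS => y /gtr0_norm.
have {}f0 : f x < 0 by rewrite lt_neqAle fx.
apply: (smooth_at_ext _ (smooth_atN sf)); have : \forall y \near x, f y < 0 by exact: (cvgr_lt (f x) fc _ f0).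
by apply: filterS => y /ltr0_norm.
Qed.

Lemma smooth_in_chartP (c : chart R S m) (A : set S) (f : S -> R^o) :
  atlas c -> open A ->
  smooth_in_chart c A f <-> forall x, chart_dom c x -> A x -> smooth_at x f.
Proof.
move=> ac oA; rewrite /smooth_in_chart (smooth_on_germP _ (chart_image_open (c := c) oA)); split.
  by move=> H x cx Ax; exists c => //; apply: H; exists x.
by move=> H _ [x [cx Ax] <-]; exact: smooth_atE (H x cx Ax).
Qed.

Lemma smooth_in_chart_rowP p (c : chart R S m) (A : set S) (f : S -> 'rV[R]_p) :
  atlas c -> open A ->
  smooth_in_chart c A f <->
  forall x, chart_dom c x -> A x -> forall j, smooth_at x (fun y => f y 0 j).
Proof.
move=> ac oA; rewrite /smooth_in_chart (smooth_on_row_germP _ (chart_image_open (c := c) oA)); split.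
  by move=> H x cx Ax j; exists c => //; apply: H; exists x.
by move=> H _ [x [cx Ax] <-] j; exact: (smooth_atE ac cx (H x cx Ax j)).
Qed.

End smooth_at.

(** * Smooth maps and their Jacobians in charts *)

Section maps.
Variable R : realType.

Lemma smooth_mapP m n (S : manifold R m) (M : manifold R n) (f : S -> M) :
  smooth_map f <-> continuous f /\
  forall x (d : chart R M n), atlas d -> chart_dom d (f x) ->
    forall j, smooth_at x (fun y => d (f y) 0 j).
Proof.
have od (fc : continuous f) (d : chart R M n) : open (f @^-1` chart_dom d).
  by apply: open_comp => //; exact: chart_dom_open.
split=> -[fc H]; split=> //.
- move=> x d ad dfx; have [c ac cx] := atlas_ex x.
  have /(smooth_in_chart_rowP _ ac (od fc d)) h := H c d ac ad.
  by move=> j; exact: (h x cx dfx j).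
- move=> c d ac ad; apply/(smooth_in_chart_rowP _ ac (od fc d)) => x cx dfx j.
  exact: H.
Qed.

Lemma smooth_map_continuous m n (S : manifold R m) (M : manifold R n) (f : S -> M) :
  smooth_map f -> continuous f.
Proof. by case. Qed.

Lemma smooth_at_map m n (S : manifold R m) (M : manifold R n) (f : S -> M) x (d : chart R M n) j :
  smooth_map f -> atlas d -> chart_dom d (f x) -> smooth_at x (fun y => d (f y) 0 j).
Proof. by move=> /smooth_mapP[_ sf] ad dfx; exact: sf. Qed.

Lemma local_smooth_germ m n (S : manifold R m) (M : manifold R n) (f : S -> M)
    (c : chart R S m) (d : chart R M n) x : smooth_map f -> atlas c -> atlas d ->
  chart_dom c x -> chart_dom d (f x) ->
  forall j, smooth_germ (c x) (fun y => (d \o f \o chart_inv c) y 0 j).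
Proof. by move=> sf ac ad cx dfx j; have := smooth_atE ac cx (smooth_at_map j sf ad dfx). Qed.

Lemma smooth_at_comp m n (S : manifold R m) (M : manifold R n) (f : S -> M) (g : M -> R) x :
  smooth_map f -> smooth_at (f x) g -> smooth_at x (g \o f).
Proof.
move=> sf [d [ad dfx] sg]; have [c ac cx] := atlas_ex x; exists c => //.
apply: (@smooth_germ_ext _ _ _ ((g \o chart_inv d) \o (d \o f \o chart_inv c))).
  have : nbhs x (f @^-1` chart_dom d).
    by apply: (smooth_map_continuous sf); exact: chart_dom_nbhs.
  by move=> /(chart_inv_near cx); apply: filterS => y dy /=; rewrite chart_mapK.
by apply: smooth_germ_comp; [exact: local_smooth_germ|rewrite /= (chart_mapK cx)].
Qed.

Lemma smooth_map_comp m n p (S : manifold R m) (M : manifold R n) (N : manifold R p)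
    (f : S -> M) (g : M -> N) : smooth_map f -> smooth_map g -> smooth_map (g \o f).
Proof.
move=> sf sg; apply/smooth_mapP; split.
  by move=> x; apply: continuous_comp; exact: smooth_map_continuous.
move=> x d ad dx j; apply: (@smooth_at_comp _ _ _ _ f (fun y => d (g y) 0 j)) => //.
exact: smooth_at_map.
Qed.

Lemma smooth_map_id m (S : manifold R m) : smooth_map (@id S).
Proof.
apply/smooth_mapP; split=> [x|x d ad dx j]; first exact: cvg_id.
by have [c ac cx] := atlas_ex x; exists c => //; exact: transition_smooth_germ.
Qed.

Definition chart_Jac m n (S : manifold R m) (M : manifold R n)
    (c : chart R S m) (d : chart R M n) (f : S -> M) (x : S) : 'M[R]_(m, n) :=
  Jac (d \o f \o chart_inv c) (c x).

Lemma chart_Jac_comp m n p (S : manifold R m) (M : manifold R n) (N : manifold R p)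
    (f : S -> M) (g : M -> N) (c : chart R S m) (d : chart R M n) (e : chart R N p) x :
  smooth_map f -> smooth_map g -> atlas c -> atlas d -> atlas e ->
  chart_dom c x -> chart_dom d (f x) -> chart_dom e (g (f x)) ->
  chart_Jac c e (g \o f) x = chart_Jac c d f x *m chart_Jac d e g (f x).
Proof.
move=> sf sg ac ad ae cx dfx egx.
have -> : chart_Jac c e (g \o f) x =
    Jac ((e \o g \o chart_inv d) \o (d \o f \o chart_inv c)) (c x).
  apply: Jac_near; have : nbhs x (f @^-1` chart_dom d).
    by apply: (smooth_map_continuous sf); exact: chart_dom_nbhs.
  by move=> /(chart_inv_near cx); apply: filterS => y dy /=; rewrite chart_mapK.
have E : (d \o f \o chart_inv c) (c x) = d (f x) by rewrite /= chart_mapK.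
rewrite Jac_comp ?E//; first exact: local_smooth_germ.
exact: local_smooth_germ.
Qed.

Lemma chart_Jac_id m (S : manifold R m) (c : chart R S m) x : chart_dom c x ->
  chart_Jac c c id x = 1%:M.
Proof.
move=> cx; rewrite -(Jac_id (c x)); apply: Jac_near.
by apply: filterS (chart_near cx) => y [].
Qed.

Lemma smooth_at_chart_Jac m n (S : manifold R m) (M : manifold R n) (f : S -> M)
    (c : chart R S m) (d : chart R M n) x i j : smooth_map f -> atlas c -> atlas d ->
  chart_dom c x -> chart_dom d (f x) -> smooth_at x (fun y => chart_Jac c d f y i j).
Proof.
move=> sf ac ad cx dfx; exists c => //.
apply: (@smooth_germ_ext _ _ _ (fun y => Jac (d \o f \o chart_inv c) y i j)).
  by apply: filterS (chart_near cx) => y [_ cy]; rewrite /chart_Jac /= cy.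
apply: smooth_germ_Jac; exact: local_smooth_germ.
Qed.

Lemma chart_at_atlas m (S : manifold R m) (x : S) : atlas (chart_at x).
Proof. by rewrite /chart_at; case: (cid2 _). Qed.

Lemma chart_at_dom m (S : manifold R m) (x : S) : chart_dom (chart_at x) x.
Proof. by rewrite /chart_at; case: (cid2 _). Qed.

Lemma tangent_mapE m n (S : manifold R m) (M : manifold R n) (f : S -> M) x
    (v : tangent x) : smooth_map f ->
  tangent_map f v = (v : 'rV[R]_m) *m chart_Jac (chart_at x) (chart_at (f x)) f x.
Proof.
move=> sf; rewrite /tangent_map derive_Jac// => j.
exact: (local_smooth_germ sf (chart_at_atlas _) (chart_at_atlas _) (chart_at_dom _) (chart_at_dom _)).
Qed.

Lemma coord_vectorE m (S : manifold R m) (c : chart R S m) x i : atlas c ->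
  chart_dom c x -> coord_vector c x i = row i (chart_Jac c (chart_at x) id x) :> 'rV[R]_m.
Proof.
move=> ac cx; rewrite /coord_vector derive_Jac ?rowE// => j.
exact: (local_smooth_germ (@smooth_map_id _ S) ac (chart_at_atlas _) cx (chart_at_dom x)).
Qed.

Lemma tangent_coordE m (S : manifold R m) (c : chart R S m) x (v : tangent x) :
  atlas c -> chart_dom c x ->
  tangent_coord c v = (v : 'rV[R]_m) *m chart_Jac (chart_at x) c id x.
Proof.
move=> ac cx; rewrite /tangent_coord derive_Jac// => j.
exact: (local_smooth_germ (@smooth_map_id _ S) (chart_at_atlas _) ac (chart_at_dom x) cx).
Qed.

Lemma chart_Jac_idK m (S : manifold R m) (c d : chart R S m) x : atlas c -> atlas d ->
  chart_dom c x -> chart_dom d x -> chart_Jac c d id x *m chart_Jac d c id x = 1%:M.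
Proof.
move=> ac ad cx dx; rewrite -(chart_Jac_comp (f := @id S) (g := @id S))//; last 2 first.
- exact: smooth_map_id.
- exact: smooth_map_id.
exact: chart_Jac_id.
Qed.

Lemma pairing_coord m (S : manifold R m) (c : chart R S m) x (p : cotangent x)
    (v : tangent x) : atlas c -> chart_dom c x ->
  pairing p v = \sum_i tangent_coord c v 0 i * cotangent_coord c p 0 i.
Proof.
move=> ac cx; rewrite tangent_coordE// /pairing.
set A := chart_Jac (chart_at x) c id x; set B := chart_Jac c (chart_at x) id x.
have AB : A *m B = 1%:M by apply: chart_Jac_idK => //; [exact: chart_at_atlas|exact: chart_at_dom].
rewrite -[in LHS](mulmx1 (v : 'rV[R]_m)) -AB mulmxA -mulmxA mxE.
apply: eq_bigr => i _; congr (_ * _).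
rewrite !mxE /pairing coord_vectorE// -/B.
by rewrite !mxE; apply: eq_bigr => j _; rewrite [row i B 0 j]mxE.
Qed.

End maps.

(** * Densities *)

Section alternating.
Variables (R : realType) (m : nat).
Local Notation frame := ('I_m -> 'rV[R]_m).

(** The same term as [v_] in [is_volume_form], so that the multilinearity of [mu] applies
    directly. *)
Definition upd (v : frame) (i : 'I_m) (x : 'rV[R]_m) : frame :=
  fun j => if j == i then x else v j.

Lemma upd_id v i : upd v i (v i) = v.
Proof. by apply/funext => j; rewrite /upd; case: eqP => // ->. Qed.

Lemma updC v i j x y : i != j -> upd (upd v i x) j y = upd (upd v j y) i x.
Proof.
move=> ij; apply/funext => k; rewrite /upd.
by case: (eqVneq k j) => // ->; rewrite eq_sym (negbTE ij).
Qed.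

Section zero.
Variable D : frame -> R.
Hypothesis D_linear : forall v i a u w,
  D (upd v i (a *: u + w)) = a * D (upd v i u) + D (upd v i w).
Hypothesis D_alt : forall v i j, i != j -> v i = v j -> D v = 0.
Hypothesis D_basis : D (fun i => delta_mx 0 i) = 0.

Let D0 v i : D (upd v i 0) = 0.
Proof.
have := D_linear v i (-1) 0 0; rewrite scaler0 addr0.
by rewrite mulN1r addNr.
Qed.

Let D_expand v i (x : 'rV[R]_m) :
  D (upd v i x) = \sum_j x 0 j * D (upd v i (delta_mx 0 j)).
Proof.
rewrite [in LHS](row_sum_delta x); elim: (index_enum _) => [|j r IH].
  by rewrite !big_nil D0.
by rewrite !big_cons D_linear IH.
Qed.

Let D_swap v i j : i != j -> D (v \o tperm i j) = - D v.
Proof.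
move=> ij; pose B x y := D (upd (upd v i x) j y).
have Bxx x : B x x = 0.
  by apply: (@D_alt _ i j) => //; rewrite /upd !eqxx (negbTE ij).
have Br x y z : B x (y + z) = B x y + B x z.
  by rewrite /B -[y]scale1r D_linear mul1r scale1r.
have Bl x y z : B (x + y) z = B x z + B y z.
  by rewrite /B !(@updC v i j)// -[x]scale1r D_linear mul1r scale1r.
have := Bxx (v i + v j); rewrite Bl !Br !Bxx add0r addr0 => /eqP.
rewrite addr_eq0 => /eqP e.
have -> : D (v \o tperm i j) = B (v j) (v i).
  congr D; apply/funext => k; rewrite /upd /=.
  by case: tpermP => [->|->|/eqP/negbTE-> /eqP/negbTE->]//; rewrite eqxx ?(negbTE ij).
have -> : D v = B (v i) (v j) by rewrite /B upd_id upd_id.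
by rewrite e opprK.
Qed.

(** The number k bounds the positions that may hold arbitrary vectors; expanding the last of them in
    the standard basis lowers k. Once every entry is a basis vector, either two coincide or the
    frame is a permutation of the basis, a product of transpositions. *)
Lemma alternating_eq0 v : D v = 0.
Proof.
have key k : forall v, (forall i : 'I_m, (k <= i)%N -> exists j, v i = delta_mx 0 j) -> D v = 0.
  elim: k => [|k IH] {}v vP.
    have [g gP] := choice (fun i => vP i (leq0n i)).
    have [/injectiveP ginj|/injectivePn[i [j ij gij]]] := boolP (injectiveb g); last first.
      by apply: (D_alt ij); rewrite !gP gij.
    have -> : v = (fun i => delta_mx 0 i) \o perm ginj.
      by apply/funext => i; rewrite gP /= permE.
    have [ts -> tsP] := prod_tpermP (perm ginj).
    elim: ts tsP => [_|t ts IH /= /andP[t12 /IH{}IH]].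
      by rewrite big_nil -[RHS]D_basis; congr D; apply/funext => i; rewrite /= perm1.
    rewrite big_cons -[RHS]oppr0 -IH -(D_swap _ t12); congr D.
    by apply/funext => i; rewrite /= permM.
  have [km|mk] := ltnP k m; last first.
    by apply: IH => i ki; have := leq_trans mk ki; rewrite leqNgt ltn_ord.
  rewrite -(upd_id v (Ordinal km)) D_expand big1// => j _.
  rewrite IH ?mulr0// => i ki; rewrite /upd; case: eqVneq => [_|ik]; first by exists j.
  by apply: vP; rewrite ltn_neqAle ki andbT eq_sym.
by apply: (key m) => i; rewrite leqNgt ltn_ord.
Qed.

End zero.

(** The difference of the two sides is multilinear and alternating, and vanishes on the standard
    basis. *)
Lemma alternating_det (mu : frame -> R) :
  (forall v i a u w, mu (upd v i (a *: u + w)) = a * mu (upd v i u) + mu (upd v i w)) ->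
  (forall v i j, i != j -> v i = v j -> mu v = 0) ->
  forall v, mu v = \det (\matrix_(i, j) v i 0 j) * mu (fun i => delta_mx 0 i).
Proof.
move=> mu_lin mu_alt v; apply/eqP; rewrite -subr_eq0; apply/eqP.
pose mat (v : frame) : 'M[R]_m := \matrix_(i, j) v i 0 j.
pose D v := mu v - \det (mat v) * mu (fun i => delta_mx 0 i).
apply: (@alternating_eq0 D) => {v} [v i a u w|v i j ij vij|]; rewrite /D.
- have rowE x : row i (mat (upd v i x)) = x.
    by apply/rowP => j; rewrite !mxE /upd eqxx.
  have row'E x y : row' i (mat (upd v i x)) = row' i (mat (upd v i y)).
    by apply/matrixP => k j; rewrite !mxE /upd eq_sym (negbTE (neq_lift _ _)).
  rewrite mu_lin (@determinant_multilinear _ _ _ (mat (upd v i u)) (mat (upd v i w)) i a 1) ?rowE ?scale1r//.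
  by ring.
- rewrite (mu_alt _ _ _ ij vij) (determinant_alternate ij) ?mul0r ?subrr// => k.
  by rewrite !mxE vij.
- have -> : mat (fun i => delta_mx 0 i) = 1%:M.
    by apply/matrixP => i j; rewrite !mxE eqxx eq_sym.
  by rewrite det1 mul1r subrr.
Qed.

End alternating.

Section volume.
Variables (R : realType) (m : nat) (S : manifold R m) (mu : volume_form S).

Lemma volume_det (s : S) (v : 'I_m -> 'rV[R]_m) :
  mu s v = \det (\matrix_(i, j) v i 0 j) * mu s (fun i => delta_mx 0 i : 'rV[R]_m).
Proof.
have [lin alt _ _] := volume_formP mu.
by apply: alternating_det => [w i a x y|]; [exact: lin|exact: alt].
Qed.

Lemma volume_mulmx (s : S) (A B : 'M[R]_m) :
  mu s (fun i => row i (A *m B) : 'rV[R]_m) = \det A * mu s (fun i => row i B : 'rV[R]_m).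
Proof.
rewrite volume_det [in RHS]volume_det mulrA -det_mulmx; congr (\det _ * _).
apply/matrixP => i j; rewrite !mxE; apply: eq_bigr => k _; by rewrite !mxE.
Qed.

Definition volume_coord (c : chart R S m) (s : S) : R := mu s (coord_vector c s).

Lemma coord_frameE (c : chart R S m) s : atlas c -> chart_dom c s ->
  coord_vector c s = (fun i => row i (chart_Jac c (chart_at s) id s)) :> ('I_m -> 'rV[R]_m).
Proof. by move=> ac cs; apply/funext => i; rewrite coord_vectorE. Qed.

Lemma volume_coord_neq0 (c : chart R S m) s : atlas c -> chart_dom c s ->
  volume_coord c s != 0.
Proof.
move=> ac cs; have [_ _ /(_ s)[v v0] _] := volume_formP mu.
rewrite /volume_coord coord_frameE// -[chart_Jac _ _ _ _]mulmx1 volume_mulmx mulf_neq0//.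
  have := chart_Jac_idK ac (chart_at_atlas s) cs (chart_at_dom s).
  by move=> /mulmx1_unit[]; rewrite unitmxE unitfE.
apply: contra_neq v0 => e0; rewrite volume_det.
have -> : (fun i => delta_mx 0 i : 'rV[R]_m) = (fun i => row i 1%:M).
  by apply/funext => i; rewrite row1.
by rewrite e0 mulr0.
Qed.

Lemma smooth_at_volume_coord (c : chart R S m) s : atlas c -> chart_dom c s ->
  smooth_at s (volume_coord c).
Proof.
move=> ac cs; have [_ _ _ /(_ c ac)] := volume_formP mu.
by move=> /(smooth_in_chartP _ ac openT) /(_ s cs); exact.
Qed.

Lemma volume_pullback (psi : S -> S) (c d : chart R S m) s : smooth_map psi ->
  atlas c -> atlas d -> chart_dom c s -> chart_dom d (psi s) ->
  mu (psi s) (fun i => tangent_map psi (coord_vector c s i)) =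
  \det (chart_Jac c d psi s) * volume_coord d (psi s).
Proof.
move=> sp ac ad cs dps; rewrite /volume_coord (coord_frameE ad dps) -volume_mulmx.
congr (mu _ _); apply/funext => i; rewrite tangent_mapE// coord_vectorE//.
rewrite -row_mul -(chart_Jac_comp (f := @id S) (g := psi) (@smooth_map_id _ _ S) sp ac
  (chart_at_atlas s) (chart_at_atlas (psi s)) cs (chart_at_dom s) (chart_at_dom (psi s))).
congr row; rewrite -(chart_Jac_comp (f := psi) (g := @id S) sp (@smooth_map_id _ _ S) ac ad
  (chart_at_atlas (psi s)) cs dps (chart_at_dom (psi s))).
by [].
Qed.

Lemma chart_Jac_diffeo_det (psi psi' : S -> S) (c d : chart R S m) s :
  smooth_map psi -> smooth_map psi' -> cancel psi psi' ->
  atlas c -> atlas d -> chart_dom c s -> chart_dom d (psi s) ->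
  \det (chart_Jac c d psi s) != 0.
Proof.
move=> sp sp' K ac ad cs dps.
have e : chart_Jac c d psi s *m chart_Jac d c psi' (psi s) = 1%:M.
  rewrite -(chart_Jac_comp (f := psi) (g := psi'))// ?K//.
  have -> : psi' \o psi = id by apply/funext => x; rewrite /= K.
  exact: chart_Jac_id.
by have [] := mulmx1_unit e; rewrite unitmxE unitfE.
Qed.

(* psi^* |mu| = density_factor psi . |mu| *)
Definition density_factor (psi : S -> S) (s : S) : R :=
  `|mu (psi s) (fun i => tangent_map psi (coord_vector (chart_at s) s i))| /
  `|volume_coord (chart_at s) s|.

(** The definition goes through [chart_at s], which depends on s in no controlled way. Fixed charts
    c and d are what shows that the factor varies smoothly. *)
Lemma density_factorE (psi : S -> S) (c d : chart R S m) s : smooth_map psi ->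
  atlas c -> atlas d -> chart_dom c s -> chart_dom d (psi s) ->
  density_factor psi s =
  `|\det (chart_Jac c d psi s)| * `|volume_coord d (psi s)| / `|volume_coord c s|.
Proof.
move=> sp ac ad cs dps; set c' := chart_at s.
have ac' : atlas c' := chart_at_atlas s; have c's : chart_dom c' s := chart_at_dom s.
rewrite /density_factor (volume_pullback sp ac' ad c's dps) normrM.
have := volume_pullback (@smooth_map_id _ _ S) ac ac' cs c's.
have -> : (fun i => tangent_map id (coord_vector c s i)) = coord_vector c s.
  apply/funext => i; rewrite tangent_mapE; last exact: smooth_map_id.
  by rewrite chart_Jac_id ?mulmx1//; exact: chart_at_dom.
rewrite -/(volume_coord c s) => ->.
have -> : chart_Jac c d psi s = chart_Jac c c' id s *m chart_Jac c' d psi s.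
  by rewrite -(chart_Jac_comp (f := @id S) (g := psi))//; exact: smooth_map_id.
have u1 : \det (chart_Jac c c' id s) != 0.
  by have /mulmx1_unit[] := chart_Jac_idK ac ac' cs c's; rewrite unitmxE unitfE.
have u2 := volume_coord_neq0 ac' c's.
rewrite det_mulmx !normrM; field.
by rewrite !normr_eq0 u1 u2.
Qed.

Lemma density_pullbackE (psi : S -> S) s (v : 'I_m -> tangent s) : smooth_map psi ->
  density_pullback psi (density_of mu) v = density_factor psi s * density_of mu v.
Proof.
move=> sp; rewrite /density_pullback /density_of.
set c := chart_at s; set d := chart_at (psi s).
have ac : atlas c := chart_at_atlas s; have cs : chart_dom c s := chart_at_dom s.
have ad : atlas d := chart_at_atlas (psi s); have dps : chart_dom d (psi s) := chart_at_dom (psi s).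
pose A : 'M[R]_m := \matrix_(i, j) (v i : 'rV[R]_m) 0 j.
have vA : v = (fun i => row i (A *m 1%:M)) :> ('I_m -> 'rV[R]_m).
  by apply/funext => i; apply/rowP => j; rewrite mulmx1 !mxE.
have -> : mu s v = \det A * volume_coord c s.
  rewrite /volume_coord coord_frameE// chart_Jac_id// -volume_mulmx.
  by congr (mu s _); rewrite vA.
have -> : mu (psi s) (fun i => tangent_map psi (v i)) =
    \det A * (\det (chart_Jac c d psi s) * volume_coord d (psi s)).
  rewrite -(@volume_pullback psi c d)//.
  have -> : (fun i => tangent_map psi (coord_vector c s i)) =
     (fun i => row i (chart_Jac c d psi s)) :> ('I_m -> 'rV[R]_m).
    apply/funext => i; rewrite tangent_mapE// coord_vectorE// chart_Jac_id//.
    by rewrite row1 -rowE.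
  rewrite -volume_mulmx; congr (mu (psi s) _); apply/funext => i.
  rewrite tangent_mapE// row_mul; congr (_ *m _).
  by apply/rowP => j; rewrite !mxE.
rewrite (density_factorE sp ac ad cs dps) !normrM; field.
by rewrite normr_eq0 volume_coord_neq0.
Qed.

Lemma smooth_at_density_factor (psi psi' : S -> S) s : smooth_map psi -> smooth_map psi' ->
  cancel psi psi' -> smooth_at s (density_factor psi).
Proof.
move=> sp sp' K; set c := chart_at s; set d := chart_at (psi s).
have ac : atlas c := chart_at_atlas s; have cs : chart_dom c s := chart_at_dom s.
have ad : atlas d := chart_at_atlas (psi s); have dps : chart_dom d (psi s) := chart_at_dom (psi s).
apply: (@smooth_at_ext _ _ _ _ (fun t => `|\det (chart_Jac c d psi t)| * `|volume_coord d (psi t)| * (`|volume_coord c t|)^-1)).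
  have h : nbhs s (psi @^-1` chart_dom d).
    by apply: (smooth_map_continuous sp); exact: chart_dom_nbhs.
  by apply: filterS (filterI (chart_dom_nbhs cs) h) => t [ct dt]; rewrite (@density_factorE _ c d).
apply: smooth_atM; first apply: smooth_atM.
- apply: smooth_at_norm; first exact: chart_Jac_diffeo_det K _ _ _ _.
  by apply: smooth_at_det => i j; exact: smooth_at_chart_Jac.
- apply: (@smooth_at_comp _ _ _ _ _ psi (fun t => `|volume_coord d t|)) => //.
  by apply: smooth_at_norm; [exact: volume_coord_neq0|exact: smooth_at_volume_coord].
- apply: smooth_atV; first by rewrite normr_eq0 volume_coord_neq0.
  by apply: smooth_at_norm; [exact: volume_coord_neq0|exact: smooth_at_volume_coord].
Qed.

Lemma density_factor_neq0 (psi psi' : S -> S) s : smooth_map psi -> smooth_map psi' ->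
  cancel psi psi' -> density_factor psi s != 0.
Proof.
move=> sp sp' K; rewrite (@density_factorE psi (chart_at s) (chart_at (psi s)))//;
  try exact: chart_at_atlas; try exact: chart_at_dom.
rewrite !mulf_neq0 ?invr_eq0 ?normr_eq0//.
- by apply: chart_Jac_diffeo_det K _ _ _ _ => //; try exact: chart_at_atlas; exact: chart_at_dom.
- by apply: volume_coord_neq0; [exact: chart_at_atlas|exact: chart_at_dom].
- by apply: volume_coord_neq0; [exact: chart_at_atlas|exact: chart_at_dom].
Qed.

End volume.

(** * Integration of densities and its invariance *)

Section local_integral.
Variables (R : realType) (m : nat) (S : manifold R m).
Local Notation I := (@integral_rV R _).

(** The radius is hidden here, since the functions summed over the indices of a partition of unity
    have unrelated supports. *)
Definition compactly_supported n (f : 'rV[R]_n -> R) := exists b, csupp b f.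

Lemma integral_rV_sum_cs n (J : Type) (r : seq J) (F : J -> 'rV[R]_n -> R) :
  (forall i, compactly_supported (F i)) ->
  I (fun x => \sum_(i <- r) F i x) = \sum_(i <- r) I (F i).
Proof.
move=> Fc; suff [] : compactly_supported (fun x => \sum_(i <- r) F i x) /\
  I (fun x => \sum_(i <- r) F i x) = \sum_(i <- r) I (F i) by [].
elim: r => [|i r [[b bP] E]].
  under eq_fun do rewrite big_nil; rewrite big_nil integral_rV0.
  by split=> //; exists 0; exact: csupp0.
have [a aP] := Fc i; pose c := Num.max a b.
have cP : csupp c (F i) by apply: csupp_le aP; rewrite le_max lexx.
have cP' : csupp c (fun x => \sum_(i <- r) F i x).
  by apply: csupp_le bP; rewrite le_max lexx orbT.
under eq_fun do rewrite big_cons.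
by rewrite big_cons -E (integral_rVD cP cP'); split=> //; exists c; exact: csuppD.
Qed.

Definition chart_patch (c : chart R S m) (H : S -> R) : 'rV[R]_m -> R :=
  patch (fun=> 0) (chart_im c) (H \o chart_inv c).

Section patch.
Variables (c : chart R S m) (H : S -> R) (A : set S).
Hypothesis Hc : forall s, chart_dom c s -> {for s, continuous H}.
Hypothesis cA : compact A.
Hypothesis Ac : A `<=` chart_dom c.
Hypothesis H0 : forall s, chart_dom c s -> ~ A s -> H s = 0.

Let Hinvc y : chart_im c y -> {for y, continuous (H \o chart_inv c)}.
Proof.
move=> [s cs <-]; apply: continuous_comp; first exact: chart_inv_continuous.
by rewrite /= chart_mapK//; exact: Hc.
Qed.

Lemma chart_image_compact : compact (c @` A).
Proof. by apply: compact_image => // s /Ac; exact: chart_map_continuous. Qed.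

Lemma chart_image_sub : c @` A `<=` chart_im c.
Proof. by move=> _ [s As <-]; exists s => //; exact: Ac. Qed.

Let Hinv0 y : chart_im c y -> ~ (c @` A) y -> (H \o chart_inv c) y = 0.
Proof.
by move=> [s cs <-] nA; rewrite /= chart_mapK// H0//; apply: contra_not nA => As; exists s.
Qed.

Lemma chart_patch_continuous : continuous (chart_patch c H).
Proof.
apply: (@patch_continuous R 'rV[R]_m (chart_im c) (c @` A)).
- exact: (@norm_hausdorff R 'rV[R]_m).
- exact: chart_im_open.
- exact: Hinvc.
- exact: chart_image_compact.
- exact: Hinv0.
- exact: chart_image_sub.
Qed.

Lemma chart_patch_cs : compactly_supported (chart_patch c H).
Proof.
have [b _ [bP _]] := patch_csupp (@chart_im_open _ _ _ c) Hinvc chart_image_compact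
  Hinv0 chart_image_sub.
by exists b.
Qed.

Lemma chart_patch0 y : ~ (c @` A) y -> chart_patch c H y = 0.
Proof.
move=> nA; rewrite /chart_patch patchE; case: ifPn => //.
by rewrite inE => cy; exact: Hinv0.
Qed.

End patch.

Lemma chart_patchE c (H : S -> R) s : chart_dom c s -> chart_patch c H (c s) = H s.
Proof.
by move=> cs; rewrite /chart_patch patchE mem_set/= ?chart_mapK//; exists s.
Qed.

Lemma chart_patch_out c (H : S -> R) y : ~ chart_im c y -> chart_patch c H y = 0.
Proof. by move=> ny; rewrite /chart_patch patchE; case: ifPn => //; rewrite inE. Qed.

Variable mu : volume_form S.

(** By [density_factorE] the factor and the volume coefficient in c combine to |det| times the
    coefficient in d at psi s, which is the integrand produced by the change of variables for psi
    read in the charts. *)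
Lemma chart_integral_pullback (psi psi' : S -> S) (c d : chart R S m) (h : S -> R) (A : set S) :
  smooth_map psi -> smooth_map psi' -> cancel psi psi' -> cancel psi' psi ->
  atlas c -> atlas d -> continuous h -> compact A -> A `<=` chart_dom d ->
  (forall t, ~ A t -> h t = 0) -> (forall s, A (psi s) -> chart_dom c s) ->
  I (chart_patch c (fun s => h (psi s) * (density_factor mu psi s * `|volume_coord mu c s|))) =
  I (chart_patch d (fun t => h t * `|volume_coord mu d t|)).
Proof.
move=> sp sp' K K' ac ad hc cA Ad h0 Ac.
pose H t := h t * `|volume_coord mu d t|.
have Hc t : chart_dom d t -> {for t, continuous H}.
  move=> dt; apply: continuousM; first exact: hc.
  by apply: smooth_at_continuous; apply: smooth_at_norm; [exact: volume_coord_neq0|exact: smooth_at_volume_coord].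
have H0 t : chart_dom d t -> ~ A t -> H t = 0 by move=> _ nA; rewrite /H h0 ?mul0r.
pose U := c @` (chart_dom c `&` psi @^-1` chart_dom d).
pose V := d @` (chart_dom d `&` psi' @^-1` chart_dom c).
pose phi := d \o psi \o chart_inv c.
pose phi' := c \o psi' \o chart_inv d.
have pc := smooth_map_continuous sp; have pc' := smooth_map_continuous sp'.
have oU : open U.
  by apply: chart_image_open; apply: open_comp => //; exact: chart_dom_open.
have oV : open V.
  by apply: chart_image_open; apply: open_comp => //; exact: chart_dom_open.
have cs s : chart_dom c s -> chart_inv c (c s) = s by exact: chart_mapK.
have ds s : chart_dom d s -> chart_inv d (d s) = s by exact: chart_mapK.
have E := @integral_rV_change R m U V phi phi' oU oV _ _ _ _ _ _
  (chart_patch d H) (d @` A) (chart_patch_continuous Hc cA Ad H0) (chart_image_compact cA Ad) _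
  (chart_patch0 H0).
rewrite -E.
- congr integral_rV; apply/funext => y.
  have [[s [cs' dps] <-]|nU] := pselect (U y).
    rewrite chart_patchE// patchE mem_set; last by exists s.
    rewrite /phi /= cs// chart_patchE// /H (@density_factorE _ _ _ _ psi c d)//.
    by rewrite -/phi -/(chart_Jac c d psi s) divfK ?normr_eq0 ?volume_coord_neq0//; ring.
  (* A point of the chart c outside U is sent outside the chart d, hence off A, where h vanishes. *)
  rewrite [RHS]patchE; case: ifPn => [|_]; first by rewrite inE.
  have [[s cs' ey]|ny] := pselect (chart_im c y); last by rewrite chart_patch_out.
  subst y; rewrite chart_patchE// h0 ?mul0r// => Aps.
  by apply: nU; exists s => //; split=> //; exact: Ad.
- move=> _ [s [cs' dps] <-]; exists (psi' s); last by rewrite /phi' /= ds.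
  by split=> //=; rewrite K'.
- by move=> _ [s [cs' dps] <-]; rewrite /phi /phi' /= cs// ds// K.
- by move=> _ [s [ds' cps] <-]; rewrite /phi /phi' /= ds// cs// K'.
- move=> j; have /smooth_on_row_germP : smooth_on U phi.
    apply/smooth_on_row_germP => // _ [s [cs' dps] <-] j'; exact: (local_smooth_germ sp ac ad cs' dps).
  move=> /(_ oU) sU.
  by apply: Ck_local => y /sU /(_ j) [W [oW Wy] CW]; exists W.
- move=> _ [s [ds' cps] <-]; apply: smooth_germ_row_continuous => j.
  exact: (local_smooth_germ sp' ad ac ds' cps).
- move=> _ [s [cs' dps] <-]; rewrite -/(chart_Jac c d psi s).
  exact: chart_Jac_diffeo_det K _ _ _ _.
- move=> _ [t At <-]; exists t => //; split; first exact: Ad.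
  by rewrite /= -[t]K' in At *; rewrite K; exact: Ac.
Qed.

Lemma pou_integralE (p : partition_of_unity S) (rho : density S) :
  pou_integral p rho = \sum_i I (chart_patch (pou_chart (p := p) i)
    (fun s => pou_fun i s * rho s (coord_vector (pou_chart i) s))).
Proof. by []. Qed.

Lemma pou_fun_smooth_at (p : partition_of_unity S) i s : smooth_at s (pou_fun (p := p) i).
Proof.
have [c ac cs] := atlas_ex s.
by have /(smooth_in_chartP _ ac openT) /(_ s cs) := pou_smooth i ac; exact.
Qed.

(** The products [h i j] of a function of p, moved by psi', with a function of q are supported in
    one chart on either side. Summing over j recovers the left side, summing over i the right side.
    The case psi = id compares two partitions of unity. *)
Lemma pou_integral_pullback (psi psi' : S -> S) (p q : partition_of_unity S) (g : S -> R) :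
  compact [set: S] ->
  smooth_map psi -> smooth_map psi' -> cancel psi psi' -> cancel psi' psi -> continuous g ->
  pou_integral p (density_pullback psi (fun s v => g s * density_of mu v)) =
  pou_integral q (fun s v => g s * density_of mu v).
Proof.
move=> cS sp sp' K K' gc.
have pc := smooth_map_continuous sp; have pc' := smooth_map_continuous sp'.
rewrite !pou_integralE.
pose h i j t := pou_fun (p := p) i (psi' t) * pou_fun (p := q) j t * g t.
pose A i j := closure [set s | pou_fun (p := q) j s != 0] `&`
  psi' @^-1` (closure [set s | pou_fun (p := p) i s != 0]).
have pic i : continuous (pou_fun (p := p) i) by move=> s; exact/smooth_at_continuous/pou_fun_smooth_at.
have qjc j : continuous (pou_fun (p := q) j) by move=> s; exact/smooth_at_continuous/pou_fun_smooth_at.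
have hc i j : continuous (h i j).
  move=> t; apply: (@continuousM _ _ (fun t => pou_fun (p := p) i (psi' t) * pou_fun (p := q) j t)); last exact: gc.
  apply: (@continuousM _ _ (pou_fun (p := p) i \o psi')); last exact: qjc.
  by apply: continuous_comp; [exact: pc'|exact: pic].
have cA i j : compact (A i j).
  apply: (subclosed_compact _ cS) => //; apply: closedI; first exact: closed_closure.
  by apply: closed_comp => [t _|]; [exact: pc'|exact: closed_closure].
have Ad i j : A i j `<=` chart_dom (pou_chart (p := q) j) by move=> t [/pou_support].
have h0 i j t : ~ A i j t -> h i j t = 0.
  move=> nA; apply/eqP; rewrite /h mulf_eq0 mulf_eq0; apply/orP; left.
  apply/negP => /negP; rewrite negb_or => /andP[p0 q0]; apply: nA.
  by split; apply: subset_closure.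
have Ac i j s : A i j (psi s) -> chart_dom (pou_chart (p := p) i) s.
  by move=> [_]; rewrite /= K => /pou_support.
have volc (c : chart R S m) s : atlas c -> chart_dom c s ->
    {for s, continuous (fun s => `|volume_coord mu c s|)}.
  move=> ac cs; apply: smooth_at_continuous.
  by apply: smooth_at_norm; [exact: volume_coord_neq0|exact: smooth_at_volume_coord].
transitivity (\sum_i \sum_j I (chart_patch (pou_chart (p := p) i)
    (fun s => h i j (psi s) * (density_factor mu psi s * `|volume_coord mu (pou_chart (p := p) i) s|)))).
  apply: eq_bigr => i _; set c := pou_chart i; have ac : atlas c := pou_atlas i.
  rewrite -integral_rV_sum_cs; last first.
    move=> j; apply: (@chart_patch_cs _ _ (psi @^-1` A i j)).
    - move=> s cs; apply: continuousM.
        by apply: continuous_comp; [exact: pc|exact: hc].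
      by apply: continuousM; [exact/smooth_at_continuous/(smooth_at_density_factor _ _ sp sp' K)|exact: volc].
    - apply: (subclosed_compact _ cS) => //.
      apply: closed_comp => [t _|]; first exact: pc.
      apply: compact_closed; [exact: manifold_hausdorff|exact: cA].
    - by move=> s /Ac.
    - by move=> s cs nA; rewrite h0 ?mul0r.
  congr integral_rV; apply/funext => y.
  have [[s cs <-]|ny] := pselect (chart_im c y); last first.
    by rewrite chart_patch_out// big1// => j _; rewrite chart_patch_out.
  rewrite chart_patchE//; under eq_bigr do rewrite chart_patchE//.
  rewrite -mulr_suml /h -mulr_suml -mulr_sumr pou_sum mulr1 K.
  rewrite /density_pullback -mulrA; congr (_ * (_ * _)).
  exact: (density_pullbackE mu (coord_vector c s) sp).
rewrite exchange_big/=; apply: eq_bigr => j _; set d := pou_chart j.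
have ad : atlas d := pou_atlas j.
transitivity (\sum_i I (chart_patch d (fun t => h i j t * `|volume_coord mu d t|))).
  apply: eq_bigr => i _.
  exact: (@chart_integral_pullback psi psi' _ _ _ (A i j) sp sp' K K' (pou_atlas i) ad
    (hc i j) (cA i j) (Ad i j) (h0 i j) (Ac i j)).
rewrite -integral_rV_sum_cs; last first.
  move=> i; apply: (@chart_patch_cs _ _ (A i j)) => //.
  - by move=> s cs; apply: continuousM; [exact: hc|exact: volc].
  - by move=> s cs nA; rewrite h0 ?mul0r.
congr integral_rV; apply/funext => y.
have [[s cs <-]|ny] := pselect (chart_im d y); last first.
  by rewrite chart_patch_out// big1// => i _; rewrite chart_patch_out.
rewrite chart_patchE//; under eq_bigr do rewrite chart_patchE//.
rewrite -mulr_suml /h -mulr_suml -mulr_suml pou_sum mul1r.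
by rewrite mulrA.
Qed.

Lemma density_integralE (p : partition_of_unity S) (g : S -> R) :
  compact [set: S] -> continuous g ->
  density_integral (fun s v => g s * density_of mu v) =
  pou_integral p (fun s v => g s * density_of mu v).
Proof.
move=> cS gc; rewrite /density_integral; set X := [set _ | _].
have /getPex [q ->] : exists J, X J by exists (pou_integral p (fun s v => g s * density_of mu v)), p.
have sid := @smooth_map_id _ _ S.
(* Pulling back along the identity reduces both sums to the same one, over p. *)
rewrite -(@pou_integral_pullback id id p p g cS sid sid (fun=> erefl) (fun=> erefl) gc).
by rewrite -(@pou_integral_pullback id id p q g cS sid sid (fun=> erefl) (fun=> erefl) gc).
Qed.

Lemma density_integral_pullback (p : partition_of_unity S) (psi psi' : S -> S) (g : S -> R) :
  compact [set: S] ->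
  smooth_map psi -> smooth_map psi' -> cancel psi psi' -> cancel psi' psi -> continuous g ->
  density_integral (density_pullback psi (fun s v => g s * density_of mu v)) =
  density_integral (fun s v => g s * density_of mu v).
Proof.
move=> cS sp sp' K K' gc; rewrite (density_integralE p)//.
rewrite /density_integral; set X := [set _ | _].
have /getPex [q ->] : exists J, X J by eexists; exists p.
exact: pou_integral_pullback K K' _.
Qed.

End local_integral.

(** * Bump functions and partitions of unity *)

Section flat.
Variable R : realType.
Implicit Types (p : {poly R}) (t h x : R).

(* The derivatives of exp(-1/t) (t > 0), extended by 0, are of the form
   p(1/t) exp(-1/t) with p a polynomial. *)
Definition flat p t : R := if 0 < t then p.[t^-1] * expR (- t^-1) else 0.

(** Take the k-th power of x / k <= exp(x / k). What matters is that the bound is independent of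
    x. *)
Lemma expRN_pow k x : 0 < x -> x ^+ k * expR (- x) <= k%:R ^+ k.
Proof.
move=> x0; have [->|k0] := posnP k.
  by rewrite !expr0 mul1r -expR0 ler_expR oppr_le0 ltW.
have kr : 0 < k%:R :> R by rewrite ltr0n.
have h : x / k%:R <= expR (x / k%:R).
  by apply: le_trans (expR_ge1Dx _); rewrite lerDr.
have : (x / k%:R) ^+ k <= expR x.
  have -> : expR x = expR (x / k%:R) ^+ k.
    by rewrite -expRM_natl mulrC divfK// gt_eqF.
  by rewrite lerXn2r// nnegrE ?divr_ge0 ?expR_ge0// ltW.
rewrite expr_div_n ler_pdivrMr ?exprn_gt0// expRN => H.
by rewrite ler_pdivrMr ?expR_gt0// mulrC.
Qed.

(** The exponential absorbs one more power of 1/h than each monomial of p contains, which leaves the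
    factor h. *)
Lemma flat_bound p : exists2 C, 0 <= C & forall h, 0 < h -> `|flat p h| <= C * h.
Proof.
exists (\sum_(i < size p) `|p`_i| * i.+1%:R ^+ i.+1).
  by apply: sumr_ge0 => i _; rewrite mulr_ge0// exprn_ge0.
move=> h h0; rewrite /flat h0 horner_coef mulr_suml.
apply: le_trans (ler_norm_sum _ _ _) _; rewrite mulr_suml; apply: ler_sum => i _.
rewrite !normrM -!mulrA ler_wpM2l// normrX (ger0_norm (expR_ge0 _)) gtr0_norm ?invr_gt0//.
rewrite -ler_pdivrMr// mulrAC -exprSr.
by apply: expRN_pow; rewrite invr_gt0.
Qed.

(** With x = 1/t one has d/dt = - x^2 d/dx, and this sends p(x) exp(-x) to x^2 (p - p')(x)
    exp(-x). *)
Lemma flat_pos_derive p t : 0 < t ->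
  is_derive t 1 (flat p : R -> R^o) (flat ('X ^+ 2 * (p - p^`())) t).
Proof.
move=> t0; pose g (s : R) : R^o := p.[s^-1] * expR (- s^-1).
have tn0 : t != 0 by rewrite gt_eqF.
apply: (@near_eq_is_derive _ _ _ g).
  near=> s; rewrite /flat /g ifT//; near: s; exact: lt_nbhsr.
have dV : is_derive t 1 (fun s : R => s^-1 : R^o) (- t ^- 2).
  have := @is_deriveV R id t 1 1 tn0 (is_derive_id _ _).
  by rewrite /GRing.scale/= mulr1.
have dp : is_derive t^-1 1 (horner p : R -> R^o) (p^`()).[t^-1].
  split; first exact: derivable_horner.
  by rewrite -derive1E -derivE.
have d1 := @is_derive1_comp R (horner p) (fun s => s^-1) t _ _ dp dV.
have dN : is_derive t 1 (fun s : R => - s^-1 : R^o) (t ^- 2).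
  by have := is_deriveN dV; rewrite opprK.
have d2 := @is_derive1_comp R expR (fun s => - s^-1) t _ _ (is_derive_expR _) dN.
apply: is_derive_eq (is_deriveM d1 d2) _.
rewrite /flat t0 !hornerE /GRing.scale/= exprVn; ring.
Unshelve. all: by end_near. Qed.

Lemma flat_derive p t :
  is_derive t 1 (flat p : R -> R^o) (flat ('X ^+ 2 * (p - p^`())) t).
Proof.
have [t0|t0] := ltP 0 t; first exact: flat_pos_derive.
have -> : flat ('X ^+ 2 * (p - p^`())) t = 0 by rewrite /flat ltNge t0.
have f0 s : s <= 0 -> flat p s = 0 by move=> s0; rewrite /flat ltNge s0.
have [t1|t1] := ltP t 0.
  apply: (@near_eq_is_derive _ _ _ (cst 0 : R -> R^o)) => /=.
  near=> s; rewrite f0//; apply: ltW; near: s; exact: lt_nbhsl.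
have -> : t = 0 by apply/le_anti; rewrite t0.
suff cL : (fun h => h^-1 *: ((flat p \o shift 0) (h *: 1) - flat p 0 : R^o)) @ (0:R)^' --> (0 : R^o).
  by split; [apply/cvg_ex; exists 0|exact: cvg_lim cL].
(* For h > 0 the difference quotient of [flat p] at 0 is [flat ('X * p) h], so the linear bound for
   this polynomial makes it tend to 0. *)
have [C C0 CP] := flat_bound ('X * p).
apply/cvgrPdist_le => /= e e0.
have d0 : 0 < e / (C + 1) by rewrite divr_gt0// ltr_wpDl.
near=> h; rewrite sub0r normrN (f0 0)// subr0 addr0.
have hd : `|h| < e / (C + 1) by near: h; exact: dnbhs0_lt.
rewrite /GRing.scale/= mulr1.
have [h0|h0] := ltP 0 h; last by rewrite f0// mulr0 normr0 ltW.
have -> : h^-1 * flat p h = flat ('X * p) h by rewrite /flat h0 hornerM hornerX mulrA.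
apply: le_trans (CP _ h0) _.
rewrite gtr0_norm// ltr_pdivlMr ?ltr_wpDl// in hd.
by apply: ltW; apply: le_lt_trans hd; rewrite mulrC ler_wpM2l ?(ltW h0)// lerDl.
Unshelve. all: by end_near. Qed.

Lemma flat_ge0 t : 0 <= flat 1 t.
Proof. by rewrite /flat; case: ifP => // _; rewrite hornerE mul1r expR_ge0. Qed.

Lemma flat_gt0 t : 0 < t -> 0 < flat 1 t.
Proof. by move=> t0; rewrite /flat t0 hornerE mul1r expR_gt0. Qed.

Lemma flat_neq0 t : flat 1 t != 0 -> 0 < t.
Proof. by rewrite /flat; case: ifP => // _; rewrite eqxx. Qed.

(** The variable is wrapped in a row of length 1 because the composition lemmas speak of maps
    between row spaces. *)
Lemma Ck_flat p k : Ck k setT (fun x : 'rV[R]_1 => flat p (x 0 0) : R^o).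
Proof.
have dE q (x v : 'rV[R]_1) : is_derive x v (fun x : 'rV[R]_1 => flat q (x 0 0) : R^o)
    (v 0 0 * flat ('X ^+ 2 * (q - q^`())) (x 0 0)).
  have [d1 d2] := flat_derive q (x 0 0).
  have df : differentiable (flat q : R -> R^o) (x 0 0) by exact/derivable1_diffP.
  have E : (fun h : R => h^-1 *: (((fun x : 'rV[R]_1 => flat q (x 0 0) : R^o) \o shift x) (h *: v)
      - flat q (x 0 0))) =
      fun h => h^-1 *: (((flat q : R -> R^o) \o shift (x 0 0)) (h *: (v 0 0 : R^o)) - flat q (x 0 0)).
    by apply/funext => h; rewrite /= !mxE.
  split; first by rewrite /derivable E; exact: diff_derivable.
  rewrite /derive E -[LHS]/('D_(v 0 0 : R^o) (flat q : R -> R^o) (x 0 0)).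
  rewrite deriveE// -[in LHS](mulr1 (v 0 0)) linearZ /= -deriveE// d2.
  by [].
have fc q (x : 'rV[R]_1) : {for x, continuous (fun x : 'rV[R]_1 => flat q (x 0 0) : R^o)}.
  apply: (@continuous_comp _ _ _ (fun x : 'rV[R]_1 => x 0 0) (flat q)).
    exact: coord_continuous.
  apply: differentiable_continuous; apply/derivable1_diffP.
  by have [] := flat_derive q (x 0 0).
elim: k p => [|k IH] p; (split=> [x _|]) => //.
move=> v; split=> [x _|]; first by have [] := dE p x v.
rewrite (_ : 'D_v _ = fun x : 'rV[R]_1 => v 0 0 * flat ('X ^+ 2 * (p - p^`())) (x 0 0) : R^o).
  by apply: CkM; [exact: openT|exact: Ck_cst|exact: IH].
by apply/funext => x; have [_] := dE p x v.
Qed.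

End flat.

Section bump.
Variable R : realType.

(** A sum of squares is used because the norm of the row space is a maximum of absolute values,
    hence not smooth. *)
Definition rV_bump n (y0 : 'rV[R]_n) (r : R) (y : 'rV[R]_n) : R :=
  flat 1 (r ^+ 2 - \sum_j (y 0 j - y0 0 j) ^+ 2).

Lemma smooth_germ_rV_bump n (y0 : 'rV[R]_n) r y : smooth_germ y (rV_bump y0 r).
Proof.
pose g (y : 'rV[R]_n) : 'rV[R]_1 := const_mx (r ^+ 2 - \sum_j (y 0 j - y0 0 j) ^+ 2).
rewrite (_ : rV_bump y0 r = (fun x : 'rV[R]_1 => flat 1 (x 0 0) : R^o) \o g); last first.
  by apply/funext => z; rewrite /= mxE.
apply: smooth_germ_comp; last by exists setT => [|k]; [split=> //; exact: openT|exact: Ck_flat].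
move=> i0; rewrite (_ : (fun z => _) = fun z : 'rV[R]_n => r ^+ 2 + - \sum_j (z 0 j - y0 0 j) * (z 0 j - y0 0 j) : R^o).
  apply: smooth_germD; first exact: smooth_germ_cst.
  apply: smooth_germN; apply: smooth_germ_sum => i _; apply: smooth_germM; apply: smooth_germD; try exact: smooth_germ_coord; exact: smooth_germ_cst.
by apply/funext => z; rewrite mxE.
Qed.

Lemma rV_bump_ge0 n (y0 : 'rV[R]_n) r y : 0 <= rV_bump y0 r y.
Proof. exact: flat_ge0. Qed.

Lemma rV_bump_gt0 n (y0 : 'rV[R]_n) r : 0 < r -> 0 < rV_bump y0 r y0.
Proof.
move=> r0; apply: flat_gt0; rewrite big1 ?subr0 ?exprn_gt0// => j _.
by rewrite subrr expr0n.
Qed.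

Lemma rV_bump_support n (y0 : 'rV[R]_n) r y : 0 < r -> rV_bump y0 r y != 0 -> `|y - y0| <= r.
Proof.
move=> r0 /flat_neq0; rewrite subr_gt0 => h; apply: row_norm_le; first exact: ltW.
move=> j; rewrite !mxE -(@ler_sqr _ `|_|) ?nnegrE ?(ltW r0)// real_normK ?num_real//.
apply: le_trans (ltW h); rewrite (bigD1 j)//= lerDl.
by apply: sumr_ge0 => i _; exact: sqr_ge0.
Qed.

(** A bump read in a chart, supported in a closed ball. The image L of this ball is compact, hence
    closed by the Hausdorff property, so the extension by 0 is smooth across the border of the
    chart. *)
Lemma manifold_bump m (S : manifold R m) (x0 : S) (W : set S) : nbhs x0 W ->
  exists chi : S -> R, [/\ forall x, smooth_at x chi, forall x, 0 <= chi x, 0 < chi x0 &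
    closure [set x | chi x != 0] `<=` W].
Proof.
move=> xW; have [c ac cx0] := atlas_ex x0.
have /nbhs_ballP[r /= r0 rP] : \forall y \near c x0, W (chart_inv c y) /\
    chart_dom c (chart_inv c y) /\ c (chart_inv c y) = y.
  exact: filterI (chart_inv_near cx0 xW) (chart_near cx0).
pose y0 := c x0; pose B := [set y : 'rV[R]_m | `|y - y0| <= r / 2].
have BP y : B y -> [/\ W (chart_inv c y), chart_dom c (chart_inv c y) & c (chart_inv c y) = y].
  move=> yB; have [|? [? ?]//] := rP y; rewrite -ball_normE/= distrC.
  by apply: le_lt_trans yB _; lra.
pose L := chart_inv c @` B.
have cL : compact L.
  apply: compact_image; last exact: closed_ball_compact.
  by move=> y /BP[_ dy ey]; rewrite -ey; exact: chart_inv_continuous.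
have Lclosed : closed L by apply: compact_closed => //; exact: manifold_hausdorff.
pose chi := patch (fun=> 0) (chart_dom c) (rV_bump y0 (r / 2) \o c).
have r20 : 0 < r / 2 by rewrite divr_gt0.
have chiL x : chi x != 0 -> L x.
  rewrite /chi patchE; case: ifPn; rewrite ?eqxx// inE => cx /(rV_bump_support r20) yB.
  by exists (c x) => //; exact: chart_mapK.
exists chi; split.
- move=> x; have [cx|ncx] := pselect (chart_dom c x).
    exists c => //; apply: (@smooth_germ_ext _ _ _ (rV_bump y0 (r / 2))); last exact: smooth_germ_rV_bump.
    by apply: filterS (chart_near cx) => y [cy ey]; rewrite /= /chi patchE mem_set//= ey.
  apply: (@smooth_at_ext _ _ _ _ (fun=> 0)); last exact: smooth_at_cst.
  have nL : ~ L x by move=> [y /BP[_ dy _] e]; apply: ncx; rewrite -e.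
  have : nbhs x (~` L) by apply: open_nbhs_nbhs; split=> //; exact: closed_openC.
  apply: filterS => y nLy; apply/esym/eqP; apply: contra_notT nLy; exact: chiL.
- move=> x; rewrite /chi patchE; case: ifPn => // _; exact: rV_bump_ge0.
- by rewrite /chi patchE mem_set//; exact: rV_bump_gt0.
- move=> x; rewrite closureE => /(_ L); case=> [|y /BP[Wy _ _] <-//].
  by split=> //; exact: chiL.
Qed.

Lemma partition_of_unity_ex m (S : manifold R m) : compact [set: S] ->
  inhabited (partition_of_unity S).
Proof.
move=> cS.
have bumpP (x : S) : exists chi : S -> R, [/\ forall y, smooth_at y chi, forall y, 0 <= chi y, 0 < chi x &
    closure [set y | chi y != 0] `<=` chart_dom (chart_at x)].
  by apply: manifold_bump; apply: chart_dom_nbhs; exact: chart_at_dom.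
have [chi chiP] := choice bumpP.
have chic x : continuous (chi x) by move=> y; apply: smooth_at_continuous; have [] := chiP x.
have [s sP] : exists s : seq S, forall y, exists2 x, x \in s & 0 < chi x y.
  (* The sequences containing a given finite one form the base of a filter; compactness along it
     turns the cover by the sets where some chi is positive into a finite one. *)
  pose F : set_system (seq S) := filter_from setT (fun s0 : seq S => [set s : seq S | {subset s0 <= s}]).
  have FF : Filter F.
    apply: filter_from_filter; first by exists [::].
    move=> s1 s2 _ _; exists (s1 ++ s2) => // s sub; split=> x xs; apply: sub.
      by rewrite mem_cat xs.
    by rewrite mem_cat xs orbT.
  have [x _|s _ sP] := (compact_near_coveringP _).1 cS (seq S) F
      (fun (s : seq S) (y : S) => exists2 x, x \in s & 0 < chi x y).
    exists ([set y | 0 < chi x y], [set s : seq S | x \in s]).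
      split=> /=; last by exists [:: x] => // s; apply; rewrite mem_head.
      by apply: (cvgr_gt (chi x x) (chic x x)); have [] := chiP x.
    by move=> [y s] /= [xy xs]; exists x.
  by exists s => y; apply: (sP s).
pose X (i : 'I_(size s)) := tnth (in_tuple s) i.
pose T y := \sum_i chi (X i) y.
have T0 y : 0 < T y.
  have [x /(nthP x)[i is_ <-] xy] := sP y.
  rewrite /T (bigD1 (Ordinal is_))//= /X (tnth_nth x)/= ltr_pwDl//.
  by apply: sumr_ge0 => j _; have [] := chiP (X j).
have fT y : smooth_at y T by apply: smooth_at_sum => i _; have [] := chiP (X i).
pose f i y := chi (X i) y * (T y)^-1.
have fs i y : smooth_at y (f i).
  apply: smooth_atM; first by have [] := chiP (X i).
  by apply: smooth_atV => //; rewrite gt_eqF.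
constructor; apply: (@PartitionOfUnity R m S (size s) (fun i => chart_at (X i)) f).
- by move=> i; exact: chart_at_atlas.
- by move=> i c ac; apply/(smooth_in_chartP _ ac openT) => y _ _.
- move=> i y; rewrite mulr_ge0 ?invr_ge0 ?(ltW (T0 y))//.
  by have [] := chiP (X i).
- move=> i; have [_ _ _] := chiP (X i); apply: subset_trans.
  by apply: closureS => y; apply: contra_neq; rewrite /f => ->; rewrite mul0r.
- by move=> y; rewrite /f -mulr_suml -/(T y) mulfV ?gt_eqF.
Qed.

End bump.

(** * Lifting smooth maps through embeddings *)

Section lift.
Variable R : realType.

Lemma Ck_invmx n k (W : set 'rV[R]_n) p (A : 'rV[R]_n -> 'M[R]_p) i j : open W ->
  (forall z, W z -> A z \in unitmx) -> (forall i j, Ck k W (fun z => A z i j)) ->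
  Ck k W (fun z => invmx (A z) i j).
Proof.
move=> oW uA CA; apply: (@Ck_ext _ _ _ _ (fun z => (\det (A z))^-1 * \adj (A z) i j)) => //.
  by move=> z; rewrite inE => /uA uz; rewrite /invmx uz [RHS]mxE.
apply: CkM => //; first by apply: CkV => // [z /uA|]; [rewrite unitmxE unitfE|exact: Ck_det].
rewrite (_ : (fun z => _) = fun z => cofactor (A z) j i : R^o); last by apply/funext => z; rewrite mxE.
apply: CkM => //; first exact: Ck_cst.
apply: Ck_det => // k' l; rewrite (_ : (fun z => _) = fun z => A z (lift j k') (lift i l)); last first.
  by apply/funext => z; rewrite !mxE.
exact: CA.
Qed.

Lemma Jac_mulmxr n p (B : 'M[R]_(n, p)) x : Jac (fun z : 'rV[R]_n => z *m B) x = B.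
Proof.
have dB : differentiable (mulmxr B : 'rV[R]_n -> 'rV[R]_p) x.
  by apply: linear_differentiable; exact: mulmxr_continuous.
have dd i : derivable (fun z : 'rV[R]_n => z *m B) x (delta_mx 0 i) by exact: diff_derivable.
apply/matrixP => i j; rewrite mxE -(derive_row (f := fun z : 'rV[R]_n => z *m B))//.
rewrite -[fun z => _]/(mulmxr B : 'rV[R]_n -> 'rV[R]_p) deriveE// diff_lin; last exact: mulmxr_continuous.
by rewrite /mulmxr/= -rowE mxE.
Qed.

Section derive_lift.
Variables (n p : nat) (f : 'rV[R]_n -> 'rV[R]_p) (A : 'rV[R]_p -> 'rV[R]_p).
Variables (G : 'rV[R]_n -> 'rV[R]_p) (W : set 'rV[R]_p) (x : 'rV[R]_n).
Hypothesis oW : open W.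
Hypothesis CA : forall j, Ck 1 W (fun z => A z 0 j).
Hypothesis Wfx : W (f x).
Hypothesis uA : Jac A (f x) \in unitmx.
Hypothesis fc : {for x, continuous f}.
Hypothesis AG : \near x, A (f x) = G x.

(** Strict differentiability of A at f x compares the increment of G = A o f with that of f times
    J0. Inverting J0 first bounds the increment of f by a multiple of that of G, and then identifies
    the limit of its quotient. *)
Lemma is_derive_lift v : derivable G x v ->
  is_derive x v f ('D_v G x *m invmx (Jac A (f x))).
Proof.
move=> dG; set g := 'D_v G x; set J0 := Jac A (f x).
have [C C0 CP] := mulmx_bound (invmx J0).
have C1 (y : 'rV[R]_p) : `|y| <= C * `|y *m J0| by have := CP (y *m J0); rewrite mulmxK.
pose De h := f (h *: v + x) - f x; pose ga h := G (h *: v + x) - G x.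
have gag : h^-1 *: ga h @[h --> 0^'] --> g by exact: dG.
suff cL : (fun h => h^-1 *: ((f \o shift x) (h *: v) - f x)) @ 0^' --> g *m invmx J0.
  by split; [apply/cvg_ex; exists (g *m invmx J0)|exact: cvg_lim cL].
have line : h *: v + x @[h --> (0:R)^'] --> x.
  rewrite -[X in _ --> X]add0r -[X in _ --> X + _](scale0r v).
  apply: cvgD; last exact: cvg_cst.
  by apply: cvgZr_tmp; apply: cvg_within_filter; exact: cvg_id.
apply/cvgrPdist_le => /= e e0.
pose eta := Num.min 1 (e / 2 / C).
have eta0 : 0 < eta by rewrite lt_min ltr01 !divr_gt0.
(* The first entry of e1 lets the error be absorbed when [De h] is bounded by [ga h]; the second
   makes the remaining error at most e / 2 once that bound is inserted. *)
pose e1 := Num.min (2 * C)^-1 (e / 2 / (C * (2 * C * (`|g| + 1)))).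
have g1 : 0 < `|g| + 1 by rewrite ltr_wpDl.
have d1 : 0 < C * (2 * C * (`|g| + 1)) by rewrite !mulr_gt0.
have e10 : 0 < e1 by rewrite lt_min invr_gt0 mulr_gt0//= !divr_gt0.
have [r r0 [rW rP]] := strict_Jac oW CA Wfx e10.
have n1 : \forall h \near (0:R)^', ball (f x) r (f (h *: v + x)).
  have nb : nbhs x (f @^-1` ball (f x) r) by apply: fc; exact: nbhsx_ballx.
  by have := line _ nb.
have n2 : \forall h \near (0:R)^', A (f (h *: v + x)) = G (h *: v + x).
  exact: (line _ AG).
have n3 : \forall h \near (0:R)^', `|g - h^-1 *: ga h| <= eta.
  by move/cvgrPdist_le : gag; exact.
have n4 : \forall h \near (0:R)^', h != 0 by exact: nbhs_dnbhs_neq.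
near=> h.
have hn0 : h != 0 by near: h.
have h0 : 0 < `|h| by rewrite normr_gt0.
have Agx : A (f x) = G x := nbhs_singleton AG.
have := rP _ _ (_ : ball (f x) r (f (h *: v + x))) (ballxx _ r0).
rewrite (near n2 h)// Agx -/(ga h) -/(De h) => /(_ (near n1 h _)) st.
have {}st : `|ga h - De h *m J0| <= e1 * `|De h| by exact: st.
have gh : `|g - h^-1 *: ga h| <= eta by near: h.
have Dega : `|De h| <= 2 * C * `|ga h|.
  have k1 : C * `|De h *m J0| <= C * (e1 * `|De h| + `|ga h|).
    rewrite ler_pM2l//; have := ler_normB (ga h) (ga h - De h *m J0).
    by rewrite subKr => /le_trans; apply; rewrite addrC lerD2r.
  have k2 : C * e1 * `|De h| <= `|De h| / 2.
    rewrite mulrC ler_wpM2l//; apply: le_trans (_ : C * (2 * C)^-1 <= _).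
      by rewrite ler_pM2l// ge_min lexx.
    by rewrite invfM mulrCA mulfV ?gt_eqF// mulr1.
  have := le_trans (C1 _) k1; rewrite mulrDr mulrA; move: k2.
  set a := C * e1 * _; set b := `|De h|; set c := C * `|ga h|.
  by rewrite -mulrA -/c; lra.
have ghb : `|ga h| <= `|h| * (`|g| + 1).
  rewrite -ler_pdivrMl// -normfV -normrZ.
  have eta1 : eta <= 1 by rewrite ge_min lexx.
  have := ler_normB g (g - h^-1 *: ga h); rewrite subKr => /le_trans; apply.
  by rewrite lerD2l (le_trans gh).
have -> : g *m invmx J0 - h^-1 *: De h = (g - (h^-1 *: De h) *m J0) *m invmx J0.
  by rewrite mulmxBl mulmxK.
apply: le_trans (CP _) _.
have -> : g - (h^-1 *: De h) *m J0 = (g - h^-1 *: ga h) + h^-1 *: (ga h - De h *m J0).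
  by rewrite (scalerBr h^-1 (ga h)) addrA subrK -scalemxAl.
apply: le_trans (ler_wpM2l (ltW C0) (ler_normD _ _)) _.
rewrite mulrDr (splitr e) lerD//.
  rewrite -ler_pdivlMl// (le_trans gh)// mulrC ge_min lexx orbT//.
rewrite normrZ normfV mulrCA ler_pdivrMl//.
apply: le_trans (ler_wpM2l (ltW C0) (le_trans st (ler_wpM2l (ltW e10) (le_trans Dega
  (ler_wpM2l _ ghb))))) _; first by rewrite mulr_ge0// ltW.
have -> : C * (e1 * (2 * C * (`|h| * (`|g| + 1)))) = `|h| * (e1 * (C * (2 * C * (`|g| + 1)))) by ring.
by rewrite ler_pM2l// -ler_pdivlMr// ge_min lexx orbT.
Unshelve. all: by end_near. Qed.

End derive_lift.

(** The derivative of f is expressed by that of G and by f itself, through the inverse Jacobian of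
    A. If f is of class C^k, so is its derivative, and the induction starts from the continuity of
    f. *)
Lemma smooth_germ_lift n p (f : 'rV[R]_n -> 'rV[R]_p) (A : 'rV[R]_p -> 'rV[R]_p)
    (G : 'rV[R]_n -> 'rV[R]_p) x :
  (forall j, smooth_germ (f x) (fun z => A z 0 j)) -> Jac A (f x) \in unitmx ->
  (\forall y \near x, {for y, continuous f}) ->
  (\near x, A (f x) = G x) -> (forall j, smooth_germ x (fun y => G y 0 j)) ->
  forall j, smooth_germ x (fun y => f y 0 j).
Proof.
move=> sA uA fc AG sG.
have nA : \forall z \near f x, (forall j, smooth_germ z (fun z => A z 0 j)) /\ Jac A z \in unitmx.
  have h1 : \forall z \near f x, forall j, smooth_germ z (fun z => A z 0 j).
    by apply: (nbhs_forall (P := fun j z => smooth_germ z (fun z => A z 0 j))) => j; exact: smooth_germ_near.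
  have dc : {for f x, continuous (fun z => \det (Jac A z))}.
    by apply: smooth_germ_continuous; apply: smooth_germ_det => i j; exact: smooth_germ_Jac.
  have h2 : \forall z \near f x, \det (Jac A z) != 0.
    by apply: (cvgr_neq0 _ dc); move: uA; rewrite unitmxE unitfE.
  by apply: filterS (filterI h1 h2) => z [? ?]; rewrite unitmxE unitfE.
pose W := [set z | (forall j, smooth_germ z (fun z => A z 0 j)) /\ Jac A z \in unitmx]°.
have oW : open W by exact: open_interior.
have CA k j : Ck k W (fun z => A z 0 j).
  by apply: Ck_local => z /interior_subset [/(_ j)[V [oV Vz] CV] _]; exists V.
have WA z : W z -> Jac A z \in unitmx by move=> /interior_subset [].
have nU : \forall y \near x, [/\ {for y, continuous f}, W (f y), A (f y) = G y &
    forall j, smooth_germ y (fun y => G y 0 j)].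
  have h1 : \forall y \near x, W (f y).
    by apply: (nbhs_singleton fc); apply: open_nbhs_nbhs; split.
  have h2 : \forall y \near x, forall j, smooth_germ y (fun y => G y 0 j).
    by apply: (nbhs_forall (P := fun j y => smooth_germ y (fun z => G z 0 j))) => j; exact: smooth_germ_near.
  by apply: filterS (filterI (filterI fc h1) (filterI AG h2)) => y [[? ?] [? ?]].
pose U := [set y | [/\ {for y, continuous f}, W (f y), A (f y) = G y &
    forall j, smooth_germ y (fun y => G y 0 j)]]°.
have oU : open U by exact: open_interior.
have UP y : U y -> [/\ {for y, continuous f}, W (f y), A (f y) = G y &
    forall j, smooth_germ y (fun y => G y 0 j)] by exact: interior_subset.
have CG k j : Ck k U (fun y => G y 0 j).
  by apply: Ck_local => y /UP[_ _ _ /(_ j)[V [oV Vz] CV]]; exists V.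
have dG y v : U y -> derivable G y v.
  move=> /UP[_ _ _ sGy]; apply/derivable_mxP => i j; rewrite ord1.
  exact: smooth_germ_derivable.
have df y v : U y -> is_derive y v f ('D_v G y *m invmx (Jac A (f y))).
  move=> Uy; have [fy Wy _ _] := UP y Uy.
  apply: (is_derive_lift oW (CA 1%N) Wy (WA _ Wy) fy); last exact: dG.
  have : \forall z \near y, U z by apply: open_nbhs_nbhs.
  by apply: filterS => z /UP[].
have CJ k i j : Ck k W (fun z => invmx (Jac A z) i j).
  apply: Ck_invmx => // i' j'; rewrite (_ : (fun z => _) = 'D_(delta_mx 0 i') (fun z => A z 0 j' : R^o)).
    exact: Ck_derive (CA k.+1 j').
  by apply/funext => z; rewrite mxE.
move=> j; exists U => // k; elim: k j => [|k IH] j.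
  by split=> // y /UP[fy _ _ _]; move/continuous_rowP: fy.
split; first by move=> y /UP[fy _ _ _]; move/continuous_rowP: fy.
move=> v; split.
  by move=> y Uy; have [/derivable_mxP d _] := df y v Uy; exact: d.
apply: (@Ck_ext _ _ _ _ (fun y => \sum_l 'D_v (fun y => G y 0 l : R^o) y *
    ((fun z => invmx (Jac A z) l j : R^o) \o f) y)) => //.
  move=> y; rewrite inE => Uy; have [d1 d2] := df y v Uy.
  rewrite -(derive_row j d1) d2 mxE; apply: eq_bigr => l _.
  by rewrite (derive_row l (dG y v Uy)).
apply: Ck_sum => // l _; apply: CkM => //; first exact: Ck_derive (CG k.+1 l).
by apply: (@Ck_comp _ _ _ _ U W) => // y /UP[].
Qed.

End lift.

Section embedding_lift.
Variables (R : realType) (m n : nat) (S : manifold R m) (M : manifold R n).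

(** Injectivity on tangent spaces is stated in the selected charts; transition Jacobians carry it to
    d and e, where a matrix with trivial left kernel has a right inverse. *)
Lemma embedding_row_free (Q : S -> M) (d : chart R S m) (e : chart R M n) s :
  embedding Q -> atlas d -> atlas e -> chart_dom d s -> chart_dom e (Q s) ->
  exists B, chart_Jac d e Q s *m B = 1%:M.
Proof.
move=> [sQ iQ _ _] ad ae ds eQs; apply/row_freeP; rewrite -kermx_eq0; apply/eqP.
set A := chart_Jac d e Q s.
have key (v : 'rV[R]_m) : v *m A = 0 -> v = 0.
  set c := chart_at s; set c' := chart_at (Q s) => vA.
  have ac : atlas c := chart_at_atlas s; have cs : chart_dom c s := chart_at_dom s.
  have ac' : atlas c' := chart_at_atlas (Q s).
  have cs' : chart_dom c' (Q s) := chart_at_dom (Q s).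
  have sid := @smooth_map_id _ _ S; have sid' := @smooth_map_id _ _ M.
  have E : chart_Jac d c id s *m chart_Jac c c' Q s = A *m chart_Jac e c' id (Q s).
    rewrite -(chart_Jac_comp (f := @id S) (g := Q) sid sQ ad ac ac' ds cs cs').
    by rewrite -(chart_Jac_comp (f := Q) (g := @id M) sQ sid' ad ae ac' ds eQs cs').
  have u0 : v *m chart_Jac d c id s = 0.
    apply: (iQ s); rewrite !tangent_mapE// mul0mx -mulmxA E mulmxA vA mul0mx//.
  by rewrite -[v]mulmx1 -(chart_Jac_idK ad ac ds cs) mulmxA u0 mul0mx.
apply/row_matrixP => i; rewrite row0; apply: key.
by rewrite -row_mul mulmx_ker row0.
Qed.

(** Continuity of psi comes from Q1 being open onto its range; smoothness is then a regularity
    question for a continuous solution. *)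
Lemma embedding_lift_smooth (Q1 Q2 : S -> M) (psi : S -> S) :
  embedding Q1 -> smooth_map Q2 -> (forall s, Q1 (psi s) = Q2 s) -> smooth_map psi.
Proof.
move=> eQ1 sQ2 Q12; have [sQ1 _ injQ1 homQ1] := eQ1.
have pc : continuous psi.
  apply/continuousP => U oU; have [V oV VU] := homQ1 U oU.
  rewrite (_ : psi @^-1` U = Q2 @^-1` V).
    by apply: open_comp => // s _; exact: (smooth_map_continuous sQ2).
  apply/seteqP; split=> s /=.
    move=> Us; have [+ _] : (V `&` range Q1) (Q1 (psi s)) by rewrite -VU; exists (psi s).
    by rewrite Q12.
  move=> Vs; have : (V `&` range Q1) (Q2 s) by split=> //; exists (psi s).
  by rewrite -VU -Q12 => -[t Ut /injQ1 <-].
apply/smooth_mapP; split=> // x d ad dpx j.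
have [c ac cx] := atlas_ex x.
have [e ae eq] := atlas_ex (Q2 x).
have eq1 : chart_dom e (Q1 (psi x)) by rewrite Q12.
have [B JB] := embedding_row_free eQ1 ad ae dpx eq1.
exists c => //.
pose f := d \o psi \o chart_inv c.
pose F := e \o Q1 \o chart_inv d.
(* [A] is Q1 read in charts followed by the right inverse B of its Jacobian at psi x: a map between
   spaces of dimension m with identity Jacobian at that point. *)
pose A z := F z *m B; pose G y := (e \o Q2 \o chart_inv c) y *m B.
have sB k (H : 'rV[R]_k -> 'rV[R]_n) y : (forall j, smooth_germ y (fun z => H z 0 j)) ->
    forall j, smooth_germ y (fun z => (H z *m B) 0 j).
  move=> sH i; rewrite (_ : (fun z => _) = fun z => \sum_l H z 0 l * B l i : R^o).
    by apply: smooth_germ_sum => l _; apply: smooth_germM => //; exact: smooth_germ_cst.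
  by apply/funext => z; rewrite mxE.
have fx : f (c x) = d (psi x) by rewrite /f /= chart_mapK.
have sF : forall j, smooth_germ (f (c x)) (fun z => F z 0 j).
  by rewrite fx; exact: (local_smooth_germ sQ1 ad ae dpx eq1).
apply: (@smooth_germ_lift _ _ _ f A G (c x)).
- exact: sB.
- have -> : Jac A (f (c x)) = Jac F (f (c x)) *m B.
    rewrite -[in RHS](Jac_mulmxr B (F (f (c x)))) -Jac_comp//.
    by apply: (@sB _ id) => i; exact: smooth_germ_coord.
  rewrite fx -/(chart_Jac d e Q1 (psi x)) JB; exact: unitmx1.
- have : \forall y \near c x, chart_dom c (chart_inv c y) /\ c (chart_inv c y) = y /\
      chart_dom d (psi (chart_inv c y)).
    have hd : nbhs x (psi @^-1` chart_dom d) by apply: pc; exact: chart_dom_nbhs.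
    by apply: filterS (filterI (chart_near cx) (chart_inv_near cx hd)) => y [[? ?] ?].
  apply: filterS => y [cy [ey dy]]; rewrite /f.
  apply: (@continuous_comp _ _ _ (psi \o chart_inv c) d).
    apply: continuous_comp; last exact: pc.
    by rewrite -ey; exact: chart_inv_continuous.
  exact: chart_map_continuous.
- have hd : nbhs x (psi @^-1` chart_dom d) by apply: pc; exact: chart_dom_nbhs.
  apply: filterS (chart_inv_near cx hd) => y dy.
  by rewrite /A /F /G /f /= chart_mapK// Q12.
- apply: sB; exact: (local_smooth_germ sQ2 ac ae cx eq).
Qed.

End embedding_lift.

(** * The momentum map *)

Section density_integral.
Variables (R : realType) (m : nat) (S : manifold R m) (mu : volume_form S).
Hypothesis cS : compact [set: S].
Local Notation I := (@integral_rV R _).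

Let cs (p : partition_of_unity S) i (g : S -> R) : continuous g ->
  compactly_supported (chart_patch (pou_chart (p := p) i)
    (fun s => pou_fun (p := p) i s * (g s * density_of mu (coord_vector (pou_chart (p := p) i) s)))).
Proof.
move=> gc; set c := pou_chart i; have ac : atlas c := pou_atlas i.
apply: (@chart_patch_cs _ _ _ c _ (closure [set s | pou_fun (p := p) i s != 0])).
- move=> s sc; apply: continuousM; first exact/smooth_at_continuous/pou_fun_smooth_at.
  apply: continuousM; first exact: gc.
  by apply: smooth_at_continuous; apply: smooth_at_norm; [exact: volume_coord_neq0|exact: smooth_at_volume_coord].
- by apply: (subclosed_compact _ cS) => //; exact: closed_closure.
- exact: pou_support.
- move=> s _ ns; have -> : pou_fun i s = 0; last by rewrite mul0r.
  by apply/eqP; apply: contra_notT ns => ns; exact: subset_closure.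
Qed.

Lemma density_integralB (f g : S -> R) : continuous f -> continuous g ->
  density_integral (fun s v => (f s - g s) * density_of mu v) =
  density_integral (fun s v => f s * density_of mu v) -
  density_integral (fun s v => g s * density_of mu v).
Proof.
move=> fc gc; have [p] := partition_of_unity_ex cS.
have fgc : continuous (fun s => f s - g s).
  by move=> s; apply: (@continuousB _ R^o); [exact: fc|exact: gc].
rewrite !(density_integralE mu p)// !pou_integralE -sumrB; apply: eq_bigr => i _.
have [a aP] := cs (p := p) i fc; have [b bP] := cs (p := p) i gc.
have ac : a <= Num.max a b by rewrite le_max lexx.
have bc : b <= Num.max a b by rewrite le_max lexx orbT.
rewrite -(integral_rVB (csupp_le ac aP) (csupp_le bc bP)).
congr integral_rV; apply/funext => y.
have [[s sc <-]|ny] := pselect (chart_im (pou_chart (p := p) i) y).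
  by rewrite !chart_patchE// mulrBl mulrBr.
by rewrite !chart_patch_out// subrr.
Qed.

Lemma density_integral_gt0 (g : S -> R) s0 : continuous g ->
  (forall s, 0 <= g s) -> 0 < g s0 ->
  0 < density_integral (fun s v => g s * density_of mu v).
Proof.
move=> gc g0 gs0; have [p] := partition_of_unity_ex cS.
rewrite (density_integralE mu p)// pou_integralE.
have ge i y : 0 <= chart_patch (pou_chart (p := p) i)
    (fun s => pou_fun (p := p) i s * (g s * density_of mu (coord_vector (pou_chart (p := p) i) s))) y.
  have [[s sc <-]|ny] := pselect (chart_im (pou_chart (p := p) i) y).
    by rewrite chart_patchE// !mulr_ge0// ?pou_ge0// /density_of.
  by rewrite chart_patch_out.
have [i pi0] : exists i, 0 < pou_fun (p := p) i s0.
  apply: contrapT => /forallNP h.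
  have := pou_sum p s0; rewrite big1 => [/eqP|i _]; first by rewrite eq_sym oner_eq0.
  by apply/le_anti; rewrite pou_ge0 andbT leNgt; apply/negP/h.
rewrite (bigD1 i)//= ltr_pwDl//; last first.
  by apply: sumr_ge0 => j _; apply: integral_rV_ge0.
have ds0 : chart_dom (pou_chart (p := p) i) s0.
  by apply: pou_support; apply: subset_closure; rewrite /= gt_eqF.
have [b bP] := cs (p := p) i gc.
apply: (@integral_rV_gt0 _ _ _ _ (pou_chart (p := p) i s0) bP (ge i)).
rewrite chart_patchE// !mulr_gt0// /density_of normr_gt0.
exact: (volume_coord_neq0 mu (pou_atlas i) ds0).
Qed.

Lemma density_integral0 : density_integral (fun s v => 0 * density_of mu v) = 0.
Proof.
have := @density_integralB (fun=> 0) (fun=> 0); rewrite subrr => h.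
have {}h := h _ _; rewrite [LHS]h ?subrr//; exact: cst_continuous.
Qed.

End density_integral.

Section cotangent_maps.
Variables (R : realType) (m n : nat) (S : manifold R m) (M : manifold R n).

Lemma smooth_cotangent_mapP (P : S -> cotangent_bundle M) :
  smooth_cotangent_map P <-> smooth_map (@cotangent_proj R n M \o P) /\
  forall x (d : chart R M n), atlas d -> chart_dom d (cotangent_proj (P x)) ->
    forall j, smooth_at x (fun s => cotangent_coord d (projT2 (P s)) 0 j).
Proof.
have od (fc : continuous (@cotangent_proj R n M \o P)) (d : chart R M n) :
    open ((@cotangent_proj R n M \o P) @^-1` chart_dom d).
  by apply: open_comp => //; exact: chart_dom_open.
split=> -[sP H]; split=> //; have fc := smooth_map_continuous sP.
- move=> x d ad dx; have [c ac cx] := atlas_ex x.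
  have /(smooth_in_chart_rowP _ ac (od fc d)) h := H c d ac ad.
  by move=> j; exact: (h x cx dx j).
- move=> c d ac ad; apply/(smooth_in_chart_rowP _ ac (od fc d)) => x cx dx j.
  exact: H.
Qed.

Lemma smooth_at_vector_field (X : vector_field M) y (d : chart R M n) j :
  atlas d -> chart_dom d y -> smooth_at y (fun z => tangent_coord d (X z) 0 j).
Proof.
move=> ad dy; have := vector_field_smooth X ad.
by move=> /(smooth_in_chart_rowP _ ad openT) h; exact: (h y dy Logic.I j).
Qed.

Lemma smooth_at_pairing (P : S -> cotangent_bundle M) (X : vector_field M) s :
  smooth_cotangent_map P -> smooth_at s (fun s => pairing (projT2 (P s)) (X (cotangent_proj (P s)))).
Proof.
move=> /smooth_cotangent_mapP[sP cP].
have [d ad ds] := atlas_ex (cotangent_proj (P s)).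
apply: (@smooth_at_ext _ _ _ _ (fun s => \sum_i tangent_coord d (X (cotangent_proj (P s))) 0 i *
    cotangent_coord d (projT2 (P s)) 0 i)).
  have : nbhs s ((@cotangent_proj R n M \o P) @^-1` chart_dom d).
    by apply: (smooth_map_continuous sP); exact: chart_dom_nbhs.
  by apply: filterS => t dt; rewrite (pairing_coord (c := d)).
apply: smooth_at_sum => i _; apply: smooth_atM; last exact: cP.
apply: (@smooth_at_comp _ _ _ _ _ (@cotangent_proj R n M \o P) (fun y => tangent_coord d (X y) 0 i)) => //.
exact: smooth_at_vector_field.
Qed.

(** In a chart d near Q s0 the field has constant components, those of w s0, multiplied by a bump.
    At s0 the pairing is the bump times a sum of squares, and by continuity its sign persists for s
    near s0. *)
Lemma test_vector_field (Q : S -> M) (w : forall s, cotangent (Q s)) s0 (O : set M) :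
  embedding Q ->
  (forall s (d : chart R M n) j, atlas d -> chart_dom d (Q s) ->
    {for s, continuous (fun t => cotangent_coord d (w t) 0 j : R)}) ->
  w s0 != 0 :> 'cV[R]_n -> nbhs (Q s0) O ->
  exists X : vector_field M, [/\ forall y, ~ O y -> X y = 0 :> 'rV[R]_n,
    forall s, 0 <= pairing (w s) (X (Q s)) & 0 < pairing (w s0) (X (Q s0))].
Proof.
move=> [sQ _ injQ homQ] wc w0 QO.
have [d ad ds0] := atlas_ex (Q s0).
pose a : 'rV[R]_n := cotangent_coord d (w s0).
have a0 : a != 0.
  apply: contra_neq w0 => a0; apply/matrixP => i j; rewrite ord1 [RHS]mxE.
  have := pairing_coord (w s0) (delta_mx 0 i : 'rV[R]_n) ad ds0.
  rewrite /pairing -rowE mxE => ->; apply: big1 => k _.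
  by rewrite -/a a0 mxE mulr0.
pose f t := \sum_i a 0 i * cotangent_coord d (w t) 0 i.
have fs0 : 0 < f s0.
  rewrite lt_neqAle; apply/andP; split; last by apply: sumr_ge0 => i _; rewrite -expr2 sqr_ge0.
  apply: contra_neqN a0 => /eqP h; apply/rowP => i; rewrite [RHS]mxE; apply/eqP.
  have /eqP := esym h; rewrite psumr_eq0 => [/allP/(_ i)|j _]; last by rewrite -expr2 sqr_ge0.
  by rewrite mem_index_enum => /(_ isT) /=; rewrite -/a mulf_eq0 orbb.
have fc : {for s0, continuous f}.
  have -> : f = \sum_i (fun t => a 0 i * cotangent_coord d (w t) 0 i).
    by apply/funext => t; rewrite fct_sumE.
  apply: (big_ind (fun g : S -> R => {for s0, continuous g})).
  - exact: cst_continuous.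
  - by move=> g h gc hc; exact: (@continuousD _ R^o).
  - by move=> i _; apply: continuousM; [exact: cst_continuous|exact: wc].
have : nbhs s0 [set t | 0 < f t] by exact: (cvgr_gt (f s0) fc).
rewrite nbhsE => -[U [oU Us0] Uf].
(* V meets the range of Q only in Q(U), so a bump inside V sees no parameter outside U, where the
   sign of f is unknown. *)
have [V oV VU] := homQ U oU.
have Vs0 : V (Q s0) by have [] : (V `&` range Q) (Q s0) by rewrite -VU; exists s0.
have nW : nbhs (Q s0) (O `&` (V `&` chart_dom d)).
  by do !apply: filterI => //; [exact: open_nbhs_nbhs|exact: chart_dom_nbhs].
have [chi [schi chi0 chis0 chiW]] := manifold_bump nW.
have chiW' y : chi y != 0 -> [/\ O y, V y & chart_dom d y].
  by move=> cy; have [] := chiW y; [exact: subset_closure|move=> ? []].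
(* The constant vector a of the chart d, converted to the coordinates in which [tangent y] is
   expressed. *)
pose Xv (y : M) : tangent y := (chi y *: (a *m chart_Jac d (chart_at y) id y) : 'rV[R]_n).
have Xc c y : atlas c -> chart_dom c y -> chart_dom d y ->
    tangent_coord c (Xv y) = chi y *: (a *m chart_Jac d c id y).
  move=> ac cy dy; rewrite tangent_coordE// /Xv -scalemxAl -mulmxA; congr (_ *: (_ *m _)).
  rewrite -(chart_Jac_comp (f := @id M) (g := @id M) (@smooth_map_id _ _ M) (@smooth_map_id _ _ M)
    ad (chart_at_atlas y) ac dy (chart_at_dom y) cy).
  by [].
have Xs c : atlas c -> smooth_in_chart c setT (fun y => tangent_coord c (Xv y)).
  move=> ac; apply/(smooth_in_chart_rowP _ ac openT) => y cy _ j.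
  have [dy|ndy] := pselect (chart_dom d y).
    apply: (@smooth_at_ext _ _ _ _ (fun z => chi z * \sum_i a 0 i * chart_Jac d c id z i j)).
      apply: filterS (filterI (chart_dom_nbhs cy) (chart_dom_nbhs dy)) => z [cz dz].
      by rewrite Xc// mxE; congr (_ * _); rewrite mxE.
    apply: smooth_atM; first exact: schi.
    apply: smooth_at_sum => i _; apply: smooth_atM; first exact: smooth_at_cst.
    by apply: smooth_at_chart_Jac => //; exact: smooth_map_id.
  apply: (@smooth_at_ext _ _ _ _ (fun=> 0)); last exact: smooth_at_cst.
  have : nbhs y (~` closure [set x | chi x != 0]).
    apply: open_nbhs_nbhs; split; first by apply: closed_openC; exact: closed_closure.
    by move=> /chiW [_ []].
  move=> ny; apply: filterS (filterI (chart_dom_nbhs cy) ny) => z [cz nz].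
  have cz0 : chi z = 0 by apply/eqP; apply: contra_notT nz => nz; exact: subset_closure.
  by rewrite tangent_coordE// /Xv cz0 scale0r mul0mx mxE.
exists (VectorField Xs); split.
- move=> y nO; rewrite /= /Xv.
  have -> : chi y = 0 by apply/eqP; apply: contra_notT nO => /chiW'[].
  by rewrite scale0r.
- move=> s /=; have [c0|/chiW'[_ Vs ds]] := eqVneq (chi (Q s)) 0.
    by rewrite /pairing /Xv c0 scale0r mul0mx mxE.
  have [t Ut /injQ e] : (Q @` U) (Q s) by rewrite VU; split=> //; exists s.
  subst t; rewrite (pairing_coord (w s) (Xv (Q s)) ad ds) (Xc _ _ ad ds ds) chart_Jac_id// mulmx1.
  under eq_bigr do rewrite mxE -mulrA.
  by rewrite -mulr_sumr; apply: mulr_ge0; [exact: chi0|exact/ltW/Uf].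
- rewrite /= (pairing_coord (w s0) (Xv (Q s0)) ad ds0) (Xc _ _ ad ds0 ds0) chart_Jac_id// mulmx1.
  under eq_bigr do rewrite mxE -mulrA.
  by rewrite -mulr_sumr mulr_gt0.
Qed.

End cotangent_maps.

(** * The action of diffeomorphisms and the level sets of the momentum map *)

Section momentum_map.
Variables (R : realType) (m n : nat) (S : manifold R m) (M : manifold R n).
Variable mu : volume_form S.
Local Notation proj := (@cotangent_proj R n M).
Local Notation mud P := (mul_density P (density_of mu)).

Lemma tangent_map_comp (f g : S -> S) s (v : tangent s) : smooth_map f -> smooth_map g ->
  tangent_map (g \o f) v = tangent_map g (tangent_map f v).
Proof.
move=> sf sg; rewrite !tangent_mapE//; last exact: smooth_map_comp.
rewrite -mulmxA -(chart_Jac_comp (f := f) (g := g) sf sg (chart_at_atlas s) (chart_at_atlas (f s))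
  (chart_at_atlas (g (f s))) (chart_at_dom s) (chart_at_dom (f s)) (chart_at_dom (g (f s)))).
by [].
Qed.

Lemma tangent_map_id (s : S) (v : tangent s) : tangent_map id v = v.
Proof.
rewrite tangent_mapE; last exact: smooth_map_id.
by rewrite chart_Jac_id ?mulmx1//; exact: chart_at_dom.
Qed.

Lemma Diff_act_id (Phi : form_density S M) : Diff_act id Phi = Phi.
Proof.
case: Phi => Q w; rewrite /Diff_act /=; congr FormDensity.
apply: functional_extensionality_dep => s; apply/funext => v; congr (w s _).
by apply/funext => i; rewrite tangent_map_id.
Qed.

Lemma Diff_act_comp (g h : S -> S) (Phi : form_density S M) :
  smooth_map g -> smooth_map h -> Diff_act (g \o h) Phi = Diff_act h (Diff_act g Phi).
Proof.
move=> sg sh; case: Phi => Q w; rewrite /Diff_act /=; congr FormDensity.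
apply: functional_extensionality_dep => s; apply/funext => v; congr (w _ _).
by apply/funext => i; rewrite (tangent_map_comp _ sh sg).
Qed.

(* psi . (P |mu|) = (pull psi P) |mu| *)
Definition pull (psi : S -> S) (P : S -> cotangent_bundle M) (s : S) : cotangent_bundle M :=
  existT (@cotangent R n M) (proj (P (psi s))) (density_factor mu psi s *: projT2 (P (psi s)) : 'cV[R]_n).

Lemma Diff_actE psi P : smooth_map psi -> Diff_act psi (mud P) = mud (pull psi P).
Proof.
move=> sp; rewrite Diff_act_mul_density /mul_density; congr FormDensity.
apply: functional_extensionality_dep => s; apply/funext => v.
by rewrite /= density_pullbackE// scalerA mulrC.
Qed.

Section diffeo.
Variables (psi psi' : S -> S) (P : S -> cotangent_bundle M).
Hypothesis sp : smooth_map psi.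
Hypothesis sp' : smooth_map psi'.
Hypothesis K : cancel psi psi'.
Hypothesis K' : cancel psi' psi.
Hypothesis sP : smooth_cotangent_map P.

Lemma pull_smooth : smooth_cotangent_map (pull psi P).
Proof.
move/smooth_cotangent_mapP: sP => [sQ cP]; apply/smooth_cotangent_mapP; split.
  exact: (smooth_map_comp sp sQ).
move=> x d ad dx j.
rewrite (_ : (fun s => _) = fun s => density_factor mu psi s *
    (((fun t => cotangent_coord d (projT2 (P t)) 0 j) \o psi) s)).
  apply: smooth_atM; first exact: (smooth_at_density_factor mu x sp sp' K).
  by apply: (smooth_at_comp sp); exact: cP.
apply/funext => s; rewrite /= !mxE /pairing /=.
by rewrite -scalemxAr mxE.
Qed.

Lemma pull_embedding : embedding (proj \o P) -> embedding (proj \o pull psi P).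
Proof.
move=> [sQ iQ injQ homQ]; have sQp : smooth_map ((proj \o P) \o psi) := smooth_map_comp sp sQ.
split=> //.
- move=> s u v; rewrite -/((proj \o P) \o psi).
  have E (w : tangent s) : tangent_map ((proj \o P) \o psi) w =
      tangent_map (proj \o P) (tangent_map psi w).
    rewrite !tangent_mapE// -mulmxA.
    rewrite -(chart_Jac_comp (f := psi) (g := proj \o P) sp sQ (chart_at_atlas s) (chart_at_atlas (psi s))
      (chart_at_atlas _) (chart_at_dom s) (chart_at_dom (psi s)) (chart_at_dom _)).
    by [].
  rewrite !E => /iQ e.
  have F (w : tangent s) : w = (tangent_map psi w : 'rV[R]_m) *m
      chart_Jac (chart_at (psi s)) (chart_at s) psi' (psi s) :> 'rV[R]_m.
    rewrite tangent_mapE// -mulmxA -(chart_Jac_comp (f := psi) (g := psi') sp sp' (chart_at_atlas s)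
      (chart_at_atlas (psi s)) (chart_at_atlas s) (chart_at_dom s) (chart_at_dom (psi s))).
      by rewrite (_ : psi' \o psi = id) ?chart_Jac_id ?mulmx1//; [exact: chart_at_dom|apply/funext => x; rewrite /= K].
    by rewrite K; exact: chart_at_dom.
  by rewrite [u]F [v]F e.
- by move=> s t /injQ /(can_inj K).
- move=> U oU; have oU' : open (psi' @^-1` U).
    by apply: open_comp => // s _; exact: (smooth_map_continuous sp').
  have [V oV VU] := homQ _ oU'; exists V => //.
  have E : (proj \o pull psi P) @` U = (proj \o P) @` (psi' @^-1` U).
    apply/seteqP; split=> _ [s Us <-].
      by exists (psi s) => //=; rewrite K.
    by exists (psi' s) => //=; rewrite K'.
  have F : range (proj \o pull psi P) = range (proj \o P).
    apply/seteqP; split=> _ [s _ <-]; first by exists (psi s).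
    by exists (psi' s) => //=; rewrite K'.
  by rewrite E F.
Qed.

Lemma pull_neq0 : (forall s, projT2 (P s) != 0) -> forall s, projT2 (pull psi P s) != 0.
Proof.
move=> P0 s; rewrite scaler_eq0 negb_or P0 andbT.
exact: (density_factor_neq0 mu s sp sp' K).
Qed.

(** The vector field is evaluated along the moved base map Q o psi, so the integrand for the moved
    element is the pullback of the original integrand as a density. *)
Lemma J_L_Diff_act : compact [set: S] -> J_L (Diff_act psi (mud P)) = J_L (mud P).
Proof.
move=> cS; apply/funext => X; rewrite Diff_act_mul_density !J_L_mul_density.
have [p] := partition_of_unity_ex cS.
apply: (@density_integral_pullback _ _ _ mu p psi psi'
  (fun s => pairing (projT2 (P s)) (X (proj (P s)))) cS sp sp' K K').
by move=> s; apply: smooth_at_continuous; exact: smooth_at_pairing.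
Qed.

End diffeo.

Lemma cotangent_bundle_eq (a b : cotangent_bundle M) :
  projT1 a = projT1 b -> projT2 a = projT2 b :> 'cV[R]_n -> a = b.
Proof. by case: a => x p; case: b => y q /= e; subst y => ->. Qed.

Lemma smooth_at_cotangent_coord (Q : S -> M) (P : S -> cotangent_bundle M) s (d : chart R M n) j :
  (forall s, proj (P s) = Q s) -> smooth_cotangent_map P -> atlas d -> chart_dom d (Q s) ->
  smooth_at s (fun t => @cotangent_coord R n M d (Q t) (projT2 (P t) : 'cV[R]_n) 0 j).
Proof.
move=> PQ /smooth_cotangent_mapP[_ cP] ad dQ.
have -> : (fun t => @cotangent_coord R n M d (Q t) (projT2 (P t) : 'cV[R]_n) 0 j) =
    fun t => cotangent_coord d (projT2 (P t)) 0 j by apply/funext => t; rewrite -[Q t]PQ.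
by apply: cP => //; rewrite PQ.
Qed.

(** Two elements over the same base map are to be subtracted under the integral, so the covectors of
    both are read over one Q. *)
Lemma J_L_baseE (Q : S -> M) (P : S -> cotangent_bundle M) (X : vector_field M) :
  (forall s, proj (P s) = Q s) ->
  J_L (mud P) X = density_integral (fun s v =>
    @pairing R n M (Q s) (projT2 (P s) : 'cV[R]_n) (X (Q s)) * density_of mu v).
Proof.
move=> PQ; rewrite J_L_mul_density; congr density_integral.
apply: functional_extensionality_dep => s; apply/funext => v; congr (_ * _).
by rewrite -[Q s]PQ.
Qed.

Lemma J_L_continuous (Q : S -> M) (P : S -> cotangent_bundle M) (X : vector_field M) :
  (forall s, proj (P s) = Q s) -> smooth_cotangent_map P ->
  continuous (fun s => @pairing R n M (Q s) (projT2 (P s) : 'cV[R]_n) (X (Q s))).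
Proof.
move=> PQ sP; rewrite (_ : (fun s => _) = fun s => pairing (projT2 (P s)) (X (proj (P s)))).
  by move=> s; apply: smooth_at_continuous; exact: smooth_at_pairing.
by apply/funext => s; rewrite -[Q s]PQ.
Qed.

Lemma cotangent_coordB (d : chart R M n) x (p q : 'cV[R]_n) j :
  @cotangent_coord R n M d x (p - q) 0 j =
  @cotangent_coord R n M d x p 0 j - @cotangent_coord R n M d x q 0 j.
Proof. by rewrite !mxE /pairing mulmxBr !mxE. Qed.

(* The type [cotangent x] does not depend on [x], so that covectors over
   propositionally equal base points are subtracted without transport. *)
Lemma J_L_base_inj (P1 P2 : S -> cotangent_bundle M) : compact [set: S] ->
  smooth_cotangent_map P1 -> smooth_cotangent_map P2 ->
  embedding (proj \o P2) -> (forall s, proj (P1 s) = proj (P2 s)) ->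
  J_L (mud P1) = J_L (mud P2) -> P1 = P2.
Proof.
move=> cS s1 s2 emb PQ J12; apply/funext => s0; apply: cotangent_bundle_eq; first exact: PQ.
apply: contrapT => /eqP; rewrite -subr_eq0 => w0.
pose Q := proj \o P2; pose w s : cotangent (Q s) := (projT2 (P1 s) : 'cV[R]_n) - (projT2 (P2 s) : 'cV[R]_n).
have Q2 s : proj (P2 s) = Q s by [].
(* Only the covector of w at s0 has to be detected and no region has to be avoided, so the
   neighbourhood is all of M. *)
have [X [_ X0 Xs0]] : exists X : vector_field M, [/\ forall y, ~ [set: M] y -> X y = 0 :> 'rV[R]_n,
    forall s, 0 <= pairing (w s) (X (Q s)) & 0 < pairing (w s0) (X (Q s0))].
  apply: test_vector_field => //; last exact: filterT.
  move=> s d j ad ds.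
  rewrite (_ : (fun t => _) = fun t => @cotangent_coord R n M d (Q t) (projT2 (P1 t) : 'cV[R]_n) 0 j
      - @cotangent_coord R n M d (Q t) (projT2 (P2 t) : 'cV[R]_n) 0 j).
    by apply: (@continuousB _ R^o); apply: smooth_at_continuous; exact: smooth_at_cotangent_coord.
  by apply/funext => t; rewrite cotangent_coordB.
have := congr1 (fun J => J X) J12.
rewrite /= (J_L_baseE X PQ) (J_L_baseE X Q2) => /eqP; rewrite -subr_eq0.
rewrite -(density_integralB mu cS (J_L_continuous (X := X) PQ s1) (J_L_continuous (X := X) Q2 s2)).
have E s : @pairing R n M (Q s) (projT2 (P1 s) : 'cV[R]_n) (X (Q s)) -
    @pairing R n M (Q s) (projT2 (P2 s) : 'cV[R]_n) (X (Q s)) = pairing (w s) (X (Q s)).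
  by rewrite /pairing /w mulmxBr !mxE.
rewrite (_ : (fun s v => _) = fun s v => pairing (w s) (X (Q s)) * density_of mu v); last first.
  by apply: functional_extensionality_dep => s; apply/funext => v; rewrite E.
apply/negP; rewrite gt_eqF//; apply: (density_integral_gt0 mu cS _ X0 Xs0).
rewrite (_ : (fun s => _) = fun s => @pairing R n M (Q s) (projT2 (P1 s) : 'cV[R]_n) (X (Q s)) -
    @pairing R n M (Q s) (projT2 (P2 s) : 'cV[R]_n) (X (Q s))); last by apply/funext => s; rewrite E.
have c1 := J_L_continuous (X := X) PQ s1; have c2 := J_L_continuous (X := X) Q2 s2.
by move=> s; exact: (@continuousB R R^o S _ _ s (c1 s) (c2 s)).
Qed.

Lemma J_L_range_sub (P1 P2 : S -> cotangent_bundle M) : compact [set: S] ->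
  smooth_cotangent_map P1 -> smooth_cotangent_map P2 ->
  embedding (proj \o P1) -> (forall s, projT2 (P1 s) != 0) ->
  J_L (mud P1) = J_L (mud P2) -> forall s, exists t, proj (P2 t) = proj (P1 s).
Proof.
move=> cS s1 s2 emb P0 J12 s0; apply: contrapT => /forallNP nt.
have sQ2 : smooth_map (proj \o P2) by case: s2.
have cr : closed (range (proj \o P2)).
  apply: compact_closed; first exact: manifold_hausdorff.
  by apply: compact_image => // s _; exact: (smooth_map_continuous sQ2).
have nO : nbhs ((proj \o P1) s0) (~` range (proj \o P2)).
  by apply: open_nbhs_nbhs; split; [exact: closed_openC|move=> [t _ /nt]].
have [X [XO X0 Xs0]] : exists X : vector_field M,
    [/\ forall y, ~ (~` range (proj \o P2)) y -> X y = 0 :> 'rV[R]_n,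
    forall s, 0 <= pairing (projT2 (P1 s)) (X ((proj \o P1) s)) &
    0 < pairing (projT2 (P1 s0)) (X ((proj \o P1) s0))].
  apply: (@test_vector_field _ _ _ _ _ (proj \o P1) (fun s => projT2 (P1 s))) => //.
  move=> s d j ad ds; apply: smooth_at_continuous.
  exact: (smooth_at_cotangent_coord (Q := proj \o P1) (P := P1)).
have := congr1 (fun J => J X) J12.
rewrite /= !J_L_mul_density => /eqP.
rewrite [X in _ == X](_ : _ = 0).
  rewrite gt_eqF//; apply: (density_integral_gt0 mu cS _ X0 Xs0).
  by move=> s; apply: smooth_at_continuous; exact: smooth_at_pairing.
rewrite -[RHS](density_integral0 mu cS); congr density_integral.
apply: functional_extensionality_dep => s; apply/funext => v; congr (_ * _).
by rewrite /pairing XO ?mul0mx ?mxE// => h; apply: h; exists s.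
Qed.

End momentum_map.

Theorem proposition5p2 (R : realType) (m n : nat)
    (S : manifold R m) (M : manifold R n)
    (S_compact : compact [set: S]) (mu : volume_form S)
    (lambda : vector_field M -> R) :
  transitive_right_action (@diffeomorphism R m S) (@Diff_act R m n S M)
    (@J_L_level R m n S M mu lambda).
Proof.
split.
- move=> psi _ [sp [psi' [sp' K K']]] [[P [sP eP P0 ->]] <-]; split; last exact: J_L_Diff_act sp' K K' _ _.
  exists (pull mu psi P); split.
  + exact: pull_smooth sp' K _.
  + exact: (pull_embedding mu sp sp' K K').
  + exact: pull_neq0 sp' K P0.
  + exact: Diff_actE.
- by move=> Phi _; exact: Diff_act_id.
- by move=> g h Phi [sg _] [sh _] _; exact: Diff_act_comp.
- move=> _ _ [[P1 [s1 e1 n1 ->]] J1] [[P2 [s2 e2 n2 ->]] J2].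
  have J12 := etrans J1 (esym J2).
  (* The comparison of ranges is used in both directions; injectivity of Q1 and Q2 makes the two
     choices mutually inverse. *)
  have [psi psiP] := choice (J_L_range_sub S_compact s2 s1 e2 n2 (esym J12)).
  have [psi' psi'P] := choice (J_L_range_sub S_compact s1 s2 e1 n1 J12).
  have [sQ1 _ inj1 _] := e1; have [sQ2 _ inj2 _] := e2.
  have K : cancel psi psi' by move=> s; apply: inj2; rewrite /= psi'P psiP.
  have K' : cancel psi' psi by move=> s; apply: inj1; rewrite /= psiP psi'P.
  have sp : smooth_map psi := embedding_lift_smooth e1 sQ2 psiP.
  have sp' : smooth_map psi' := embedding_lift_smooth e2 sQ1 psi'P.
  exists psi; first by split=> //; exists psi'.
  rewrite (Diff_actE mu P1 sp); congr (mul_density _ _).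
  (* Invariance keeps the momentum of the moved element equal to that of P2, now over the same base
     map. *)
  have J21 : J_L (mul_density (pull mu psi P1) (density_of mu)) = J_L (mul_density P2 (density_of mu)).
    rewrite -(Diff_actE mu P1 sp) (J_L_Diff_act mu sp sp' K K' s1 S_compact).
    exact: J12.
  exact: (J_L_base_inj S_compact (pull_smooth mu sp sp' K s1) s2 e2 psiP J21).
Qed.
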